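(* Let $k$ be a field and let $K$ and $L$ be two extension fields of $k$ such that $K\otimes_k L$ is Noetherian. Let $K_s$ be the (not necessarily algebraic) separable closure of $k$ in $K$ and $K_i$ the (algebraic) purely inseparable closure of $k$ in $K$, in the sense specified in the context. Assume that $K=K_sK_i$ (the composite field of $K_s$ and $K_i$ in $K$), and let $K_i=k(S)$ for some generating subset $S$ of $K_i$. View $K_i$ and $L$ as subfields of a common algebraic closure $\overline{L}$ of $L$. Then the following assertions are equivalent: (i) $K\otimes_k L$ is regular; (ii) $K_i\otimes_k L$ is a domain; (iii) $K_i\otimes_k L$ is a field; (iv) $[k(S'):k]=[L(S'):L]$ for each finite subset $S'$ of $S$; (v) $K_i\cap L(S')=k(S')$ for each finite subset $S'$ of $S$.
   Context: A ring is regular if it is Noetherian and its localizations at all prime ideals are regular local rings (a Noetherian local ring $(R,\mathfrak{m})$ is regular if its Krull dimension equals $\dim_{R/\mathfrak{m}}\mathfrak{m}/\mathfrak{m}^2$). A transcendence base $T$ of an extension field $E$ over $k$ is separating if $E$ is separable algebraic over $k(T)$. An extension field $E$ of $k$ (not necessarily algebraic) is separable over $k$ if every finitely generated intermediate field between $k$ and $E$ has a separating transcendence base over $k$. $K_s$ denotes the (not necessarily algebraic) separable closure of $k$ in $K$, understood as an intermediate field $k\subseteq K_s\subseteq K$ that is separable over $k$ and maximal with this property. $K_i$ denotes the purely inseparable closure of $k$ in $K$: the set of elements of $K$ that are purely inseparable (algebraic) over $k$, i.e. if $\operatorname{char}(k)=p>0$, the elements $x\in K$ with $x^{p^n}\in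 k$ for some $n\ge 0$, and $K_i=k$ if $\operatorname{char}(k)=0$. Since $K_i$ is purely inseparable over $k$, there is a unique $k$-homomorphism $u:K_i\to\overline{L}$, where $\overline{L}$ is an algebraic closure of $L$; $K_i$ is identified with its image $u(K_i)$, and the fields $L(S')$, $k(S')$ and the intersection $K_i\cap L(S')$ are taken inside $\overline{L}$. *)

(* Defs.v *)
From HB Require Import structures.
(* The notations of mpoly clash with those of classical_sets, and its name
   "symmetric" with that of ssrbool. *)
From mathcomp Require Import -(notations) mpoly.
From mathcomp Require Import all_boot all_algebra all_field ring.
From mathcomp Require Import boolp classical_sets functions cardinality.

Set Implicit Arguments.
Unset Strict Implicit.
Unset Printing Implicit Defensive.

Import GRing.Theory.
Local Open Scope ring_scope.
Local Open Scope quotient_scope.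
Local Open Scope classical_set_scope.

Section RingPredicates.
Variable A : comPzRingType.

Definition is_ideal (I : set A) : Prop :=
  [/\ I 0, (forall x y, I x -> I y -> I (x + y))
         & (forall a x, I x -> I (a * x))].

Definition is_prime_ideal (P : set A) : Prop :=
  [/\ is_ideal P, ~ P 1 & forall x y, P (x * y) -> P x \/ P y].

Definition is_maximal_ideal (M : set A) : Prop :=
  [/\ is_ideal M, ~ M 1
    & forall I, is_ideal I -> ~ I 1 -> M `<=` I -> I = M].

Definition noetherian : Prop :=
  forall I, is_ideal I -> exists s : seq A, I = smallest is_ideal [set` s].

Definition is_domain : Prop :=
  (1 : A) <> 0 /\ GRing.integral_domain_axiom A.

Definition is_field : Prop :=
  (1 : A) <> 0 /\ forall x : A, x <> 0 -> exists y, x * y = 1.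

(* The length of the chain p_0 < ... < p_n is n. *)
Definition has_prime_chain (n : nat) : Prop :=
  exists p : nat -> set A,
    (forall i, (i <= n)%N -> is_prime_ideal (p i)) /\
    (forall i, (i < n)%N -> p i `<` p i.+1).

Definition krull_dim_eq (d : nat) : Prop :=
  has_prime_chain d /\ forall n, has_prime_chain n -> (n <= d)%N.

Definition ideal_square (I : set A) : set A :=
  smallest is_ideal [set z | exists x y, [/\ I x, I y & z = x * y]].

(* dim_{A/M} M/M^2 = d: the classes of x_0, ..., x_(d-1) form a basis of M/M^2
   over A/M, written with representatives in M and in A. *)
Definition cotangent_dim_eq (M : set A) (d : nat) : Prop :=
  exists x : 'I_d -> A,
    [/\ forall i, M (x i),
        forall y, M y -> exists a : 'I_d -> A,
          ideal_square M (y - \sum_i a i * x i)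
      & forall a : 'I_d -> A,
          ideal_square M (\sum_i a i * x i) -> forall i, M (a i)].

Definition regular_local : Prop :=
  noetherian /\ exists M : set A,
    [/\ is_maximal_ideal M, (forall M', is_maximal_ideal M' -> M' = M)
      & exists d, krull_dim_eq d /\ cotangent_dim_eq M d].

Record prime_ideal := PrimeIdeal {
  prime_set : set A;
  prime_setP : is_prime_ideal prime_set
}.

End RingPredicates.

(* The localization A_P: fractions a/s with s outside P, where a/s = b/t if and
   only if u(at - bs) = 0 for some u outside P. *)
Section Localization.
Variables (A : comPzRingType) (p : prime_ideal A).
Local Notation P := (prime_set p).

Definition fraction := {x : A * A | x.2 \notin P}.
Implicit Types x y z : fraction.

Let num x := (val x).1.
Let den x := (val x).2.

Let den_notin x : ~ P (den x).
Proof. by rewrite -notin_setE; apply: (valP x). Qed.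

Let mul_notin (s t : A) : ~ P s -> ~ P t -> ~ P (s * t).
Proof. by have [_ _ PM] := prime_setP p; move=> ? ? /PM[]. Qed.

Let one_notin : ~ P 1. Proof. by have [] := prime_setP p. Qed.

Let notin_mem (s : A) : ~ P s -> s \notin P.
Proof. by rewrite notin_setE. Qed.

Definition mkfraction (a s : A) (Ps : ~ P s) : fraction :=
  exist _ (a, s) (notin_mem Ps).

Definition fraction_eqv x y : bool :=
  `[< exists2 u, ~ P u & u * (num x * den y - num y * den x) = 0 >].

Lemma fraction_eqv_refl : reflexive fraction_eqv.
Proof.
by move=> x; apply/asboolP; exists 1; [exact: one_notin | rewrite subrr mulr0].
Qed.

Lemma fraction_eqv_sym : symmetric fraction_eqv.
Proof.
move=> x y; apply/idP/idP => /asboolP[u Pu e]; apply/asboolP; exists u => //;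
  by rewrite -opprB mulrN e oppr0.
Qed.

Lemma fraction_eqv_trans : transitive fraction_eqv.
Proof.
move=> y x z /asboolP[u Pu e] /asboolP[v Pv e']; apply/asboolP.
exists (u * v * den y).
  by apply: mul_notin; [exact: mul_notin | exact: den_notin].
have -> : u * v * den y * (num x * den z - num z * den x) =
    v * den z * (u * (num x * den y - num y * den x)) +
    u * den x * (v * (num y * den z - num z * den y)) by ring.
by rewrite e e' !mulr0 addr0.
Qed.

Canonical fraction_eqv_rel :=
  EquivRel fraction_eqv fraction_eqv_refl fraction_eqv_sym fraction_eqv_trans.

Definition localization := {eq_quot fraction_eqv}.
HB.instance Definition _ := Choice.on localization.
HB.instance Definition _ := EqQuotient.on localization.

Definition to_frac a s (Ps : ~ P s) : localization :=
  \pi_localization (mkfraction a Ps).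

Let num_den x : x = mkfraction (num x) (@den_notin x).
Proof. by apply: val_inj; apply: surjective_pairing. Qed.

Lemma to_fracP (t : localization) :
  exists a s (Ps : ~ P s), t = to_frac a Ps.
Proof.
elim/quotW: t => x; exists (num x), (den x), (@den_notin x).
by rewrite /to_frac -num_den.
Qed.

Lemma to_frac_eq a s (Ps : ~ P s) b t (Pt : ~ P t) :
  to_frac a Ps = to_frac b Pt <->
  exists2 u, ~ P u & u * (a * t - b * s) = 0.
Proof.
split=> e; last by apply/eqmodP/asboolP.
have /eqmodP e' : mkfraction a Ps = mkfraction b Pt %[mod localization].
  exact: e.
exact/asboolP.
Qed.

Definition loc_zero : localization := to_frac 0 one_notin.
Definition loc_one : localization := to_frac 1 one_notin.
Definition loc_opp (t : localization) : localization :=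
  to_frac (- num (repr t)) (@den_notin (repr t)).
Definition loc_add (t t' : localization) : localization :=
  to_frac (num (repr t) * den (repr t') + num (repr t') * den (repr t))
    (mul_notin (@den_notin (repr t)) (@den_notin (repr t'))).
Definition loc_mul (t t' : localization) : localization :=
  to_frac (num (repr t) * num (repr t'))
    (mul_notin (@den_notin (repr t)) (@den_notin (repr t'))).

Let repr_frac a s (Ps : ~ P s) (x := repr (to_frac a Ps)) :
  exists2 u, ~ P u & u * (num x * s - a * den x) = 0.
Proof.
have /eqmodP/asboolP[u Pu e] : x = mkfraction a Ps %[mod localization].
  by rewrite reprK.
by exists u.
Qed.

Lemma loc_oppE a s (Ps : ~ P s) : loc_opp (to_frac a Ps) = to_frac (- a) Ps.
Proof.
have [u Pu e] := repr_frac a Ps; apply/to_frac_eq; exists u => //.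
by rewrite -[RHS]oppr0 -[in RHS]e; ring.
Qed.

Lemma loc_addE a s (Ps : ~ P s) b t (Pt : ~ P t) :
  loc_add (to_frac a Ps) (to_frac b Pt) =
  to_frac (a * t + b * s) (mul_notin Ps Pt).
Proof.
have [u Pu e] := repr_frac a Ps; have [v Pv e'] := repr_frac b Pt.
apply/to_frac_eq; exists (u * v); first exact: mul_notin.
set x := repr _ in e *; set y := repr _ in e' *.
transitivity (v * t * den y * (u * (num x * s - a * den x)) +
   u * s * den x * (v * (num y * t - b * den y))); first by ring.
by rewrite e e' !mulr0 addr0.
Qed.

Lemma loc_mulE a s (Ps : ~ P s) b t (Pt : ~ P t) :
  loc_mul (to_frac a Ps) (to_frac b Pt) = to_frac (a * b) (mul_notin Ps Pt).
Proof.
have [u Pu e] := repr_frac a Ps; have [v Pv e'] := repr_frac b Pt.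
apply/to_frac_eq; exists (u * v); first exact: mul_notin.
set x := repr _ in e *; set y := repr _ in e' *.
transitivity (v * t * num y * (u * (num x * s - a * den x)) +
   u * a * den x * (v * (num y * t - b * den y))); first by ring.
by rewrite e e' !mulr0 addr0.
Qed.

Let to_frac_ext a s (Ps : ~ P s) b t (Pt : ~ P t) :
  a * t - b * s = 0 -> to_frac a Ps = to_frac b Pt.
Proof.
by move=> e; apply/to_frac_eq; exists 1; [exact: one_notin | rewrite e mulr0].
Qed.

Lemma loc_addA : associative loc_add.
Proof.
move=> x y z; have [a [r [Pr ->]]] := to_fracP x.
have [b [s [Ps ->]]] := to_fracP y; have [c [t [Pt ->]]] := to_fracP z.
by rewrite !loc_addE; apply: to_frac_ext; ring.
Qed.

Lemma loc_addC : commutative loc_add.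
Proof.
move=> x y; have [a [r [Pr ->]]] := to_fracP x.
have [b [s [Ps ->]]] := to_fracP y.
by rewrite !loc_addE; apply: to_frac_ext; ring.
Qed.

Lemma loc_add0 : left_id loc_zero loc_add.
Proof.
move=> x; have [a [r [Pr ->]]] := to_fracP x.
by rewrite loc_addE; apply: to_frac_ext; ring.
Qed.

Lemma loc_addN : left_inverse loc_zero loc_opp loc_add.
Proof.
move=> x; have [a [r [Pr ->]]] := to_fracP x.
by rewrite loc_oppE loc_addE; apply: to_frac_ext; ring.
Qed.

HB.instance Definition _ :=
  GRing.isZmodule.Build localization loc_addA loc_addC loc_add0 loc_addN.

Lemma loc_mulA : associative loc_mul.
Proof.
move=> x y z; have [a [r [Pr ->]]] := to_fracP x.
have [b [s [Ps ->]]] := to_fracP y; have [c [t [Pt ->]]] := to_fracP z.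
by rewrite !loc_mulE; apply: to_frac_ext; ring.
Qed.

Lemma loc_mulC : commutative loc_mul.
Proof.
move=> x y; have [a [r [Pr ->]]] := to_fracP x.
have [b [s [Ps ->]]] := to_fracP y.
by rewrite !loc_mulE; apply: to_frac_ext; ring.
Qed.

Lemma loc_mul1 : left_id loc_one loc_mul.
Proof.
move=> x; have [a [r [Pr ->]]] := to_fracP x.
by rewrite loc_mulE; apply: to_frac_ext; ring.
Qed.

Lemma loc_mulD : left_distributive loc_mul loc_add.
Proof.
move=> x y z; have [a [r [Pr ->]]] := to_fracP x.
have [b [s [Ps ->]]] := to_fracP y; have [c [t [Pt ->]]] := to_fracP z.
by rewrite !(loc_addE, loc_mulE); apply: to_frac_ext; ring.
Qed.

HB.instance Definition _ := GRing.Zmodule_isComPzRing.Build localization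
  loc_mulA loc_mulC loc_mul1 loc_mulD.

End Localization.

Definition regular_ring (A : comPzRingType) : Prop :=
  noetherian A /\ forall p : prime_ideal A, regular_local (localization p).

(* The tensor product of two commutative k-algebras A and B, given by their
   structure morphisms f and g. A list of pairs (a_i, b_i) stands for the formal
   sum of the a_i (x) b_i; two formal sums are identified when every k-bilinear
   map takes the same value on both. *)
Section Tensor.
Variables (k A B : comPzRingType).
Variables (f : {rmorphism k -> A}) (g : {rmorphism k -> B}).

Record k_bilinear (V : lmodType k) (b : A -> B -> V) : Prop := KBilinear {
  k_bilinearDl : forall x x' y, b (x + x') y = b x y + b x' y;
  k_bilinearDr : forall x y y', b x (y + y') = b x y + b x y';
  k_bilinearZl : forall c x y, b (f c * x) y = c *: b x y;
  k_bilinearZr : forall c x y, b x (g c * y) = c *: b x y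
}.

Definition formal_sum := seq (A * B).
Implicit Types s t : formal_sum.

Definition formal_eval (V : zmodType) (b : A -> B -> V) s : V :=
  \sum_(z <- s) b z.1 z.2.

Definition tensor_eqv s t : bool :=
  `[< forall (V : lmodType k) (b : A -> B -> V), k_bilinear b ->
        formal_eval b s = formal_eval b t >].

Lemma tensor_eqv_refl : reflexive tensor_eqv.
Proof. by move=> s; apply/asboolP. Qed.

Lemma tensor_eqv_sym : symmetric tensor_eqv.
Proof.
by move=> s t; apply/idP/idP => /asboolP e; apply/asboolP => V b bb;
  rewrite e.
Qed.

Lemma tensor_eqv_trans : transitive tensor_eqv.
Proof.
by move=> t s r /asboolP e /asboolP e'; apply/asboolP => V b bb;
  rewrite e // e'.
Qed.

Canonical tensor_eqv_rel :=
  EquivRel tensor_eqv tensor_eqv_refl tensor_eqv_sym tensor_eqv_trans.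

Definition tensor := {eq_quot tensor_eqv}.
HB.instance Definition _ := Choice.on tensor.
HB.instance Definition _ := EqQuotient.on tensor.

Definition to_tensor s : tensor := \pi_tensor s.

Definition tens_zero : tensor := to_tensor [::].
Definition tens_one : tensor := to_tensor [:: (1, 1)].
Definition tens_opp (x : tensor) : tensor :=
  to_tensor [seq (- z.1, z.2) | z <- repr x].
Definition tens_add (x y : tensor) : tensor := to_tensor (repr x ++ repr y).
Definition tens_mul (x y : tensor) : tensor :=
  to_tensor [seq (z.1 * w.1, z.2 * w.2) | z <- repr x, w <- repr y].

Section Eval.
Variables (V : lmodType k) (b : A -> B -> V).
Hypothesis bb : k_bilinear b.

Let ev (x : tensor) : V := formal_eval b (repr x).

Let b0l y : b 0 y = 0.
Proof. by have := k_bilinearZl bb 0 0 y; rewrite rmorph0 mul0r scale0r. Qed.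

Let bNl x y : b (- x) y = - b x y.
Proof.
by apply: (addrI (b x y)); rewrite -(k_bilinearDl bb) !subrr b0l.
Qed.

Lemma eval_to_tensor s : ev (to_tensor s) = formal_eval b s.
Proof.
have /eqmodP/asboolP e : repr (to_tensor s) = s %[mod tensor].
  by rewrite reprK.
exact: e.
Qed.

Lemma eval_zero : ev tens_zero = 0.
Proof. by rewrite eval_to_tensor /formal_eval big_nil. Qed.

Lemma eval_one : ev tens_one = b 1 1.
Proof. by rewrite eval_to_tensor /formal_eval big_seq1. Qed.

Lemma eval_opp x : ev (tens_opp x) = - ev x.
Proof.
rewrite eval_to_tensor /formal_eval big_map -sumrN.
by apply: eq_bigr => z _; rewrite bNl.
Qed.

Lemma eval_add x y : ev (tens_add x y) = ev x + ev y.
Proof. by rewrite eval_to_tensor /formal_eval big_cat. Qed.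

Lemma eval_mul x y : ev (tens_mul x y) =
  \sum_(z <- repr x) \sum_(w <- repr y) b (z.1 * w.1) (z.2 * w.2).
Proof. by rewrite eval_to_tensor /formal_eval big_allpairs_dep. Qed.

Lemma k_bilinear_mul a c : k_bilinear (fun x y => b (x * a) (y * c)).
Proof.
split=> *; rewrite ?mulrDl -?mulrA ?(k_bilinearDl bb) ?(k_bilinearDr bb) //.
  by rewrite (k_bilinearZl bb).
by rewrite (k_bilinearZr bb).
Qed.

End Eval.

Lemma tensor_ext (x y : tensor) :
  (forall (V : lmodType k) (b : A -> B -> V), k_bilinear b ->
     formal_eval b (repr x) = formal_eval b (repr y)) -> x = y.
Proof.
by move=> e; rewrite -[x]reprK -[y]reprK; apply/eqmodP/asboolP.
Qed.

Lemma tens_addA : associative tens_add.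
Proof. by move=> x y z; apply: tensor_ext => V b bb; rewrite !eval_add ?addrA. Qed.

Lemma tens_addC : commutative tens_add.
Proof. by move=> x y; apply: tensor_ext => V b bb; rewrite !eval_add // addrC. Qed.

Lemma tens_add0 : left_id tens_zero tens_add.
Proof.
by move=> x; apply: tensor_ext => V b bb; rewrite eval_add // eval_zero // add0r.
Qed.

Lemma tens_addN : left_inverse tens_zero tens_opp tens_add.
Proof.
move=> x; apply: tensor_ext => V b bb.
by rewrite eval_add // eval_opp // eval_zero // addNr.
Qed.

HB.instance Definition _ :=
  GRing.isZmodule.Build tensor tens_addA tens_addC tens_add0 tens_addN.

Lemma tens_mulC : commutative tens_mul.
Proof.
move=> x y; apply: tensor_ext => V b bb; rewrite !eval_mul // exchange_big /=.
by apply: eq_bigr => z _; apply: eq_bigr => w _; rewrite mulrC [z.2 * _]mulrC.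
Qed.

Let eval_mulE (V : lmodType k) (b : A -> B -> V) : k_bilinear b ->
  forall x y, formal_eval b (repr (tens_mul x y)) =
  \sum_(w <- repr y)
     formal_eval (fun u v => b (u * w.1) (v * w.2)) (repr x).
Proof. by move=> bb x y; rewrite eval_mul // exchange_big. Qed.

Lemma tens_mulD : left_distributive tens_mul tens_add.
Proof.
move=> x y z; apply: tensor_ext => V b bb.
rewrite eval_add // !eval_mulE // -big_split /=; apply: eq_bigr => w _.
by rewrite eval_add //; apply: k_bilinear_mul.
Qed.

Lemma tens_mul1 : left_id tens_one tens_mul.
Proof.
move=> x; apply: tensor_ext => V b bb; rewrite eval_mulE //.
apply: eq_bigr => w _; rewrite eval_one; last exact: k_bilinear_mul.
by rewrite !mul1r.
Qed.

Lemma tens_mulA : associative tens_mul.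
Proof.
move=> x y z; apply: tensor_ext => V b bb.
have E x1 x2 x3 : formal_eval b (repr (tens_mul (tens_mul x1 x2) x3)) =
    \sum_(w <- repr x3) \sum_(u <- repr x1) \sum_(v <- repr x2)
      b (u.1 * v.1 * w.1) (u.2 * v.2 * w.2).
  rewrite eval_mulE //; apply: eq_bigr => w _.
  by rewrite (eval_mul (k_bilinear_mul bb w.1 w.2)).
rewrite tens_mulC !E [RHS]exchange_big /=; apply: eq_bigr => w _.
rewrite [RHS]exchange_big /=; apply: eq_bigr => u _; apply: eq_bigr => v _.
by congr (b _ _); ring.
Qed.

HB.instance Definition _ := GRing.Zmodule_isComPzRing.Build tensor
  tens_mulA tens_mulC tens_mul1 tens_mulD.

Definition pure (a : A) (c : B) : tensor := to_tensor [:: (a, c)].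

Lemma pure1 : pure 1 1 = 1. Proof. by []. Qed.

Lemma eval_pure (V : lmodType k) (b : A -> B -> V) a c : k_bilinear b ->
  formal_eval b (repr (pure a c)) = b a c.
Proof. by move=> bb; rewrite eval_to_tensor // /formal_eval big_seq1. Qed.

Lemma pureM a c a' c' : pure a c * pure a' c' = pure (a * a') (c * c').
Proof.
apply: tensor_ext => V b bb; rewrite eval_mulE // [RHS]eval_pure //.
have ev w : formal_eval (fun u v => b (u * w.1) (v * w.2)) (repr (pure a c)) =
    b (a * w.1) (c * w.2) by rewrite eval_pure //; apply: k_bilinear_mul.
under eq_bigr => w _ do rewrite ev.
have bb' : k_bilinear (fun u v => b (a * u) (c * v)).
  by split=> *; rewrite ?mulrDr ?(k_bilinearDl bb) ?(k_bilinearDr bb) //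
    mulrCA ?(k_bilinearZl bb) ?(k_bilinearZr bb).
exact: (eval_pure a' c' bb').
Qed.

Lemma pureDl a a' c : pure (a + a') c = pure a c + pure a' c.
Proof.
apply: tensor_ext => V b bb.
by rewrite eval_add // !eval_pure // (k_bilinearDl bb).
Qed.

Lemma pureDr a c c' : pure a (c + c') = pure a c + pure a c'.
Proof.
apply: tensor_ext => V b bb.
by rewrite eval_add // !eval_pure // (k_bilinearDr bb).
Qed.

Lemma pureZ x a c : pure (f x * a) c = pure a (g x * c).
Proof.
apply: tensor_ext => V b bb.
by rewrite !eval_pure // (k_bilinearZl bb) (k_bilinearZr bb).
Qed.

Lemma to_tensorE s : to_tensor s = \sum_(z <- s) pure z.1 z.2.
Proof.
elim: s => [|[a c] s IH]; first by rewrite big_nil.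
rewrite big_cons -IH; apply: tensor_ext => V b bb.
by rewrite eval_add // eval_pure // !eval_to_tensor // /formal_eval big_cons.
Qed.

(* The universal property, for the k-module structure x . u = (f x (x) 1) * u. *)
Lemma tensor_universal (V : lmodType k) (b : A -> B -> V) : k_bilinear b ->
  exists! h : tensor -> V,
    [/\ {morph h : x y / x + y},
        forall x (u : tensor), h (pure (f x) 1 * u) = x *: h u
      & forall a c, h (pure a c) = b a c].
Proof.
move=> bb; exists (fun u => formal_eval b (repr u)); split.
  split=> [u u'|x u|a c]; [exact: eval_add | | exact: eval_pure].
  rewrite eval_mulE // /formal_eval scaler_sumr; apply: eq_bigr => w _.
  rewrite -/(formal_eval (fun u v => b (u * w.1) (v * w.2)) _).
  rewrite eval_pure; last exact: k_bilinear_mul.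
  by rewrite mul1r (k_bilinearZl bb).
move=> h [hD hZ hP]; apply/funext => u; rewrite -{2}[u]reprK.
rewrite -[\pi_tensor _]/(to_tensor (repr u)) to_tensorE.
have h0 : h 0 = 0 by apply: (addrI (h 0)); rewrite -hD !addr0.
by rewrite (big_morph h hD h0); apply: eq_bigr => z _; rewrite hP.
Qed.

End Tensor.

Section Subfields.
Variable F : fieldType.
Implicit Types (E T : set F) (x : F).

Definition is_subfield E : Prop := GRing.divring_closed (mem E).

Definition adjoin E T : set F := smallest is_subfield (E `|` T).

Definition minimal_polynomial E x (p : {poly F}) : Prop :=
  [/\ p \is monic, p \is a polyOver (mem E), root p x
    & forall q : {poly F}, q \is a polyOver (mem E) -> q != 0 -> root q x ->
        (size p <= size q)%N].

(* Separable means, in particular, algebraic. *)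
Definition separable_over E x : Prop :=
  exists2 p, minimal_polynomial E x p & separable_poly p.

(* [E' : E] = d, witnessed by a basis of E' over E. *)
Definition degree_eq E E' (d : nat) : Prop :=
  exists b : 'I_d -> F,
    [/\ forall i, E' (b i),
        forall x, E' x -> exists2 c : 'I_d -> F,
          forall i, E (c i) & x = \sum_i c i * b i
      & forall c : 'I_d -> F, (forall i, E (c i)) ->
          \sum_i c i * b i = 0 -> forall i, c i = 0].

End Subfields.

(* An extension K of k is given by its structure morphism f, and its
   intermediate fields are subsets of K. *)
Section Extensions.
Variables (k K : fieldType) (f : {rmorphism k -> K}).
Implicit Types E T : set K.

Definition intermediate_field E : Prop := is_subfield E /\ range f `<=` E.

Definition algebraically_independent T : Prop :=
  forall (n : nat) (t : 'I_n -> K), injective t -> (forall i, T (t i)) ->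
    forall p : mpoly n k, mmap f t p = 0 -> p = 0.

(* A family T that satisfies this is a transcendence base of E over k, since E
   is then algebraic over k(T). *)
Definition separating_transcendence_base E T : Prop :=
  [/\ T `<=` E, algebraically_independent T
    & forall x, E x -> separable_over (adjoin (range f) T) x].

Definition separable_extension E : Prop :=
  forall s : seq K, [set` s] `<=` E ->
    exists T, separating_transcendence_base (adjoin (range f) [set` s]) T.

Definition maximal_separable E : Prop :=
  [/\ intermediate_field E, separable_extension E
    & forall E', intermediate_field E' -> separable_extension E' ->
        E `<=` E' -> E' = E].

(* In characteristic p > 0 the [pchar k]-numbers n are the powers of p; in
   characteristic 0 the only one is 1, and this set is the image of k. *)
Definition pinsep_closure : set K :=
  [set x | exists2 n : nat, [pchar k].-nat n & exists a, x ^+ n = f a].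

Lemma pinsep_closure_divring : is_subfield pinsep_closure.
Proof.
have charK n : [pchar k].-nat n -> [pchar K].-nat n.
  by rewrite (eq_pnat _ (fmorph_pchar f)).
split=> [|x y|x y].
- by rewrite inE; exists 1%N => //; exists 1; rewrite rmorph1.
- rewrite !inE => -[m cm [a xa]] [n cn [b yb]]; exists (m * n)%N.
    by rewrite pnatM cm.
  exists (a ^+ n - b ^+ m); rewrite exprDn_pchar ?exprNn_pchar; last 2 first.
  + by apply: charK; rewrite pnatM cm.
  + by apply: charK; rewrite pnatM cm.
  by rewrite exprM xa mulnC exprM yb rmorphB !rmorphXn.
rewrite !inE => -[m cm [a xa]] [n cn [b yb]]; exists (m * n)%N.
  by rewrite pnatM cm.
exists (a ^+ n / b ^+ m).
by rewrite expr_div_n exprM xa mulnC exprM yb fmorph_div !rmorphXn.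
Qed.

Definition pinsep_pred : {pred K} := mem pinsep_closure.
HB.instance Definition _ :=
  GRing.isDivringClosed.Build K pinsep_pred pinsep_closure_divring.

(* The same set, as a field. *)
Record pinsep_field := PinsepField { pinsep_val : K; pinsep_valP : pinsep_val \in pinsep_pred }.
HB.instance Definition _ := [isSub for pinsep_val].
HB.instance Definition _ := [Choice of pinsep_field by <:].
HB.instance Definition _ := [SubChoice_isSubComUnitRing of pinsep_field by <:].
HB.instance Definition _ := [SubComUnitRing_isSubIntegralDomain of pinsep_field by <:].
HB.instance Definition _ := [SubIntegralDomain_isSubField of pinsep_field by <:].

Lemma base_in_pinsep a : f a \in pinsep_pred.
Proof. by rewrite inE; exists 1%N => //; exists a. Qed.

Definition to_pinsep (a : k) : pinsep_field := PinsepField (base_in_pinsep a).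

Lemma to_pinsep_is_zmod_morphism : zmod_morphism to_pinsep.
Proof. by move=> a b; apply: val_inj; rewrite /= rmorphB. Qed.

Lemma to_pinsep_is_monoid_morphism : monoid_morphism to_pinsep.
Proof.
by split=> [|a b]; apply: val_inj; rewrite /= ?rmorph1 ?rmorphM.
Qed.

HB.instance Definition _ := GRing.isZmodMorphism.Build k pinsep_field to_pinsep
  to_pinsep_is_zmod_morphism.
HB.instance Definition _ := GRing.isMonoidMorphism.Build k pinsep_field to_pinsep
  to_pinsep_is_monoid_morphism.

End Extensions.

(* Main.v *)
From HB Require Import structures.
Require Import Defs.
From mathcomp Require Import -(notations) mpoly.
From mathcomp Require Import all_boot all_algebra all_field ring zify.
From mathcomp Require Import boolp classical_sets functions cardinality.

Set Implicit Arguments.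
Unset Strict Implicit.
Unset Printing Implicit Defensive.

Import GRing.Theory.
Local Open Scope ring_scope.
Local Open Scope classical_set_scope.

(** Write A for K (x) L and B for K_i (x) L, tensor products over k.

    Conditions on B. Some Frobenius power of each element of B lies in L
    (tensor_pinsep_pow). So B is a domain if it is reduced, and a field if it is a
    domain. If B is a field, it embeds into the closure of L, so that a basis of
    k(S') over k stays free over L and spans L(S'): the degrees agree
    (field_degrees). If the degrees agree, an element of K_i that lies in L(S') has
    coordinates over L that solve a linear system over k, and this system is then
    solvable over k (degrees_intersection). If K_i meets every L(S') in k(S'), the
    minimal polynomials of the elements of S keep their degrees when k is replaced
    by L, because a factor (X - t)^m of X^q - t^q has a coefficient that reveals a
    power of t; so K_i and L are linearly disjoint, B embeds into the closure of L,
    and B is a domain (intersection_field).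

    If A is regular, then B is reduced (regular_reduced). At a minimal prime P of A
    the localization is a regular local ring of dimension 0, that is, a field; so a
    nilpotent element of B is killed by some s outside P. As A is free over B and
    the elements of B are units or nilpotent, s would be nilpotent if the element
    were not zero.

    If B is a field, then A is regular (pinsep_field_regular). Since K_s is
    separable and K_i purely inseparable over k, they are linearly disjoint
    (pinsep_linearly_disjoint), and A is K_s (x) B, where B plays the role of a
    ground field. A prime P of A is finitely generated, so that its generators
    involve a finitely generated subfield of K_s only; this field is reached from k
    by a tower of simple extensions, transcendental or separable. Going up the
    tower, P is generated by a regular sequence, locally (tower_regular): a
    transcendental step adds at most one term, because a polynomial ring over the
    residue field is a principal ideal domain, and a separable step adds none,
    because a separable polynomial has no multiple factors. A Noetherian local ring
    whose maximal ideal is generated by a regular sequence is regular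
    (regular_localI): the sequence gives a chain of primes of its own length, and
    Krull's height theorem, proved here from the principal ideal theorem, shows that
    no chain is longer. *)

(** * Ideals of Noetherian rings *)

Section Ideals.
Variable A : comPzRingType.
Implicit Types (C I J P Q : set A) (a x y z s : A) (xs : seq A).

Lemma ideal_opp I x : is_ideal I -> I x -> I (- x).
Proof. by move=> [_ _ IM] Ix; rewrite -mulN1r; apply: IM. Qed.

Lemma ideal_sub I x y : is_ideal I -> I x -> I y -> I (x - y).
Proof. by move=> iI Ix Iy; have [_ ID _] := iI; exact: ID Ix (ideal_opp iI Iy). Qed.

Lemma ideal_mulr I a x : is_ideal I -> I x -> I (x * a).
Proof. by move=> [_ _ IM] Ix; rewrite mulrC; apply: IM. Qed.

Lemma ideal_subKr I x y : is_ideal I -> I y -> I (x - y) -> I x.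
Proof. by move=> [_ ID _] Iy Ixy; rewrite -[x](subrK y); apply: ID. Qed.

Lemma prime_mul_notin P s t : is_prime_ideal P -> ~ P s -> ~ P t -> ~ P (s * t).
Proof. by move=> [_ _ PM] Ps Pt /PM[]. Qed.

Lemma prime_expr P x n : is_prime_ideal P -> P (x ^+ n) -> P x.
Proof.
move=> [_ P1 PM]; elim: n => [/P1 //|n IH]; rewrite exprS.
by case/PM.
Qed.

(** The combinations of xs with coefficients in C: for an ideal C this is the
    product of C and the ideal of xs, as in Nakayama's lemma and in the square of
    a maximal ideal. *)
Definition comb C : seq A -> set A :=
  foldr (fun x I => [set z | exists a y, [/\ C a, I y & z = a * x + y]]) [set 0].

Definition ideal_of xs : set A := comb setT xs.

Lemma comb_ideal C xs : is_ideal C -> is_ideal (comb C xs).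
Proof.
move=> [C0 CD CM]; elim: xs => [|x xs [I0 ID IM]] /=.
  by split=> [|x y /= -> ->|a x /= ->] //; rewrite ?addr0 ?mulr0.
split=> [|y z /= [a [y' [Ca Iy ->]]] [b [z' [Cb Iz ->]]]
  |a y /= [b [y' [Cb Iy ->]]]].
- by exists 0, 0; rewrite mul0r addr0.
- by exists (a + b), (y' + z'); split; [apply: CD|apply: ID|ring].
- by exists (a * b), (a * y'); split; [apply: CM|apply: IM|ring].
Qed.

Lemma setT_ideal : is_ideal [set: A]. Proof. by []. Qed.

Lemma set1_0_ideal : is_ideal [set (0 : A)].
Proof. exact: (comb_ideal [::] setT_ideal). Qed.

Lemma ideal_of_ideal xs : is_ideal (ideal_of xs).
Proof. exact/comb_ideal/setT_ideal. Qed.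

Lemma comb_sub C I xs : is_ideal I -> (forall a x, C a -> x \in xs -> I (a * x)) ->
  comb C xs `<=` I.
Proof.
move=> iI; elim: xs => [|x xs IH] Ixs y /=; first by move=> ->; case: iI.
move=> [a [z [Ca /IH Iz ->]]]; have [_ ID _] := iI; apply: ID.
  by apply: Ixs; rewrite ?mem_head.
by apply: Iz => b w Cb w_xs; apply: Ixs; rewrite // in_cons w_xs orbT.
Qed.

Lemma ideal_of_sub I xs : is_ideal I -> (forall x, x \in xs -> I x) ->
  ideal_of xs `<=` I.
Proof.
by move=> iI Ixs; apply: comb_sub => // a x _ /Ixs Ix; case: iI => _ _; apply.
Qed.

Lemma comb_mem C xs a x : is_ideal C -> C a -> x \in xs -> comb C xs (a * x).
Proof.
move=> iC Ca; elim: xs => //= y xs IH; rewrite in_cons => /orP[/eqP ->|/IH Cax].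
  by exists a, 0; split; rewrite ?addr0 //; case: (comb_ideal xs iC).
by exists 0, (a * x); split; rewrite ?mul0r ?add0r //; case: iC.
Qed.

Lemma ideal_of_mem xs x : x \in xs -> ideal_of xs x.
Proof. by move=> x_xs; rewrite -[x]mul1r; apply: comb_mem setT_ideal _ _. Qed.

Lemma comb_mul C xs a x : is_ideal C -> C a -> ideal_of xs x -> comb C xs (a * x).
Proof.
move=> iC Ca; elim: xs x => [x /= ->|y xs IH x]; first by rewrite /= mulr0.
move=> [b [z [_ Iz ->]]] /=; exists (a * b), (a * z); split; last by ring.
  exact: ideal_mulr.
exact: IH.
Qed.

Lemma ideal_of_mul xs ys x y : ideal_of xs x -> ideal_of ys y ->
  ideal_of [seq a * b | a <- xs, b <- ys] (x * y).
Proof.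
set I := ideal_of (allpairs _ _ _); have iI : is_ideal I := ideal_of_ideal _.
have iM z : is_ideal [set t | I (t * z)].
  have [I0 ID IM] := iI; split=> [|t u /= It Iu|a t /= It].
  - by rewrite /= mul0r.
  - by rewrite mulrDl; apply: ID.
  - by rewrite -mulrA; apply: IM.
move=> Ix Iy; apply: (ideal_of_sub (iM y) _ Ix) => a a_xs /=.
rewrite mulrC; apply: (ideal_of_sub (iM a) _ Iy) => b b_ys /=.
by rewrite mulrC; apply/ideal_of_mem/allpairs_f.
Qed.

Lemma ideal_ofP xs z :
  ideal_of xs z <-> exists b : nat -> A, z = \sum_(i < size xs) b i * xs`_i.
Proof.
elim: xs z => [|x xs IH] z /=.
  by split=> [->|[b ->]]; [exists (fun=> 0); rewrite big_ord0|rewrite big_ord0].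
split=> [[a [y [_ /IH[b ->] ->]]]|[b ->]].
  by exists (fun n => if n is m.+1 then b m else a); rewrite big_ord_recl.
exists (b 0%N), (\sum_(i < size xs) b i.+1 * xs`_i); split=> //.
  by apply/IH; exists (fun i => b i.+1).
by rewrite big_ord_recl.
Qed.

Lemma smallest_ideal_of xs : smallest (@is_ideal A) [set` xs] = ideal_of xs.
Proof.
apply/seteqP; split=> [z sz|z Iz I [iI sI]].
  by apply: sz; split=> [|x xs_x]; [apply: ideal_of_ideal|apply: ideal_of_mem].
exact: (ideal_of_sub iI sI).
Qed.

Definition ideal_add I J : set A := [set z | exists x y, [/\ I x, J y & z = x + y]].

Lemma ideal_add_ideal I J : is_ideal I -> is_ideal J -> is_ideal (ideal_add I J).
Proof.
move=> [I0 ID IM] [J0 JD JM]; split=> [|_ _ [x [y [Ix Jy ->]]] [z [t [Iz Jt ->]]]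
  |a _ [x [y [Ix Jy ->]]]].
- by exists 0, 0; rewrite addr0.
- by exists (x + z), (y + t); split; [apply: ID|apply: JD|ring].
- by exists (a * x), (a * y); split; [apply: IM|apply: JM|ring].
Qed.

Lemma ideal_addl I J : is_ideal J -> I `<=` ideal_add I J.
Proof. by move=> [J0 _ _] x Ix; exists x, 0; rewrite addr0. Qed.

Lemma ideal_addr I J : is_ideal I -> J `<=` ideal_add I J.
Proof. by move=> [I0 _ _] x Jx; exists 0, x; rewrite add0r. Qed.

Lemma ideal_add_sub I J L : is_ideal L -> I `<=` L -> J `<=` L ->
  ideal_add I J `<=` L.
Proof. by move=> [_ LD _] IL JL _ [x [y [/IL Lx /JL Ly ->]]]; apply: LD. Qed.

Hypothesis nA : noetherian A.

Lemma noetherian_ideal_of I : is_ideal I -> exists xs, I = ideal_of xs.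
Proof. by move=> /nA[xs ->]; exists xs; rewrite smallest_ideal_of. Qed.

(** Otherwise there is an infinite strictly increasing sequence of ideals, whose
    union is finitely generated, hence equal to one of its terms. *)
Lemma noetherian_maximal (F : set (set A)) I0 : F I0 ->
  (forall I, F I -> is_ideal I) ->
  exists2 I, F I & forall J, F J -> I `<=` J -> J = I.
Proof.
move=> FI0 F_ideal; apply: contrapT => noMax.
have step (I : {I | F I}) : exists J : {J | F J}, sval I `<` sval J.
  apply: contrapT => noJ; apply: noMax; exists (sval I); first exact: svalP.
  move=> J FJ IJ; apply: contrapT => JI; apply: noJ; exists (exist _ J FJ).
  by rewrite /= properEneq; split=> //; apply/eqP => e; apply: JI.
have [next nextP] := choice step.
pose G n := sval (iter n next (exist _ I0 FI0)).
have GS n : G n `<` G n.+1 by apply: nextP.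
have iG n : is_ideal (G n) by apply/F_ideal/svalP.
have Gle m n : (m <= n)%N -> G m `<=` G n.
  move=> /subnK <-; elim: (n - m)%N => [//|d IH]; apply: subset_trans IH _.
  by rewrite addSn; apply: properW.
have iU : is_ideal (\bigcup_n G n).
  split=> [|x y [m _ Gx] [n _ Gy]|a x [m _ Gx]].
  - by exists 0%N => //; case: (iG 0%N).
  - exists (maxn m n) => //; have [_ GD _] := iG (maxn m n).
    by apply: GD; [apply: Gle Gx|apply: Gle Gy]; rewrite ?leq_maxl ?leq_maxr.
  - by exists m => //; case: (iG m) => _ _; apply.
have [xs Exs] := noetherian_ideal_of iU.
have xsU x : x \in xs -> exists n, G n x.
  move=> /ideal_of_mem; rewrite -Exs => -[n _ Gx]; by exists n.
have [N GN] : exists N, forall x, x \in xs -> G N x.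
  elim: xs xsU {Exs} => [|x xs IH] xsU; first by exists 0%N.
  have [m Gm] := xsU x (mem_head _ _).
  have [|n Gn] := IH; first by move=> y y_xs; apply: xsU; rewrite in_cons y_xs orbT.
  exists (maxn m n) => y; rewrite in_cons => /orP[/eqP ->|/Gn].
    by apply: Gle Gm; rewrite leq_maxl.
  by apply: Gle; rewrite leq_maxr.
have UN : \bigcup_n G n `<=` G N by rewrite Exs; apply: ideal_of_sub.
have [_ /nonsubset[x [GSx Gx]]] := GS N.
by apply/Gx/UN; exists N.+1.
Qed.

(** An ideal that contains I and is maximal among those disjoint from S is prime:
    if a and b lie outside it, then its sums with (a) and with (b) both meet S,
    and the product of two such elements of S lies in its sum with (a b). *)
Lemma exists_prime I (S : set A) : is_ideal I -> S 1 ->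
  (forall s t, S s -> S t -> S (s * t)) -> (forall s, S s -> ~ I s) ->
  exists Q, [/\ is_prime_ideal Q, I `<=` Q & forall s, S s -> ~ Q s].
Proof.
move=> iI S1 SM SI.
have [|J [] //|Q [iQ IQ SQ] maxQ] := @noetherian_maximal
  [set J | [/\ is_ideal J, I `<=` J & forall s, S s -> ~ J s]] I; first by split.
exists Q; split=> //; split=> // [/SQ|a b Qab]; first exact.
apply: contrapT => /not_orP[Qa Qb].
have meet c : ~ Q c -> exists2 s, S s & ideal_add Q (ideal_of [:: c]) s.
  move=> Qc; apply: contrapT => noS.
  have iJ := ideal_add_ideal iQ (ideal_of_ideal [:: c]).
  have QJ := @ideal_addl Q _ (ideal_of_ideal [:: c]).
  have JQ : ideal_add Q (ideal_of [:: c]) = Q.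
    apply: maxQ => //; split=> //; first exact: subset_trans QJ.
    by move=> s Ss Js; apply: noS; exists s.
  apply: Qc; rewrite -JQ; apply: ideal_addr => //.
  by apply: ideal_of_mem; rewrite mem_head.
have [s Ss [q [_ [Qq [c [_ [_ -> ->]]] Es]]]] := meet a Qa.
have [t St [r [_ [Qr [d [_ [_ -> ->]]] Et]]]] := meet b Qb.
apply: (SQ _ (SM s t Ss St)); rewrite {}Es {}Et.
have [_ QD QM] := iQ.
have -> : (q + (c * a + 0)) * (r + (d * b + 0)) =
  (r + d * b) * q + (c * a * r + c * d * (a * b)) by ring.
by apply: (QD) (QM _ _ _) (QD _ _ (QM _ _ _) (QM _ _ _)).
Qed.

End Ideals.

(** * Krull's height theorem *)

Section Height.
Variable A : comPzRingType.
Implicit Types (C I J P Q : set A) (a x y z s : A) (xs : seq A).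

(** The contraction of the extension of I to the localization at Q. *)
Definition saturation Q I : set A := [set y | exists2 s, ~ Q s & I (s * y)].

Lemma saturation_ideal Q I : is_prime_ideal Q -> is_ideal I ->
  is_ideal (saturation Q I).
Proof.
move=> pQ [I0 ID IM]; have [_ Q1 _] := pQ.
split=> [|x y [s Qs Ix] [t Qt Iy]|a x [s Qs Ix]].
- by exists 1; rewrite // mulr0.
- exists (s * t); first exact: prime_mul_notin.
  have -> : s * t * (x + y) = t * (s * x) + s * (t * y) by ring.
  by apply: ID; apply: IM.
- by exists s; rewrite // mulrCA; apply: IM.
Qed.

Lemma sub_saturation Q I : is_prime_ideal Q -> I `<=` saturation Q I.
Proof. by move=> [_ Q1 _] x Ix; exists 1; rewrite // mul1r. Qed.

Definition saturated Q I := saturation Q I `<=` I.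

Lemma saturation_saturated Q I : is_prime_ideal Q -> saturated Q (saturation Q I).
Proof.
move=> pQ x [s Qs [t Qt Itsx]]; exists (t * s); first exact: prime_mul_notin.
by rewrite -mulrA.
Qed.

Lemma saturation_mono Q I J : I `<=` J -> saturation Q I `<=` saturation Q J.
Proof. by move=> IJ x [s Qs /IJ Jsx]; exists s. Qed.

Lemma saturation_comb Q J xs y : is_prime_ideal Q -> is_ideal J ->
  (forall x, x \in xs -> saturation Q J x) -> ideal_of xs y -> saturation Q J y.
Proof. by move=> pQ iJ xsJ; apply: (ideal_of_sub (saturation_ideal pQ iJ) xsJ). Qed.

(** Nakayama's lemma over the localization at Q, by elimination: the relation
    that expresses a generator x has a coefficient of x outside Q, and removes x
    from the other relations. *)
Lemma nakayama Q J xs : is_prime_ideal Q -> is_ideal J ->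
  (forall x, x \in xs -> exists s m, [/\ ~ Q s, comb Q xs m & J (s * x - m)]) ->
  forall x, x \in xs -> saturation Q J x.
Proof.
move=> pQ iJ; have [iQ Q1 QM] := pQ; have [Q0 QD QI] := iQ; have [J0 JD JM] := iJ.
elim: xs => [//|x xs IH] rel.
have [s [_ [Qs [a [m [Qa Cm ->]]] Jx]]] := rel x (mem_head _ _).
have Qu : ~ Q (s - a) by move=> Qsa; apply: Qs; apply: ideal_subKr Qsa.
have {}Jx : J ((s - a) * x - m) by move: Jx; congr J; ring.
have Jxs y : y \in xs -> saturation Q J y.
  apply: IH => {}y y_xs.
  have [|t [_ [Qt [b [n [Qb Cn ->]]] Jy]]] := rel y.
    by rewrite in_cons y_xs orbT.
  exists ((s - a) * t), (b * m + (s - a) * n); split.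
  - exact: prime_mul_notin.
  - by have [_ CD CM] := comb_ideal xs iQ; apply: CD; apply: CM.
  have -> : (s - a) * t * y - (b * m + (s - a) * n) =
    (s - a) * (t * y - (b * x + n)) + b * ((s - a) * x - m) by ring.
  by apply: JD; apply: JM.
move=> y; rewrite in_cons => /orP[/eqP ->|]; last exact: Jxs.
have [t Qt Jtm] : saturation Q J m.
  apply: saturation_comb Jxs _ => //.
  by apply: comb_sub Cm; [apply: ideal_of_ideal|move=> b z _ z_xs;
    case: (ideal_of_ideal xs) => _ _; apply; apply: ideal_of_mem].
exists (t * (s - a)); first exact: prime_mul_notin.
have -> : t * (s - a) * x = t * ((s - a) * x - m) + t * m by ring.
by apply: JD => //; apply: JM.
Qed.

Hypothesis nA : noetherian A.

Definition stationary (I : nat -> set A) :=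
  exists N, forall n, (N <= n)%N -> I n `<=` I n.+1.

(** If Q is minimal over C, then A_Q / C A_Q is Artinian. Among the saturated
    ideals over which some descending chain is not stationary, let B be
    maximal. Some z outside B has annihilator Q modulo B, so that z generates a
    simple module modulo B; a chain over B is then controlled by its sum with
    (z), which is stationary by maximality, and by whether it contains z. *)
Lemma minimal_over_dcc Q C (I : nat -> set A) : is_prime_ideal Q -> is_ideal C ->
  (forall Q', is_prime_ideal Q' -> C `<=` Q' -> Q' `<=` Q -> Q' = Q) ->
  (forall n, [/\ is_ideal (I n), saturated Q (I n), C `<=` I n & I n.+1 `<=` I n]) ->
  stationary I.
Proof.
move=> pQ iC minQ; have [iQ Q1 QM] := pQ.
pose chain B (D : nat -> set A) :=
  forall n, [/\ is_ideal (D n), saturated Q (D n), B `<=` D n & D n.+1 `<=` D n].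
pose bad : set (set A) := [set B | [/\ is_ideal B, saturated Q B, C `<=` B
  & exists2 D, chain B D & ~ stationary D]].
move=> chI; apply: contrapT => badI.
have [|B [] //|B [iB sB CB [D chD badD]] maxB] :=
    noetherian_maximal nA (F := bad) (I0 := saturation Q C).
  split; [exact: saturation_ideal | exact: saturation_saturated
    | exact: sub_saturation |].
  exists I => // n; have [iI sI CI dI] := chI n.
  by split=> //; apply: subset_trans (saturation_mono CI) sI.
have B1 : ~ B 1.
  move=> B1; apply: badD; exists 0%N => n _ x _.
  by have [[_ _ DM] _ BD _] := chD n.+1; rewrite -[x]mulr1; apply/DM/BD.
have [_ BD BM] := iB.
pose ann z : set A := [set a | B (a * z)].
have iann z : is_ideal (ann z).
  rewrite /ann; split=> /= [|a b Ba Bb|a b Bb]; rewrite ?mul0r ?mulrDl -?mulrA.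
  - by case: iB.
  - exact: BD.
  - exact: BM.
have [|_ [z _ <-] //|_ [z Bz <-] maxz] := noetherian_maximal nA
  (F := ann @` [set z | ~ B z]) (I0 := ann 1); first by exists 1.
have annQ : ann z = Q.
  apply: minQ.
  - split=> //= [|a b annab]; first by rewrite /ann /= mul1r.
    have [annb|annb] := pselect (ann z b); first by right.
    left; rewrite -(maxz (ann (b * z))); [|by exists (b * z)|].
      by move: annab; rewrite /ann /= mulrA.
    by move=> c annc; rewrite /ann /= mulrCA; apply: BM.
  - by move=> c /CB Bc; rewrite /ann /= mulrC; apply: BM.
  - move=> a anna; apply: contrapT => Qa; apply: Bz; apply: sB; by exists a.
pose addz J := saturation Q (ideal_add J (ideal_of [:: z])).
have iz := ideal_of_ideal [:: z].
have addz_z J : is_ideal J -> addz J z.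
  by move=> iJ; apply/sub_saturation/ideal_addr/ideal_of_mem; rewrite ?mem_head.
have addz_ideal J : is_ideal J -> is_ideal (addz J).
  by move=> iJ; apply: saturation_ideal => //; apply: ideal_add_ideal.
have addz_sub J : J `<=` addz J.
  by apply: subset_trans (sub_saturation pQ); apply: ideal_addl.
have addz_mono J J' : J `<=` J' -> addz J `<=` addz J'.
  move=> JJ'; apply: saturation_mono => _ [a [b [Ja zb ->]]].
  by exists a, b; split=> //; apply: JJ'.
have stat D' : chain (addz B) D' -> stationary D'.
  move=> chD'; apply: contrapT => badD'; apply: Bz.
  rewrite -(maxB (addz B)); [exact: addz_z | split | exact: addz_sub].
  - exact: addz_ideal.
  - exact: saturation_saturated.
  - exact: subset_trans (addz_sub B).
  - by exists D'.
have [Dz|/existsNP[n0 Dz]] := pselect (forall n, D n z).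
  apply: badD; apply: stat => n; have [iD sD BDn dD] := chD n; split=> //.
  apply: subset_trans (saturation_mono _) sD; apply: ideal_add_sub => //.
  by apply: ideal_of_sub => // x; rewrite mem_seq1 => /eqP ->.
have [N statN] : stationary (fun n => addz (D n)).
  apply: stat => n; have [iD sD BDn dD] := chD n.
  split; [exact: addz_ideal|exact: saturation_saturated|exact: addz_mono..].
apply: badD; exists (maxn n0 N) => n; rewrite geq_max => /andP[n0n Nn] y Dy.
have Dnz : ~ D n z.
  move=> Dnz; apply: Dz; move: Dnz; rewrite -(subnK n0n).
  elim: (n - n0)%N => [//|d IH]; rewrite addSn.
  by have [_ _ _ dD] := chD (d + n0)%N => /dD.
have [iD sD _ dD] := chD n; have [iDS sDS BDS _] := chD n.+1.
have [s Qs [i [_ [Di [a [_ [_ -> ->]]] Esy]]]] := statN n Nn y (addz_sub _ _ Dy).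
apply: sDS; exists s => //; rewrite Esy addr0; have [_ DD _] := iDS; apply: DD => //.
have Daz : D n (a * z).
  have -> : a * z = s * y - i by rewrite Esy; ring.
  by apply: ideal_sub => //; [case: iD => _ _; apply|apply: dD].
apply: BDS; rewrite -[B _]/(ann z a) annQ; apply: contrapT => Qa.
by apply/Dnz/sD; exists a.
Qed.

(** Krull's principal ideal theorem: the quotient of A_Q by P0 and x would be
    Artinian if Q were minimal over P0 and x, so the symbolic powers of P1
    modulo P0 would be stationary modulo x, hence stationary by Nakayama's
    lemma over A_Q; by Nakayama's lemma over the localization at P1, a power of
    P1 would lie in P0. *)
Theorem principal_ideal_theorem P0 P1 Q x :
  is_prime_ideal P0 -> is_prime_ideal P1 -> is_prime_ideal Q ->
  P0 `<` P1 -> P1 `<` Q -> Q x ->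
  exists Q', [/\ is_prime_ideal Q', P0 `<=` Q', Q' x & Q' `<` Q].
Proof.
move=> pP0 pP1 pQ lt01 lt1Q Qx; apply: contrapT => noQ'.
have [iP0 _ _] := pP0; have [iP1 P11 _] := pP1; have [iQ _ _] := pQ.
pose C := ideal_add P0 (ideal_of [:: x]).
have iC : is_ideal C by apply: ideal_add_ideal => //; apply: ideal_of_ideal.
have Cx : C x by apply/ideal_addr/ideal_of_mem; rewrite // mem_head.
have P0C : P0 `<=` C by apply/ideal_addl/ideal_of_ideal.
have minQ Q' : is_prime_ideal Q' -> C `<=` Q' -> Q' `<=` Q -> Q' = Q.
  move=> pQ' CQ' Q'Q; apply: contrapT => neQ; apply: noQ'; exists Q'.
  split; [by []|exact: subset_trans CQ'|exact: CQ'|].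
  by rewrite properEneq; split=> //; apply/eqP.
have P1x : ~ P1 x.
  move=> P1x; have [P1Q /nonsubset[y [Qy P1y]]] := lt1Q; apply: P1y.
  rewrite (minQ P1) //; apply: ideal_add_sub => //; first exact: properW.
  by apply: ideal_of_sub => // y'; rewrite mem_seq1 => /eqP ->.
have P1Q s : ~ Q s -> ~ P1 s by move=> Qs /(properW lt1Q).
have P01 s : ~ P1 s -> ~ P0 s by move=> P1s /(properW lt01).
have [xs Exs] := noetherian_ideal_of nA iP1.
pose pw n := iter n (fun ys => [seq a * b | a <- xs, b <- ys]) [:: 1 : A].
have pwS n : forall y, y \in pw n.+1 -> comb P1 (pw n) y.
  move=> y /allpairsP[[a b] /= [a_xs b_pw ->]]; apply: comb_mem => //.
  by rewrite Exs; apply: ideal_of_mem.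
have comb_pw n : comb P1 (pw n) `<=` ideal_of (pw n).
  by apply: comb_sub => [|a y _ y_pw]; [exact: ideal_of_ideal|exact: comb_mem].
have pwS_sub n : ideal_of (pw n.+1) `<=` comb P1 (pw n).
  by apply: ideal_of_sub; [apply: comb_ideal|apply: pwS].
pose S n := saturation P1 (ideal_add (ideal_of (pw n)) P0).
have iS n : is_ideal (S n).
  by apply/saturation_ideal/ideal_add_ideal => //; apply: ideal_of_ideal.
have P0S n : P0 `<=` S n.
  by apply: subset_trans (sub_saturation pP1); apply/ideal_addr/ideal_of_ideal.
have dS n : S n.+1 `<=` S n.
  apply: saturation_mono; apply: ideal_add_sub.
  - by apply: ideal_add_ideal => //; apply: ideal_of_ideal.
  - apply: subset_trans (ideal_addl iP0).
    exact: subset_trans (pwS_sub n) (comb_pw n).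
  - exact/ideal_addr/ideal_of_ideal.
pose D n := saturation Q (ideal_add (S n) (ideal_of [:: x])).
have [n|N statN] := minimal_over_dcc (I := D) pQ iC minQ.
  have iSx := ideal_add_ideal (iS n) (ideal_of_ideal [:: x]).
  split; [exact: saturation_ideal|exact: saturation_saturated| |].
    apply: subset_trans (sub_saturation pQ); apply: ideal_add_sub => //.
      by apply: subset_trans (ideal_addl _); [apply: P0S|apply: ideal_of_ideal].
    exact: ideal_addr.
  apply: saturation_mono => _ [a [b [Sa xb ->]]]; exists a, b.
  by split=> //; apply: dS.
have SN : S N `<=` S N.+1.
  have [ys Eys] := noetherian_ideal_of nA (iS N).
  have ysN y : y \in ys -> saturation Q (S N.+1) y.
    apply: nakayama => // {}y y_ys.
    have Sy : S N y by rewrite Eys; apply: ideal_of_mem.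
    have [|s Qs [z [_ [Sz [a [_ [_ -> ->]]] Esy]]]] := statN N (leqnn N) y.
      by apply/sub_saturation/ideal_addl => //; apply: ideal_of_ideal.
    exists s, (x * a); split=> //; last first.
      by rewrite Esy; move: Sz; congr S; ring.
    apply: comb_mul => //; rewrite -Eys; apply: saturation_saturated => //.
    have : S N (x * a); last by exists x.
    have -> : x * a = s * y - z by rewrite Esy; ring.
    by apply: ideal_sub => //; [case: (iS N) => _ _; apply|apply: dS].
  move=> y; rewrite {1}Eys => /(saturation_comb pQ (iS N.+1) ysN)[s Qs Ssy].
  by apply: saturation_saturated => //; exists s; first exact: P1Q.
have P0pw y : y \in pw N -> P0 y.
  move=> y_pw; suff [s P1s] : saturation P1 P0 y.
    by case: pP0 => _ _ PM /PM[/(P01 _ P1s)|].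
  apply: nakayama y y_pw => // y y_pw.
  have [|s P1s [m [j [Im P0j Esy]]]] := SN y.
    apply: sub_saturation => //; apply: ideal_addl => //; exact: ideal_of_mem.
  exists s, m; split=> //; first exact: pwS_sub.
  by rewrite Esy; move: P0j; congr P0; ring.
have [_ /nonsubset[y [P1y P0y]]] := lt01; apply: P0y.
apply: (@prime_expr _ _ _ N) => //.
apply: (ideal_of_sub iP0 P0pw); elim: N {statN SN P0pw} => [|n IH].
  by apply: ideal_of_mem; rewrite mem_head.
by rewrite exprS; apply: ideal_of_mul; rewrite -?Exs.
Qed.

Definition prime_chain (p : nat -> set A) n :=
  (forall i, (i <= n)%N -> is_prime_ideal (p i)) /\
  (forall i, (i < n)%N -> p i `<` p i.+1).

Lemma prime_chain_le p n i j : prime_chain p n -> (i <= j <= n)%N -> p i `<=` p j.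
Proof.
move=> [_ ltp] /andP[/subnK <-]; elim: (j - i)%N => [_ //|d IH]; rewrite addSn => le_n.
by apply: subset_trans (IH (ltnW le_n)) (properW (ltp _ _)).
Qed.

Lemma prime_chain_rcons p n Q : prime_chain p n -> is_prime_ideal Q -> p n `<` Q ->
  prime_chain (fun i => if (i <= n)%N then p i else Q) n.+1.
Proof.
move=> [pp ltp] pQ ltQ; split=> i; first by case: ifP => // /pp.
rewrite ltnS => le_in; rewrite le_in; case: ifP => [/ltp //|].
by move=> /negbT; rewrite -leqNgt => ni; have -> : i = n by lia.
Qed.

(** One step of the induction on the number of generators in the height theorem:
    the principal ideal theorem replaces the highest prime that does not contain
    x by one that does, so that x moves down the chain one prime at a time. *)
Lemma prime_chain_shift n p x : prime_chain p n.+1 -> p n.+1 x ->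
  exists p', [/\ prime_chain p' n, p' 0%N x, p 0%N `<=` p' 0%N & p' n = p n.+1].
Proof.
elim: n p => [|n IH] p chp px.
  exists (fun=> p 1%N); split=> //.
    by split=> // i _; case: chp => [pp _]; apply: pp.
  by apply: prime_chain_le chp _.
have [pp ltp] := chp.
have [R [pR ltR Rx ltR']] : exists R,
    [/\ is_prime_ideal R, p n `<` R, R x & R `<` p n.+2].
  have [pnx|pnx] := pselect (p n.+1 x).
    by exists (p n.+1); split=> //; [apply: pp|apply: ltp|apply: ltp].
  have [Q' [pQ' le0 Q'x ltQ']] := principal_ideal_theorem
    (pp n (leqW (leqnSn n))) (pp n.+1 (leqnSn _)) (pp n.+2 (leqnn _))
    (ltp n (leqnSn _)) (ltp n.+1 (leqnn _)) px.
  exists Q'; split=> //; rewrite properEneq; split=> //; apply/eqP => E.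
  by apply: pnx; apply: (properW (ltp n _)); rewrite ?E //; lia.
have chn : prime_chain p n by split=> i ?; [apply: pp|apply: ltp]; lia.
have [||p' [chp' p'x le0 p'n]] :=
    IH (fun i => if (i <= n)%N then p i else R).
- exact: prime_chain_rcons.
- by rewrite ltnn.
rewrite ltnn in p'n.
exists (fun i => if (i <= n)%N then p' i else p n.+2); split=> //; last by rewrite ltnn.
by apply: prime_chain_rcons => //; [apply: pp|rewrite p'n].
Qed.

(** Moving x into the lowest prime of a shortened chain trades one generator for
    one unit of length. The ideal J collects the generators used up, so that no
    quotient ring is formed. *)
Theorem height_theorem xs J P p n : is_prime_ideal P -> is_ideal J ->
  (forall x, x \in xs -> P x) ->
  P `<=` saturation P (ideal_add J (ideal_of xs)) ->
  prime_chain p n -> J `<=` p 0%N -> p n = P -> (n <= size xs)%N.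
Proof.
move=> pP; elim: xs J p n => [|x xs IH] J p n iJ xsP gen chp Jp pn.
  rewrite leqNgt; apply/negP => n_gt0; have [pp ltp] := chp.
  have [_ /nonsubset[y [py py0]]] := ltp 0%N n_gt0; apply: py0.
  have le0 : p 0%N `<=` P by rewrite -pn; apply: prime_chain_le chp _; rewrite leqnn.
  have [|s Ps [z [_ [Jz -> Esy]]]] := gen y.
    by rewrite -pn; apply: (prime_chain_le chp) py; rewrite n_gt0 leqnn.
  have [_ _ PM] := pp 0%N isT; have /PM[/le0 //|//] : p 0%N (s * y).
  by rewrite Esy addr0; apply: Jp.
case: n chp pn => [//|n] chp pn; rewrite /= ltnS.
have [|p' [chp' p'x le0 p'n]] := prime_chain_shift (x := x) chp.
  by rewrite pn; apply/xsP/mem_head.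
have ix := ideal_of_ideal [:: x].
apply: (IH (ideal_add J (ideal_of [:: x])) p' n) => //.
- exact: ideal_add_ideal.
- by move=> y y_xs; apply: xsP; rewrite in_cons y_xs orbT.
- move=> y /gen[s Ps [z [_ [Jz [a [t [_ It ->]]] Esy]]]]; exists s => //.
  exists (z + a * x), t; split=> //; last by rewrite Esy addrA.
  by exists z, (a * x); split=> //; apply: comb_mem; rewrite ?mem_head.
- have [ip' _ _] : is_prime_ideal (p' 0%N) by case: chp' => pp' _; apply: pp'.
  apply: ideal_add_sub => //; first exact: subset_trans le0.
  by apply: ideal_of_sub => // y; rewrite mem_seq1 => /eqP ->.
- by rewrite p'n.
Qed.

(** By the height theorem the chains that end at a given prime have bounded length,
    and a longest one starts at a minimal prime. *)
Lemma exists_minimal_prime : (1 : A) <> 0 ->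
  exists P, is_prime_ideal P /\ forall Q, is_prime_ideal Q -> Q `<=` P -> Q = P.
Proof.
move=> A1.
have [|s t -> ->|s -> //|Q [pQ _ _]] :=
  exists_prime nA (S := [set 1]) (set1_0_ideal A); rewrite ?mulr1 //.
have [iQ _ _] := pQ; have [xs Exs] := noetherian_ideal_of nA iQ.
pose to_Q n := `[< exists2 p, prime_chain p n & p n = Q >].
have ex0 : exists n, to_Q n by exists 0%N; apply/asboolP; exists (fun=> Q).
have le_xs n : to_Q n -> (n <= size xs)%N.
  move=> /asboolP[p chp pn]; have [pp _] := chp; have [[ip _ _] _ _] := pp 0%N isT.
  apply: (height_theorem pQ (set1_0_ideal A)) chp _ pn.
  - by move=> x x_xs; rewrite Exs; apply: ideal_of_mem.
  - move=> x Qx; apply: sub_saturation => //; apply: ideal_addr; rewrite -?Exs //.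
    exact: set1_0_ideal.
  - by move=> _ ->.
case: (ex_maxnP ex0 le_xs) => n /asboolP[p [pp ltp] pn] max_n.
exists (p 0%N); split=> [|R pR Rp0]; first exact: pp.
apply: contrapT => neR; have : to_Q n.+1.
  apply/asboolP; exists (fun i => if i is j.+1 then p j else R) => //.
  split=> [[|i] // /pp //|[_|i /ltp //]].
  by rewrite properEneq; split=> //; apply/eqP.
by move=> /max_n; rewrite ltnn.
Qed.

End Height.

(** * Local rings generated by regular sequences *)

Section RegularSequences.
Variable A : comPzRingType.
Implicit Types (I J P Q : set A) (a x y z s : A) (xs : seq A).

(** The sequence is regular in the localization at P, from its last term to its
    first one: the order in which a tower of extensions produces the terms. *)
Fixpoint regular_at P xs : Prop :=
  if xs is x :: xs' then regular_at P xs' /\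
    forall y, ideal_of xs' (x * y) -> saturation P (ideal_of xs') y
  else True.

Lemma regular_at_sub P Q xs : Q `<=` P -> regular_at P xs -> regular_at Q xs.
Proof.
move=> QP; elim: xs => //= x xs IH [/IH rxs rx]; split=> // y /rx[s Ps Is].
by exists s => // /QP.
Qed.

(** The powers of x times elements outside P avoid the ideal of the other terms,
    because x is a nonzerodivisor modulo it over the localization at P. A prime
    that contains this ideal and avoids them is the next step down. *)
Lemma regular_prime_chain P xs : noetherian A -> is_prime_ideal P ->
  (forall x, x \in xs -> P x) -> regular_at P xs ->
  exists2 p, prime_chain p (size xs) & p (size xs) = P.
Proof.
move=> nA; elim: xs P => [|x xs IH] P pP xsP; first by exists (fun=> P).
case=> [rxs rx] /=; have [iP P1 PM] := pP.
have xs'P : ideal_of xs `<=` P.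
  by apply: ideal_of_sub => // y y_xs; apply: xsP; rewrite in_cons y_xs orbT.
have avoid n s : ~ P s -> ~ ideal_of xs (s * x ^+ n).
  elim: n s => [|n IHn] s Ps; first by rewrite mulr1 => /xs'P.
  rewrite exprS mulrCA => /rx[t Pt]; rewrite mulrA; apply: IHn.
  exact: prime_mul_notin.
have [|||Q [pQ xsQ SQ]] := exists_prime nA
  (S := [set t | exists2 s, ~ P s & exists n, t = s * x ^+ n])
  (ideal_of_ideal xs).
- by exists 1 => //; exists 0%N; rewrite mulr1.
- move=> _ _ [s Ps [m ->]] [t Pt [n ->]]; exists (s * t).
    exact: prime_mul_notin.
  by exists (m + n)%N; rewrite exprD mulrACA.
- by move=> _ [s Ps [n ->]]; apply: avoid.
have QP : Q `<=` P.
  move=> s Qs; apply: contrapT => Ps; apply: SQ Qs.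
  by exists s => //; exists 0%N; rewrite mulr1.
have ltQP : Q `<` P.
  split=> // PQ; apply: (SQ x); last by apply/PQ/xsP/mem_head.
  by exists 1 => //; exists 1%N; rewrite mul1r.
have [||p chp pn] := IH Q pQ.
- by move=> y y_xs; apply/xsQ/ideal_of_mem.
- exact: regular_at_sub rxs.
exists (fun i => if (i <= size xs)%N then p i else P); last by rewrite ltnn.
by apply: prime_chain_rcons; rewrite ?pn.
Qed.

(** Regularity of the first term puts its coefficient into the ideal of the other
    terms, locally; substituting this leaves a relation between those. *)
Lemma regular_at_coef P xs (b : nat -> A) : is_prime_ideal P ->
  (forall x, x \in xs -> P x) -> regular_at P xs ->
  \sum_(i < size xs) b i * xs`_i = 0 -> forall i, (i < size xs)%N -> P (b i).
Proof.
move=> pP; have [iP P1 PM] := pP; elim: xs b => [//|x xs IH] b xsP [rxs rx].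
have xs'P y : y \in xs -> P y by move=> y_xs; apply: xsP; rewrite in_cons y_xs orbT.
rewrite big_ord_recl => E.
have {}E : b 0%N * x + \sum_(i < size xs) b i.+1 * xs`_i = 0 by [].
have [s Ps Isb] : saturation P (ideal_of xs) (b 0%N).
  apply: rx; have -> : x * b 0%N = - \sum_(i < size xs) b i.+1 * xs`_i.
    by apply/eqP; rewrite -addr_eq0 mulrC; apply/eqP.
  apply: ideal_opp; first exact: ideal_of_ideal.
  by apply/ideal_ofP; exists (fun i => b i.+1).
have Pb0 : P (b 0%N) by have /PM[] := ideal_of_sub iP xs'P Isb.
have /ideal_ofP[c Ec] := Isb.
case=> [//|i]; rewrite ltnS => lt_i.
have : P (x * c i + s * b i.+1).
  apply: (IH (fun i => x * c i + s * b i.+1)) => //.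
  under eq_bigr do rewrite mulrDl -!mulrA.
  rewrite big_split /= -!mulr_sumr -Ec.
  transitivity (s * (b 0%N * x + \sum_(j < size xs) b j.+1 * xs`_j)); first by ring.
  by rewrite E mulr0.
have [_ PD PI] := iP.
move=> Pi; have : P (s * b i.+1).
  have -> : s * b i.+1 = x * c i + s * b i.+1 - x * c i by ring.
  by apply: ideal_sub => //; apply: ideal_mulr => //; apply/xsP/mem_head.
by case/PM.
Qed.

Lemma comb_sum C xs z : is_ideal C -> comb C xs z ->
  exists2 m : nat -> A, (forall i, C (m i)) & z = \sum_(i < size xs) m i * xs`_i.
Proof.
move=> iC; elim: xs z => [|x xs IH] z /=.
  by move=> ->; exists (fun=> 0); rewrite ?big_ord0 // => _; case: iC.
move=> [c [w [Cc /IH[m Cm ->] ->]]].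
exists (fun n => if n is n'.+1 then m n' else c); first by case.
by rewrite big_ord_recl.
Qed.

Lemma local_maximal_ideal M : is_prime_ideal M ->
  (forall s, ~ M s -> exists t, s * t = 1) ->
  is_maximal_ideal M /\ forall M', is_maximal_ideal M' -> M' = M.
Proof.
move=> [iM M1 _] unitM.
have sub_M I : is_ideal I -> ~ I 1 -> I `<=` M.
  move=> iI I1 x Ix; apply: contrapT => /unitM[t xt]; apply: I1.
  by rewrite -xt; apply: ideal_mulr.
split=> [|M' [iM' M'1 maxM']]; last by symmetry; apply: maxM' => //; apply: sub_M.
by split=> // I iI I1 MI; apply/seteqP; split=> //; apply: sub_M.
Qed.

Lemma ideal_square_sub_comb M xs : is_ideal M -> M = ideal_of xs ->
  ideal_square M `<=` comb M xs.
Proof.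
move=> iM Exs z; apply; split; first exact: comb_ideal.
by move=> _ [x [y [Mx My ->]]]; apply: comb_mul; rewrite -?Exs.
Qed.

(** The height theorem bounds the dimension by the number d of generators; the
    chain obtained from the regular sequence attains d, and the regularity makes
    the generators independent modulo the square of the maximal ideal. *)
Theorem regular_localI M xs : noetherian A -> is_prime_ideal M ->
  (forall s, ~ M s -> exists t, s * t = 1) ->
  M = ideal_of xs -> regular_at M xs -> regular_local A.
Proof.
move=> nA pM unitM Exs rxs; have [iM M1 MM] := pM.
have [maxM uniqM] := local_maximal_ideal pM unitM.
have xsM x : x \in xs -> M x by rewrite Exs; apply: ideal_of_mem.
split=> //; exists M; split=> //; exists (size xs); split.
  split=> [|n [p chp]].
    by have [p chp _] := regular_prime_chain nA pM xsM rxs; exists p.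
  have [pp ltp] := chp; have [ipn pn1 _] := pp n (leqnn n).
  have pnM : p n `<=` M.
    move=> x px; apply: contrapT => /unitM[t xt]; apply: pn1.
    by rewrite -xt; apply: ideal_mulr.
  have bound q m : prime_chain q m -> q m = M -> (m <= size xs)%N.
    move=> chq qm; have [pq _] := chq; have [[iq0 _ _] _ _] := pq 0%N isT.
    apply: (height_theorem nA pM (set1_0_ideal A) xsM) chq _ qm.
      move=> x Mx; apply: sub_saturation => //.
      by apply: ideal_addr; rewrite -?Exs //; apply: set1_0_ideal.
    by move=> _ ->.
  have [/bound|neM] := pselect (p n = M); first exact.
  apply: ltnW; apply: (bound (fun i => if (i <= n)%N then p i else M)).
    apply: prime_chain_rcons => //.
    by rewrite properEneq; split=> //; apply/eqP.
  by rewrite ltnn.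
exists (fun i => xs`_i); split=> [i|y|a].
- by apply/xsM/mem_nth.
- rewrite {1}Exs => /ideal_ofP[b ->]; exists (fun i => b i).
  by rewrite subrr => I [[]].
move=> /(ideal_square_sub_comb iM Exs) Ca i.
have [m Mm Em] := comb_sum iM Ca.
pose a' n := if insub n is Some j then a j else 0.
have a'E (j : 'I_(size xs)) : a' j = a j by rewrite /a' valK.
have /(_ i (ltn_ord i)) : forall j, (j < size xs)%N -> M (a' j - m j).
  apply: (regular_at_coef (b := fun j => a' j - m j) pM xsM rxs).
  under eq_bigr do rewrite mulrBl a'E.
  by rewrite sumrB Em subrr.
by rewrite a'E => Mam; apply: ideal_subKr (Mm i) Mam.
Qed.

End RegularSequences.

(** * Localizations *)

Section LocalizationAt.
Variables (A : comPzRingType) (p : prime_ideal A).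
Local Notation P := (prime_set p).
Local Notation B := (localization p).
Implicit Types (a s x y : A) (b c : B) (xs : seq A).

Let pP : is_prime_ideal P. Proof. exact: prime_setP. Qed.
Let P1 : ~ P 1. Proof. by case: pP. Qed.

Definition loc a : B := to_frac a P1.

Lemma to_frac_mul a s (Ps : ~ P s) a' s' (Ps' : ~ P s') (Pss' : ~ P (s * s')) :
  to_frac a Ps * to_frac a' Ps' = to_frac (a * a') Pss'.
Proof.
by rewrite [LHS]loc_mulE; apply/to_frac_eq; exists 1; rewrite // subrr mulr0.
Qed.

Lemma locM a a' : loc (a * a') = loc a * loc a'.
Proof.
rewrite [RHS]loc_mulE; apply/to_frac_eq.
by exists 1; rewrite // !mulr1 subrr mulr0.
Qed.

Lemma locD a a' : loc (a + a') = loc a + loc a'.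
Proof.
rewrite [RHS]loc_addE; apply/to_frac_eq.
by exists 1; rewrite // !mulr1 subrr mulr0.
Qed.

Lemma loc1 : loc 1 = 1.
Proof. by apply/to_frac_eq; exists 1; rewrite // subrr mulr0. Qed.

Lemma loc0 : loc 0 = 0.
Proof. by apply: (addrI (loc 0)); rewrite -locD !addr0. Qed.

Lemma loc_eq0 a : loc a = 0 -> exists2 s, ~ P s & s * a = 0.
Proof.
rewrite -loc0 => /to_frac_eq[s Ps]; rewrite mul0r subr0 mulr1 => E.
by exists s.
Qed.

Lemma loc_inv s : ~ P s -> exists b, loc s * b = 1.
Proof.
move=> Ps; exists (to_frac 1 Ps); have Ps1 : ~ P (1 * s) by rewrite mul1r.
rewrite /loc (@to_frac_mul _ _ _ _ _ _ Ps1) -loc1; apply/to_frac_eq.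
by exists 1; rewrite // !mulr1 !mul1r subrr.
Qed.

Lemma loc_frac b : exists a s, ~ P s /\ b * loc s = loc a.
Proof.
have [a [s [Ps ->]]] := to_fracP b; exists a, s; split=> //.
have Ps1 : ~ P (s * 1) by rewrite mulr1.
rewrite /loc (@to_frac_mul _ _ _ _ _ _ Ps1); apply/to_frac_eq.
by exists 1; rewrite // !mulr1 subrr mulr0.
Qed.

Lemma loc_div s b (I : set B) : ~ P s -> is_ideal I -> I (b * loc s) -> I b.
Proof.
move=> /loc_inv[t st] iI Ibs; rewrite -[b]mulr1 -st mulrA.
exact: ideal_mulr.
Qed.

Lemma contraction_ideal (I : set B) : is_ideal I -> is_ideal [set a | I (loc a)].
Proof.
move=> [I0 ID IM]; split=> /= [|x y|a x].
- by rewrite loc0.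
- by rewrite locD; apply: ID.
- by rewrite locM; apply: IM.
Qed.

Lemma ideal_of_loc xs a : ideal_of xs a -> ideal_of (map loc xs) (loc a).
Proof.
apply: (ideal_of_sub (contraction_ideal (ideal_of_ideal _))) => x x_xs /=.
exact/ideal_of_mem/map_f.
Qed.

Lemma ideal_of_loc_frac xs b : ideal_of (map loc xs) b ->
  exists a s, [/\ ~ P s, ideal_of xs a & b * loc s = loc a].
Proof.
elim: xs b => [|x xs IH] b /= => [->|[c [b' [_ /IH[a [s [Ps Ia E]]] ->]]]].
  by exists 0, 1; rewrite loc1 loc0 mulr1.
have [d [t [Pt E']]] := loc_frac c.
exists (s * d * x + t * a), (s * t); split.
- exact: prime_mul_notin.
- by exists (s * d), (t * a); split=> //; case: (ideal_of_ideal xs) => _ _; apply.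
- rewrite locD !locM -E' -E; ring.
Qed.

Lemma ideal_of_locE xs a : ideal_of (map loc xs) (loc a) <->
  saturation P (ideal_of xs) a.
Proof.
split=> [/ideal_of_loc_frac[a' [s [Ps Ia' E]]]|[s Ps /ideal_of_loc]]; last first.
  rewrite locM mulrC; apply: loc_div => //; exact: ideal_of_ideal.
have [|t Pt E'] := @loc_eq0 (a * s - a').
  by apply: (addIr (loc a')); rewrite -locD subrK locM E add0r.
exists (t * s); first exact: prime_mul_notin.
have -> : t * s * a = t * a' + t * (a * s - a') by ring.
by rewrite E' addr0; case: (ideal_of_ideal xs) => _ _; apply.
Qed.

Lemma noetherian_localization : noetherian A -> noetherian B.
Proof.
move=> nA I iI; have [xs Exs] := noetherian_ideal_of nA (contraction_ideal iI).
exists (map loc xs); rewrite smallest_ideal_of; apply/seteqP; split=> [b Ib|].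
  have [a [s [Ps E]]] := loc_frac b.
  apply: (loc_div Ps (ideal_of_ideal _)); rewrite E; apply: ideal_of_loc.
  by rewrite -Exs /= -E; apply: ideal_mulr.
apply: ideal_of_sub => // _ /mapP[x x_xs ->].
by rewrite -[I _]/([set a | I (loc a)] x) Exs; apply: ideal_of_mem.
Qed.

Definition loc_max : set B := [set b | exists a s, [/\ P a, ~ P s & b * loc s = loc a]].

Lemma loc_maxE a : loc_max (loc a) <-> P a.
Proof.
have [iP _ PM] := pP; split=> [[a' [s [Pa' Ps E]]]|Pa]; last first.
  by exists a, 1; rewrite loc1 mulr1.
have [|t Pt E'] := @loc_eq0 (a * s - a').
  by apply: (addIr (loc a')); rewrite -locD subrK locM E add0r.
have : P (t * (s * a)).
  have -> : t * (s * a) = t * a' + t * (a * s - a') by ring.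
  by rewrite E' addr0; case: iP => _ _; apply.
by case/PM => [//|/PM[]].
Qed.

Lemma loc_max_prime : is_prime_ideal loc_max.
Proof.
have [[P0 PD PI] _ PM] := pP.
split; first split.
- by rewrite -loc0; apply/loc_maxE.
- move=> b c [a [s [Pa Ps E]]] [a' [s' [Pa' Ps' E']]].
  exists (s' * a + s * a'), (s * s'); split.
  + by apply: PD; apply: PI.
  + exact: prime_mul_notin.
  + by rewrite locD !locM -E -E'; ring.
- move=> c b [a [s [Pa Ps E]]]; have [d [t [Pt E']]] := loc_frac c.
  exists (d * a), (t * s); split; [exact: PI|exact: prime_mul_notin|].
  by rewrite !locM -E -E'; ring.
- by rewrite -loc1 => /loc_maxE.
move=> b c [a [s [Pa Ps E]]]; have [d [t [Pt Eb]]] := loc_frac b.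
have [e [u [Pu Ec]]] := loc_frac c.
have : P (s * (d * e)).
  apply/loc_maxE; rewrite !locM -Eb -Ec.
  have -> : loc s * (b * loc t * (c * loc u)) = b * c * loc s * loc (t * u).
    by rewrite locM; ring.
  by rewrite E -locM; apply/loc_maxE; rewrite mulrC; apply: PI.
case/PM => [//|/PM[Pd|Pe]]; [left; exists d, t|right; exists e, u]; by split.
Qed.

Lemma loc_max_unit b : ~ loc_max b -> exists c, b * c = 1.
Proof.
move=> Mb; have [a [s [Ps E]]] := loc_frac b.
have [|c Ec] := @loc_inv a; first by move=> Pa; apply: Mb; exists a, s.
by exists (loc s * c); rewrite mulrA E.
Qed.

(** Local generation by a regular sequence passes to the localization, whose
    maximal ideal is then generated by a regular sequence. *)
Theorem regular_localization xs : noetherian A -> (forall x, x \in xs -> P x) ->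
  regular_at P xs -> P `<=` saturation P (ideal_of xs) ->
  regular_local B.
Proof.
move=> nA xsP rxs gen.
have iM xs' : is_ideal (ideal_of (map loc xs')) := ideal_of_ideal _.
apply: (@regular_localI _ loc_max (map loc xs)).
- exact: noetherian_localization.
- exact: loc_max_prime.
- exact: loc_max_unit.
- apply/seteqP; split=> [b [a [s [Pa Ps E]]]|].
    by apply: (loc_div Ps) => //; rewrite E; apply/ideal_of_locE/gen.
  have [iMax _ _] := loc_max_prime.
  by apply: ideal_of_sub => // _ /mapP[x /xsP Px ->]; apply/loc_maxE.
elim: xs rxs {xsP gen} => //= x xs IH [/IH rxs rx]; split=> // b Ixb.
apply: sub_saturation; first exact: loc_max_prime.
have [a [s [Ps E]]] := loc_frac b.
apply: (loc_div Ps) => //; rewrite E; apply/ideal_of_locE.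
apply: saturation_saturated => //.
have [|t Pt] := (ideal_of_locE xs (x * a)).1.
  by rewrite locM -E mulrA; apply: ideal_mulr.
by rewrite mulrCA => /rx; exists t.
Qed.

(** At a minimal prime the dimension is 0, so a regular localization has maximal
    ideal M = M^2, hence M = 0 by Nakayama's lemma. *)
Lemma regular_minimal_prime : noetherian A ->
  (forall Q, is_prime_ideal Q -> Q `<=` P -> Q = P) ->
  regular_local B -> forall y, P y -> exists2 s, ~ P s & s * y = 0.
Proof.
move=> nA minP [nB [M [maxM uniqM [d [[[q [pq ltq]] _] [x [_ genx _]]]]]]] y Py.
have contr (Q : set B) : is_prime_ideal Q -> [set a | Q (loc a)] = P.
  move=> [iQ Q1 QM]; apply: minP.
    split=> [||a a']; [exact: contraction_ideal|by rewrite /= loc1|].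
    by rewrite /= locM; apply: QM.
  move=> a Qa; apply: contrapT => /loc_inv[c Ec]; apply: Q1.
  by rewrite -Ec; apply: ideal_mulr.
have d0 : d = 0%N.
  case: d pq ltq {x genx} => [//|d] pq ltq.
  have [_ /nonsubset[b [q1b q0b]]] := ltq 0%N isT; case: q0b.
  have pq0 := pq 0%N isT; have pq1 := pq 1%N isT.
  have [a [s [Ps E]]] := loc_frac b.
  have [iq0 _ _] := pq0; have [iq1 _ _] := pq1.
  apply: (loc_div Ps) => //; rewrite E -[q 0%N _]/([set a | q 0%N (loc a)] a).
  by rewrite contr // -(contr (q 1%N)) //= -E; apply: ideal_mulr.
have [maxL _] := local_maximal_ideal loc_max_prime loc_max_unit.
have ML : loc_max = M by apply: uniqM.
have pM : is_prime_ideal M by rewrite -ML; apply: loc_max_prime.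
have [iM _ _] := pM.
have [zs Ezs] := noetherian_ideal_of nB iM.
apply: loc_eq0; have Mz z : z \in zs -> saturation M [set 0] z.
  apply: nakayama => //; first exact: set1_0_ideal.
  move=> {}z z_zs; exists 1, z; rewrite mul1r subrr; split=> //.
    by have [_] := pM.
  apply: (ideal_square_sub_comb iM Ezs).
  have [|a] := genx z; first by rewrite Ezs; apply: ideal_of_mem.
  by rewrite big1 ?subr0 // => i _; have := ltn_ord i; rewrite [X in (_ < X)%N]d0.
have [|s Ms /= sy] := saturation_comb (y := loc y) pM (set1_0_ideal _) Mz.
  by rewrite -Ezs -ML; apply/loc_maxE.
have [c sc] : exists c, s * c = 1 by apply: loc_max_unit; rewrite ML.
by rewrite -[loc y]mul1r -sc mulrAC sy mul0r.
Qed.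

End LocalizationAt.

(** * Independence over a subfield *)

Section Subrings.
Variable A : pzRingType.
Implicit Types (R : set A) (x y : A).

Definition is_subring R : Prop :=
  [/\ R 1, forall x y, R x -> R y -> R (x - y) & forall x y, R x -> R y -> R (x * y)].

(** The subset B makes a basis extracted from a family a subfamily on the same
    index type. *)
Definition free_over R (I : finType) (B : {set I}) (a : I -> A) : Prop :=
  forall c : I -> A, (forall i, R (c i)) -> \sum_(i in B) c i * a i = 0 ->
    forall i, i \in B -> c i = 0.

Section Closure.
Variable R : set A.
Hypothesis sR : is_subring R.

Lemma subring1 : R 1. Proof. by case: sR. Qed.
Lemma subringB x y : R x -> R y -> R (x - y).
Proof. by case: sR => _ RB _; apply: RB. Qed.
Lemma subringM x y : R x -> R y -> R (x * y). Proof. by case: sR => _ _; apply. Qed.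
Lemma subring0 : R 0.
Proof. by rewrite -(subrr 1); apply: subringB; apply: subring1. Qed.
Lemma subringN x : R x -> R (- x).
Proof. by move=> Rx; rewrite -[- x]add0r; apply: subringB => //; apply: subring0. Qed.
Lemma subringD x y : R x -> R y -> R (x + y).
Proof. by move=> Rx Ry; rewrite -[y]opprK; apply: subringB => //; apply: subringN. Qed.
Lemma subringX x n : R x -> R (x ^+ n).
Proof.
move=> Rx; elim: n => [|n IH]; first by rewrite expr0; apply: subring1.
by rewrite exprS; apply: subringM.
Qed.
Lemma subring_sum (J : Type) (r : seq J) (P : pred J) (G : J -> A) :
  (forall i, P i -> R (G i)) -> R (\sum_(i <- r | P i) G i).
Proof. by move=> RG; apply: big_ind => //; [exact: subring0|exact: subringD]. Qed.
Lemma subring_prod (J : Type) (r : seq J) (P : pred J) (G : J -> A) :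
  (forall i, P i -> R (G i)) -> R (\prod_(i <- r | P i) G i).
Proof. by move=> RG; apply: big_ind => //; [exact: subring1|exact: subringM]. Qed.
Lemma subring_nat n : R n%:R.
Proof.
elim: n => [|n IH]; first exact: subring0.
by rewrite -natr1; apply: subringD => //; apply: subring1.
Qed.
End Closure.

End Subrings.

(** Group a relation between the products by the index of a: its coefficients are
    combinations of the e_j, hence lie in R. *)
Lemma free_over_mul (A : comPzRingType) (R0 R : set A) (I J : finType) (B : {set I})
    (D : {set J}) (a : I -> A) (e : J -> A) :
  is_subring R -> R0 `<=` R -> (forall j, R (e j)) ->
  free_over R B a -> free_over R0 D e ->
  free_over R0 (finset.setX B D) (fun p : I * J => a p.1 * e p.2).
Proof.
move=> rR R0R Re fra fre x R0x x0 [i q]; rewrite finset.in_setX /= => /andP[iB qD].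
have xi0 : forall i, i \in B -> \sum_(q in D) x (i, q) * e q = 0.
  apply: fra => [i'|].
    by apply: (subring_sum rR) => q' _; apply: (subringM rR) => //; apply: R0R.
  rewrite -[RHS]x0; under eq_bigr do rewrite mulr_suml.
  rewrite pair_big_dep /=; apply: eq_big => [[i' q']|[i' q'] _] /=.
    by rewrite finset.in_setX.
  by ring.
exact: (fre (fun q => x (i, q)) _ (xi0 i iB)) qD.
Qed.

Lemma free_over_morph (F F' : fieldType) (h : {rmorphism F -> F'}) (E : set F)
    (I : finType) (B : {set I}) (a : I -> F) :
  free_over (h @` E) B (h \o a) <-> free_over E B a.
Proof.
split=> [fra c Ec c0 i iB|fra c Ec c0 i iB].
  apply: (fmorph_inj h); rewrite rmorph0; apply: (fra (fun i => h (c i))) iB => [j|].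
    by exists (c j).
  by under eq_bigr do rewrite -rmorphM; rewrite -rmorph_sum c0 rmorph0.
have /choice[d dP] : forall i, exists d, E d /\ h d = c i.
  by move=> j; have [d Ed dc] := Ec j; exists d.
rewrite -(dP i).2 (fra d _ _ i iB) ?rmorph0 // => [j|]; first by case: (dP j).
apply: (fmorph_inj h); rewrite rmorph0 -[RHS]c0 rmorph_sum.
by apply: eq_bigr => j _; rewrite rmorphM -(dP j).2.
Qed.

(** A sum over a list as a sum over a larger range: lists of different lengths get
    a common index type, so that sums over them can be exchanged. *)
Lemma big_nth_pad (T : Type) (V : nmodType) (z0 : T) (G : T -> V) (s : seq T) n :
  G z0 = 0 -> (size s <= n)%N ->
  \sum_(z <- s) G z = \sum_(j < n) G (nth z0 s j).
Proof.
move=> G0 le_n; rewrite (big_nth z0) big_mkord.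
pose H j := G (nth z0 s j).
rewrite -(big_mkord xpredT H) -[RHS](big_mkord xpredT H).
rewrite [RHS](big_cat_nat (n := size s)) //= [X in _ + X]big_nat_cond.
rewrite [X in _ + X]big1 ?addr0 // => j /andP[/andP[le_j _] _].
by rewrite /H nth_default.
Qed.

Lemma range_subring (A A' : pzRingType) (h : {rmorphism A -> A'}) :
  is_subring (range h).
Proof.
split=> [|_ _ [x _ <-] [y _ <-]|_ _ [x _ <-] [y _ <-]].
- by exists 1; rewrite ?rmorph1.
- by exists (x - y); rewrite ?rmorphB.
- by exists (x * y); rewrite ?rmorphM.
Qed.

Section Subfields.
Variable F : fieldType.
Implicit Types (E : set F) (x y : F).

Lemma subfieldP E : is_subfield E <-> is_subring E /\ forall x, E x -> E x^-1.
Proof.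
split=> [[E1 EB Ediv]|[[E1 EB EM] EV]]; last first.
  split=> [|x y|x y]; rewrite !inE //; first exact: EB.
  by move=> Ex Ey; apply/EM/EV.
rewrite inE in E1; have E_div x y : E x -> E y -> E (x / y).
  by move=> Ex Ey; have := Ediv x y; rewrite !inE; apply.
have EV x : E x -> E x^-1 by rewrite -[x^-1]mul1r; apply: E_div.
split=> //; split=> // x y Ex Ey; first by have := EB x y; rewrite !inE; apply.
by rewrite -[y]invrK; apply/E_div/EV.
Qed.

Lemma subfield_subring E : is_subfield E -> is_subring E.
Proof. by move=> /subfieldP[]. Qed.

Lemma subfieldV E x : is_subfield E -> E x -> E x^-1.
Proof. by move=> /subfieldP[_]; apply. Qed.

Lemma range_subfield (k : fieldType) (f : {rmorphism k -> F}) : is_subfield (range f).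
Proof.
apply/subfieldP; split=> [|_ [x _ <-]]; first exact: range_subring.
by exists x^-1; rewrite ?fmorphV.
Qed.

(** A subfamily of maximal size among the free ones spans the family. *)
Lemma exists_basis E (I : finType) (a : I -> F) : is_subfield E ->
  exists B : {set I}, free_over E B a /\
    exists g : I -> I -> F, forall i, (forall j, E (g i j)) /\
      a i = \sum_(j in B) g i j * a j.
Proof.
move=> sE; have rE := subfield_subring sE.
pose fr (B : {set I}) := `[< free_over E B a >].
have fr0 : fr finset.set0 by apply/asboolP => c _ _ i; rewrite inE.
case: (arg_maxnP (fun B : {set I} => #|B|) fr0) => B /asboolP frB maxB.
exists B; split=> //.
suff /choice[g gP] : forall i, exists g : I -> F,
    (forall j, E (g j)) /\ a i = \sum_(j in B) g j * a j by exists g.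
move=> i; have [iB|iB] := boolP (i \in B).
  exists (fun j => (j == i)%:R); split=> [j|]; first exact: subring_nat.
  rewrite (bigD1 i) //= eqxx mul1r big1 ?addr0 // => j /andP[_ /negPf ->].
  by rewrite mul0r.
have /asboolPn/existsNP[c /not_implyP[Ec /not_implyP[c0 /existsNP[j]]]] :
    ~~ fr (i |: B).
  by apply/negP => /maxB /=; rewrite cardsU1 iB ltnn.
move=> /not_implyP[]; rewrite big_setU1 //= in c0 * => jB cj.
have ci : c i != 0.
  apply/eqP => ci; rewrite ci mul0r add0r in c0.
  move: jB; rewrite in_setU1 => /orP[/eqP ij|jB]; apply: cj; rewrite ?ij //.
  exact: frB.
exists (fun j => - c j / c i); split=> [l|].
  by apply: subringM => //; [apply: subringN|apply: subfieldV].
apply: (mulfI ci); rewrite mulr_sumr.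
under eq_bigr do rewrite mulrCA !mulrA mulrVK ?unitfE // mulNr.
by rewrite sumrN; apply/eqP; rewrite -addr_eq0; apply/eqP.
Qed.

(** Zorn's lemma gives a maximal subspace that contains U but not v; the line
    through v is a complement of it. *)
Lemma exists_functional (k : fieldType) (f : {rmorphism k -> F}) (U : set F) v :
  U 0 -> (forall c x y, U x -> U y -> U (f c * x + y)) -> ~ U v ->
  exists l : F -> k, [/\ forall c x y, l (f c * x + y) = c * l x + l y,
    forall x, U x -> l x = 0 & l v = 1].
Proof.
move=> U0 UL Uv.
pose good (W : set F) := [/\ U `<=` W,
  (forall c x y, W x -> W y -> W (f c * x + y)) & ~ W v].
have [D DP totD|W [WP maxW]] := @Zorn_bigcup F [set W | W = set0 \/ good W].
  have [[W0 [DW0 gW0]]|noW] := pselect (exists W, D W /\ good W); last first.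
    left; apply/seteqP; split=> // x [W DW Wx].
    by have [W0|gW] := DP W DW; [rewrite W0 in Wx|case: noW; exists W].
  right; split=> [x Ux|c x y [W1 DW1 W1x] [W2 DW2 W2y]|[W DW Wv]].
  - by exists W0 => //; case: gW0 => UW _ _; apply: UW.
  - have [W' DW' [W'x W'y]] : exists2 W', D W' & W' x /\ W' y.
      by have [le|le] := totD _ _ DW1 DW2; [exists W2|exists W1] => //;
        split=> //; apply: le.
    exists W' => //; have [W'0|[_ W'L _]] := DP W' DW'; last exact: W'L.
    by rewrite W'0 in W'x.
  - by have [W0'|[]//] := DP W DW; rewrite W0' in Wv.
have [UW WL Wv] : good W.
  case: WP => // W0; exfalso; apply: (maxW U); last by right; split.
  by rewrite W0; split=> // /(_ _ U0).
have W0 : W 0 by apply: UW.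
have WZ c x : W x -> W (f c * x) by move=> Wx; rewrite -[f c * x]addr0; apply: WL.
have WB x y : W x -> W y -> W (x - y).
  by move=> Wx Wy; rewrite addrC -mulN1r -(rmorph1 f) -rmorphN; apply: WL.
have coord x : exists c, W (x - f c * v).
  apply: contrapT => noc; pose W' := [set y | exists w c, W w /\ y = w + f c * x].
  have WW' : W `<=` W' by move=> w Ww; exists w, 0; rewrite rmorph0 mul0r addr0.
  apply: (maxW W').
    split=> // /(_ x) W'x; apply: noc; exists 0; rewrite rmorph0 mul0r subr0.
    by apply: W'x; exists 0, 1; rewrite rmorph1 mul1r add0r.
  right; split; first exact: subset_trans WW'.
    move=> c _ _ [w [a [Ww ->]]] [w' [a' [Ww' ->]]].
    exists (f c * w + w'), (c * a + a'); split; first exact: WL.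
    by rewrite rmorphD rmorphM; ring.
  move=> [w [c [Ww Ev]]]; apply: noc; exists c^-1.
  have c0 : f c != 0.
    by apply/eqP => fc0; apply: Wv; rewrite Ev fc0 mul0r addr0.
  have -> : x - f c^-1 * v = f (- c^-1) * w.
    by rewrite Ev rmorphN fmorphV mulrDr mulrA mulVf // mul1r; ring.
  exact: WZ.
have uniq c c' x : W (x - f c * v) -> W (x - f c' * v) -> c = c'.
  move=> Wc Wc'; apply: contrapT => /eqP; rewrite -subr_eq0 => ne; apply: Wv.
  have -> : v = f (c - c')^-1 * ((x - f c' * v) - (x - f c * v)).
    have -> : x - f c' * v - (x - f c * v) = f (c - c') * v.
      by rewrite rmorphB; ring.
    by rewrite mulrA -rmorphM mulVf // rmorph1 mul1r.
  by apply/WZ/WB.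
have [l lP] := choice coord; exists l; split=> [c x y|x Ux|].
- apply: uniq (lP _) _.
  have -> : f c * x + y - f (c * l x + l y) * v =
      f c * (x - f (l x) * v) + (y - f (l y) * v).
    by rewrite rmorphD rmorphM; ring.
  exact: WL.
- by apply: uniq (lP _) _; rewrite rmorph0 mul0r subr0; apply: UW.
- by apply: uniq (lP _) _; rewrite rmorph1 mul1r subrr.
Qed.

End Subfields.

(** * Tensor products *)

(** Bilinear maps out of a tensor product over k take values in modules over k; an
    algebra becomes one by restriction of scalars along its structure morphism. *)
Definition restrict (k R : comPzRingType) (g : {rmorphism k -> R}) : Type := R.

Section Restrict.
Variables (k R : comPzRingType) (g : {rmorphism k -> R}).
HB.instance Definition _ := GRing.Zmodule.copy (restrict g) R.
Definition restrict_scale (c : k) (x : restrict g) : restrict g := g c * (x : R).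
Fact restrict_scaleA a b x :
  restrict_scale a (restrict_scale b x) = restrict_scale (a * b) x.
Proof. by rewrite /restrict_scale rmorphM mulrA. Qed.
Fact restrict_scale1 : left_id 1 restrict_scale.
Proof. by move=> x; rewrite /restrict_scale rmorph1 mul1r. Qed.
Fact restrict_scaleDr : right_distributive restrict_scale +%R.
Proof. by move=> a x y; rewrite /restrict_scale mulrDr. Qed.
Fact restrict_scaleDl v : {morph restrict_scale^~ v : a b / a + b}.
Proof. by move=> a b; rewrite /restrict_scale rmorphD mulrDl. Qed.
HB.instance Definition _ := GRing.Zmodule_isLmodule.Build k (restrict g)
  restrict_scaleA restrict_scale1 restrict_scaleDr restrict_scaleDl.
End Restrict.

Section TensorProducts.
Variables (k A B : comPzRingType) (f : {rmorphism k -> A}) (g : {rmorphism k -> B}).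
Local Notation pure := (pure f g).

Lemma tensor_sum (x : tensor f g) : x = \sum_(z <- repr x) pure z.1 z.2.
Proof.
by rewrite -to_tensorE; apply/esym/reprK.
Qed.

Lemma pure_in_l a c : pure a c = pure a 1 * pure 1 c.
Proof. by rewrite pureM mulr1 mul1r. Qed.

Definition tensor_inl a : tensor f g := pure a 1.
Definition tensor_inr c : tensor f g := pure 1 c.

Lemma pure0r a : pure a 0 = 0.
Proof. by apply: (addrI (pure a 0)); rewrite -pureDr !addr0. Qed.

Lemma pure0l c : pure 0 c = 0.
Proof. by apply: (addrI (pure 0 c)); rewrite -pureDl !addr0. Qed.

Lemma pureBl a a' c : pure (a - a') c = pure a c - pure a' c.
Proof. by apply: (addIr (pure a' c)); rewrite -pureDl !subrK. Qed.

Lemma pureBr a c c' : pure a (c - c') = pure a c - pure a c'.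
Proof. by apply: (addIr (pure a c')); rewrite -pureDr !subrK. Qed.

Lemma pure_suml (J : Type) (r : seq J) (P : pred J) (G : J -> A) c :
  pure (\sum_(i <- r | P i) G i) c = \sum_(i <- r | P i) pure (G i) c.
Proof. by apply: (big_morph (pure^~ c)) => [x y|]; rewrite ?pureDl ?pure0l. Qed.

Lemma pure_sumr (J : Type) (r : seq J) (P : pred J) (G : J -> B) a :
  pure a (\sum_(i <- r | P i) G i) = \sum_(i <- r | P i) pure a (G i).
Proof. by apply: (big_morph (pure a)) => [x y|]; rewrite ?pureDr ?pure0r. Qed.

Fact tensor_inl_zmod : zmod_morphism tensor_inl.
Proof. by move=> a b; apply: pureBl. Qed.
Fact tensor_inl_monoid : monoid_morphism tensor_inl.
Proof. by split=> // a b; rewrite /tensor_inl pureM mulr1. Qed.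
HB.instance Definition _ :=
  GRing.isZmodMorphism.Build A (tensor f g) tensor_inl tensor_inl_zmod.
HB.instance Definition _ :=
  GRing.isMonoidMorphism.Build A (tensor f g) tensor_inl tensor_inl_monoid.

Fact tensor_inr_zmod : zmod_morphism tensor_inr.
Proof. by move=> a b; apply: pureBr. Qed.
Fact tensor_inr_monoid : monoid_morphism tensor_inr.
Proof. by split=> // a b; rewrite /tensor_inr pureM mulr1. Qed.
HB.instance Definition _ :=
  GRing.isZmodMorphism.Build B (tensor f g) tensor_inr tensor_inr_zmod.
HB.instance Definition _ :=
  GRing.isMonoidMorphism.Build B (tensor f g) tensor_inr tensor_inr_monoid.

Lemma tensor_in_base c : tensor_inl (f c) = tensor_inr (g c).
Proof. by rewrite /tensor_inl -[f c]mulr1 pureZ mulr1. Qed.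

Lemma tensor_lift (R : comPzRingType) (alpha : {rmorphism A -> R})
    (beta : {rmorphism B -> R}) : (forall c, alpha (f c) = beta (g c)) ->
  exists h : {rmorphism tensor f g -> R}, forall a c, h (pure a c) = alpha a * beta c.
Proof.
move=> agree.
pose b (a : A) (c : B) : restrict (alpha \o f) := alpha a * beta c.
have bb : k_bilinear f g b.
  split=> [x x' y|x y y'|c x y|c x y]; rewrite /b.
  - by rewrite rmorphD mulrDl.
  - by rewrite rmorphD mulrDr.
  - by rewrite rmorphM -mulrA.
  - by rewrite rmorphM mulrCA -agree.
pose h (x : tensor f g) : R := formal_eval b (repr x).
have hD : {morph h : x y / x + y} by move=> x y; apply: (eval_add bb x y).
have hp a c : h (pure a c) = alpha a * beta c by apply: (eval_pure a c bb).
have h0 : h 0 = 0 by apply: (addrI (h 0)); rewrite -hD !addr0.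
have hB : zmod_morphism h.
  by move=> x y; apply: (addIr (h y)); rewrite -hD !subrK.
have hM : monoid_morphism h.
  split=> [|x y]; first by rewrite -(pure1 f g) hp !rmorph1 mulr1.
  rewrite [x]tensor_sum [y]tensor_sum mulr_suml !(big_morph h hD h0) mulr_suml.
  apply: eq_bigr => z _; rewrite mulr_sumr !(big_morph h hD h0) mulr_sumr.
  by apply: eq_bigr => w _; rewrite pureM !hp !rmorphM mulrACA.
pose m1 := GRing.isZmodMorphism.Build _ _ h hB.
pose m2 := GRing.isMonoidMorphism.Build _ _ h hM.
pose h' : {rmorphism tensor f g -> R} := HB.pack h m1 m2.
by exists h'.
Qed.

End TensorProducts.

(** A k-linear functional on K that separates one member of a free family from
    the others extends to a map from the tensor product to L. *)
Lemma tensor_free (k K : fieldType) (L : comPzRingType) (f : {rmorphism k -> K})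
    (g : {rmorphism k -> L}) (I : finType) (B : {set I}) (a : I -> K) (l : I -> L) :
  free_over (range f) B a -> \sum_(i in B) pure f g (a i) (l i) = 0 ->
  forall i, i \in B -> l i = 0.
Proof.
move=> fr E i0 i0B.
pose U := [set x | exists c : I -> k, x = \sum_(i in B :\ i0) f (c i) * a i].
have [|c _ _ [c1 ->] [c2 ->]||lam [lamL lamU lam1]] :=
    @exists_functional K k f U (a i0).
- by exists (fun=> 0); rewrite big1 // => i _; rewrite rmorph0 mul0r.
- exists (fun i => c * c1 i + c2 i); rewrite mulr_sumr -big_split /=.
  by apply: eq_bigr => i _; rewrite rmorphD rmorphM mulrDl mulrA.
- move=> [c Ec].
  have /(_ i0 i0B)/eqP : forall i, i \in B -> f (if i == i0 then 1 else - c i) = 0.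
    apply: fr => [i|]; first by exists (if i == i0 then 1 else - c i).
    rewrite (big_setD1 i0) //= eqxx rmorph1 mul1r {1}Ec -big_split /=.
    apply: big1 => i; rewrite in_setD1 => /andP[/negPf -> _].
    by rewrite rmorphN mulNr subrr.
  by rewrite eqxx rmorph1 oner_eq0.
have lamD x y : lam (x + y) = lam x + lam y.
  by have := lamL 1 x y; rewrite rmorph1 !mul1r.
have lam0 : lam 0 = 0 by apply: (addrI (lam 0)); rewrite -lamD !addr0.
have lamZ c x : lam (f c * x) = c * lam x.
  by have := lamL c x 0; rewrite lam0 !addr0.
pose b (x : K) (y : L) : restrict g := g (lam x) * y.
have bb : k_bilinear f g b.
  split=> [x x' y|x y y'|c x y|c x y]; rewrite /b.
  - by rewrite lamD rmorphD mulrDl.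
  - by rewrite mulrDr.
  - by rewrite lamZ rmorphM -mulrA.
  - by rewrite mulrCA.
pose h (x : tensor f g) : L := formal_eval b (repr x).
have hD : {morph h : x y / x + y} by move=> x y; apply: (eval_add bb x y).
have hp x y : h (pure f g x y) = g (lam x) * y by apply: (eval_pure x y bb).
have h0 : h 0 = 0 by apply: (addrI (h 0)); rewrite -hD !addr0.
have := congr1 h E; rewrite h0 (big_morph h hD h0) (big_setD1 i0) //=.
rewrite hp lam1 rmorph1 mul1r big1 ?addr0 // => i iB; rewrite hp lamU.
  by rewrite rmorph0 mul0r.
exists (fun j => (j == i)%:R); rewrite (bigD1 i) //= eqxx rmorph1 mul1r big1 ?addr0 //.
by move=> j /andP[_ /negPf ->]; rewrite rmorph0 mul0r.
Qed.

(** * Frobenius powers *)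

Section Frobenius.
Variables (k : fieldType) (R : comPzRingType) (g : {rmorphism k -> R}).
Implicit Types x y : R.

Lemma frobeniusD n x y : [pchar k].-nat n -> (x + y) ^+ n = x ^+ n + y ^+ n.
Proof.
move=> cn.
(* The characteristic is that of k as soon as R is not the zero ring. *)
have [R1|R1] := eqVneq (1 : R) 0.
  by rewrite -[LHS]mulr1 -[RHS]mulr1 R1 !mulr0.
pose nz := GRing.PzSemiRing_isNonZero.Build R R1.
pose R' : comNzRingType := HB.pack (R : Type) nz (GRing.ComPzRing.class R).
apply: (@exprDn_pchar R' x y n); apply: sub_in_pnat cn => p _ /andP[pr_p /eqP p0].
rewrite inE pr_p /=; apply/eqP; have := congr1 g p0.
by rewrite rmorph_nat rmorph0.
Qed.

Lemma frobeniusB n x y : [pchar k].-nat n -> (x - y) ^+ n = x ^+ n - y ^+ n.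
Proof.
by move=> cn; apply: (addIr (y ^+ n)); rewrite -frobeniusD // !subrK.
Qed.

Lemma frobenius_sum n (J : Type) (r : seq J) (P : pred J) (G : J -> R) :
  [pchar k].-nat n ->
  (\sum_(i <- r | P i) G i) ^+ n = \sum_(i <- r | P i) G i ^+ n.
Proof.
move=> cn; apply: (big_morph (fun x => x ^+ n)) => [x y|]; first exact: frobeniusD.
by rewrite expr0n; case: n cn.
Qed.

End Frobenius.

(** * Polynomials over a subring *)

Section PolynomialsOver.
Variable A : comNzRingType.
Variable R : set A.
Hypothesis sR : is_subring R.
Implicit Types (p q r : {poly A}) (x y c : A).

Definition poly_over (E : set A) p : Prop := forall i, E p`_i.

Lemma poly_overC c : R c -> poly_over R c%:P.
Proof. by move=> Rc i; rewrite coefC; case: ifP => // _; apply: subring0. Qed.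

Lemma poly_over0 : poly_over R 0.
Proof. by move=> i; rewrite coef0; apply: subring0. Qed.

Lemma poly_overX : poly_over R 'X.
Proof. by move=> i; rewrite coefX; apply: subring_nat. Qed.

Lemma poly_over_subring : is_subring (poly_over R).
Proof.
split=> [i|p q Rp Rq i|p q Rp Rq i].
- by rewrite coef1; apply: subring_nat.
- by rewrite coefB; apply: subringB.
- by rewrite coefM; apply: subring_sum => // j _; apply: subringM.
Qed.

Lemma poly_overXn n : poly_over R 'X^n.
Proof. exact: (subringX poly_over_subring n poly_overX). Qed.

Lemma poly_overZ c p : R c -> poly_over R p -> poly_over R (c *: p).
Proof. by move=> Rc Rp i; rewrite coefZ; apply: subringM. Qed.

Lemma poly_over_horner p x : poly_over R p -> R x -> R p.[x].
Proof.
move=> Rp Rx; rewrite horner_coef; apply: subring_sum => // i _.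
by apply: subringM => //; apply: subringX.
Qed.

Lemma size_lt_coef0 n p : (forall i, (n <= i)%N -> p`_i = 0) -> (size p <= n)%N.
Proof. by move=> p0; apply/leq_sizeP. Qed.

(** The quotient and the remainder keep their coefficients in R, for any leading
    coefficient; for a monic q this is ordinary division. *)
Lemma pseudo_division q p : poly_over R q -> q != 0 -> poly_over R p ->
  exists n w r, [/\ poly_over R w, poly_over R r, (size r < size q)%N
    & lead_coef q ^+ n *: p = q * w + r].
Proof.
move=> Rq q0; have := leqnn (size p); move: {2}(size p) => m.
have rP := poly_over_subring.
elim: m p => [|m IH] p le_pm Rp.
  exists 0%N, 0, p; rewrite scale1r mulr0 add0r; split=> //; first exact: poly_over0.
  by move: le_pm; rewrite leqn0 => /eqP ->; rewrite size_poly_gt0.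
have [lt_pq|le_qp] := ltnP (size p) (size q).
  exists 0%N, 0, p; rewrite scale1r mulr0 add0r; split=> //; exact: poly_over0.
pose d := (size p - size q)%N; pose c := lead_coef q.
have Rc : R c by apply: Rq.
have Rw : poly_over R (lead_coef p *: 'X^d).
  by apply: poly_overZ; [apply: Rp|apply: poly_overXn].
pose p' := c *: p - q * (lead_coef p *: 'X^d).
have Rp' : poly_over R p'.
  by apply: (subringB rP); [apply: poly_overZ|apply: (subringM rP)].
have sq : (0 < size q)%N by rewrite size_poly_gt0.
have le_p' : (size p' <= m)%N.
  apply: size_lt_coef0 => i le_mi.
  rewrite /p' coefB coefZ -scalerAr coefZ coefMXn.
  have [lt_id|le_di] := ltnP i d.
    by move: lt_id le_pm sq; rewrite /d; move: (size q) (size p) => a b; lia.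
  have [/eqP Ei|ne] := boolP (i == (size p).-1).
    have -> : (i - d)%N = (size q).-1.
      by rewrite Ei /d; move: sq le_qp; move: (size q) (size p) => a b; lia.
    by rewrite -!lead_coefE Ei -lead_coefE mulrC subrr.
  have lt_i : ((size p).-1 < i)%N.
    rewrite ltn_neqAle eq_sym ne /=; apply: leq_trans le_mi.
    by move: le_pm; case: (size p).
  have -> : p`_i = 0.
    by apply: nth_default; move: lt_i; move: (size p) => a; lia.
  have -> : q`_(i - d) = 0; last by rewrite !mulr0 subrr.
  apply: nth_default; move: lt_i sq le_qp.
  by rewrite /d; move: (size q) (size p) => a b; lia.
have [n [w [r [Rw' Rr lt_r E]]]] := IH p' le_p' Rp'.
exists n.+1, (c ^+ n *: (lead_coef p *: 'X^d) + w), r; split=> //.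
  by apply: (subringD rP) => //; apply: poly_overZ => //; apply: subringX.
rewrite -/c mulrDr -addrA -E -/c /p' scalerBr [c ^+ n *: (c *: p)]scalerA -exprSr.
rewrite -[q * (c ^+ n *: _)]scalerAr.
by rewrite addrC subrK.
Qed.

End PolynomialsOver.

Lemma poly_over_sub (A : comNzRingType) (R R' : set A) p : R `<=` R' ->
  poly_over R p -> poly_over R' p.
Proof. by move=> RR' Rp i; apply: RR'. Qed.

(** * Adjunction *)

Section Adjunction.
Variable F : fieldType.
Implicit Types (E T : set F) (x y t : F) (p q r h : {poly F}).

Lemma adjoin_subfield E T : is_subfield (adjoin E T).
Proof.
apply/subfieldP; split; first split.
- by move=> M [/subfield_subring[]].
- move=> x y Ex Ey M [sM ETM]; have rM := subfield_subring sM.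
  by apply: subringB => //; [apply: Ex|apply: Ey].
- move=> x y Ex Ey M [sM ETM]; have rM := subfield_subring sM.
  by apply: subringM => //; [apply: Ex|apply: Ey].
- by move=> x Ex M [sM ETM]; apply: subfieldV => //; apply: Ex.
Qed.

Lemma adjoin_base E T : E `<=` adjoin E T.
Proof. by move=> x Ex M [_]; apply; left. Qed.

Lemma adjoin_gen E T : T `<=` adjoin E T.
Proof. by move=> x Ex M [_]; apply; right. Qed.

Lemma adjoin_min E T E' : is_subfield E' -> E `<=` E' -> T `<=` E' ->
  adjoin E T `<=` E'.
Proof. by move=> sE' EE' TE' x; apply; split=> // y [/EE'|/TE']. Qed.

Lemma adjoin_mono E T E' T' : E `<=` E' -> T `<=` T' -> adjoin E T `<=` adjoin E' T'.
Proof.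
move=> EE' TT'; apply: adjoin_min; first exact: adjoin_subfield.
  by apply: subset_trans (@adjoin_base _ _).
by apply: subset_trans (@adjoin_gen _ _).
Qed.

Lemma adjoin_adjoin E T T' : adjoin (adjoin E T) T' = adjoin E (T `|` T').
Proof.
apply/seteqP; split; apply: adjoin_min; try exact: adjoin_subfield.
- by apply: adjoin_mono => // x; left.
- by apply: subset_trans (@adjoin_gen _ _) => x; right.
- by apply: subset_trans (@adjoin_base _ _); apply: adjoin_base.
- move=> x [Tx|]; last exact: adjoin_gen.
  by apply: adjoin_base; apply: adjoin_gen.
Qed.

Lemma adjoin0 E : is_subfield E -> adjoin E set0 = E.
Proof.
by move=> sE; apply/seteqP; split; [apply: adjoin_min|apply: adjoin_base].
Qed.

Lemma adjoin_set_cons E t (s : seq F) :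
  adjoin E [set` t :: s] = adjoin (adjoin E [set` s]) [set t].
Proof.
rewrite adjoin_adjoin; congr adjoin; apply/seteqP; split=> x /=.
  by rewrite in_cons => /orP[/eqP|]; [right|left].
by case=> [xs|->]; rewrite in_cons ?xs ?orbT ?eqxx.
Qed.

Lemma adjoin_finite E T x : adjoin E T x ->
  exists2 s : seq F, [set` s] `<=` T & adjoin E [set` s] x.
Proof.
move: x; apply: (@adjoin_min E T
  [set x | exists2 s : seq F, [set` s] `<=` T & adjoin E [set` s] x]).
- apply/subfieldP; split; first split.
  + by exists [::] => //; case: (subfield_subring (adjoin_subfield E [set` [::]])).
  + move=> x y [s sT Ex] [s' s'T Ey]; exists (s ++ s').
      by move=> z /=; rewrite mem_cat => /orP[/sT|/s'T].
    have rA := subfield_subring (adjoin_subfield E [set` s ++ s']).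
    apply: (subringB rA).
      by apply: adjoin_mono Ex => // z /= zs; rewrite mem_cat zs.
    by apply: adjoin_mono Ey => // z /= zs; rewrite mem_cat zs orbT.
  + move=> x y [s sT Ex] [s' s'T Ey]; exists (s ++ s').
      by move=> z /=; rewrite mem_cat => /orP[/sT|/s'T].
    have rA := subfield_subring (adjoin_subfield E [set` s ++ s']).
    apply: (subringM rA).
      by apply: adjoin_mono Ex => // z /= zs; rewrite mem_cat zs.
    by apply: adjoin_mono Ey => // z /= zs; rewrite mem_cat zs orbT.
  + move=> x [s sT Ex]; exists s => //.
    exact: (subfieldV (adjoin_subfield E [set` s])).
- by move=> x Ex; exists [::] => //; apply: adjoin_base.
- move=> x Tx; exists [:: x]; last by apply: adjoin_gen; rewrite /= mem_head.
  by move=> y /=; rewrite mem_seq1 => /eqP ->.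
Qed.

Lemma adjoin_finite_seq E T (xs : seq F) : (forall x, x \in xs -> adjoin E T x) ->
  exists2 s : seq F, [set` s] `<=` T & forall x, x \in xs -> adjoin E [set` s] x.
Proof.
elim: xs => [|x xs IH] Exs; first by exists [::].
have [|s sT sxs] := IH; first by move=> y y_xs; apply: Exs; rewrite in_cons y_xs orbT.
have [s' s'T s'x] := adjoin_finite (Exs x (mem_head _ _)).
exists (s ++ s') => [z /=|y]; first by rewrite mem_cat => /orP[/sT|/s'T].
rewrite in_cons => /orP[/eqP ->|/sxs Ey].
  by apply: adjoin_mono s'x => // z /= zs; rewrite mem_cat zs orbT.
by apply: adjoin_mono Ey => // z /= zs; rewrite mem_cat zs.
Qed.

(** The fractions in t with coefficients in E form a field; a common denominator
    serves to clear the denominators of a linear relation over E(t). *)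
Lemma adjoin1_fracs E t (I : finType) (a : I -> F) : is_subfield E ->
  (forall i, adjoin E [set t] (a i)) ->
  exists (q : {poly F}) (p : I -> {poly F}), [/\ poly_over E q, q.[t] != 0
    & forall i, poly_over E (p i) /\ a i * q.[t] = (p i).[t]].
Proof.
move=> sE; have rE := subfield_subring sE; have rP := poly_over_subring rE.
pose frac : set F := [set x | exists p q,
  [/\ poly_over E p, poly_over E q, q.[t] != 0 & x * q.[t] = p.[t]]].
have sub_frac : adjoin E [set t] `<=` frac.
  apply: adjoin_min.
  - apply/subfieldP; split; first split.
    + by exists 1, 1; rewrite hornerC oner_neq0 mulr1; split=> //; apply: (subring1 rP).
    + move=> x y [p [q [Ep Eq q0 Ex]]] [p' [q' [Ep' Eq' q0' Ey]]].
      exists (p * q' - p' * q), (q * q'); split.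
      * by apply: (subringB rP) => //; apply: (subringM rP).
      * exact: (subringM rP).
      * by rewrite hornerM mulf_neq0.
      * by rewrite hornerD hornerN !hornerM -Ex -Ey; ring.
    + move=> x y [p [q [Ep Eq q0 Ex]]] [p' [q' [Ep' Eq' q0' Ey]]].
      exists (p * p'), (q * q'); split; [exact: (subringM rP)|exact: (subringM rP)| |].
        by rewrite hornerM mulf_neq0.
      by rewrite !hornerM -Ex -Ey; ring.
    + move=> x [p [q [Ep Eq q0 Ex]]]; have [->|x0] := eqVneq x 0.
        exists 0, 1; rewrite hornerC oner_neq0 invr0 mul0r hornerC.
        by split=> //; [apply: poly_over0|apply: subring1].
      exists q, p; rewrite -Ex mulf_neq0 //; split=> //.
      by rewrite mulrA mulVf // mul1r.
  - move=> x Ex; exists x%:P, 1; rewrite !hornerC oner_neq0 mulr1.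
    by split=> //; [apply: poly_overC|apply: subring1].
  - move=> _ ->; exists 'X, 1; rewrite hornerX hornerC oner_neq0 mulr1.
    by split=> //; [apply: poly_overX|apply: subring1].
move=> Ea; have /choice[p /choice[q pqP]] := fun i => sub_frac _ (Ea i).
exists (\prod_i q i), (fun i => p i * \prod_(j | j != i) q j); split.
- by apply: (subring_prod rP) => // i _; case: (pqP i).
- by rewrite horner_prod; apply/prodf_neq0 => i _; case: (pqP i).
- move=> i; have [Ep Eq q0 E1] := pqP i; split.
    by apply: (subringM rP) => //; apply: (subring_prod rP) => // j _; case: (pqP j).
  by rewrite (bigD1 i) //= !hornerM -E1 mulrA.
Qed.

(** * Minimal polynomials *)

Definition transcendental_over E t :=
  forall p, poly_over E p -> root p t -> p = 0.

Lemma polyOver_poly_over E p : E 0 -> p \is a polyOver (mem E) <-> poly_over E p.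
Proof.
move=> E0; split=> [Ep i|Ep].
  have [lt_i|le_i] := ltnP i (size p); last by rewrite nth_default.
  by have /allP/(_ _ (mem_nth 0 lt_i)) := Ep; rewrite inE.
by apply/(all_nthP 0) => i _; rewrite inE; apply: Ep.
Qed.

(** Divisibility is what the proofs use; it follows from the minimality of the
    degree by division with remainder over E. *)
Lemma minimal_polynomialP E t h : is_subfield E ->
  minimal_polynomial E t h <-> [/\ h \is monic, poly_over E h, root h t
    & forall q, poly_over E q -> root q t -> h %| q].
Proof.
move=> sE; have rE := subfield_subring sE; have E0 := subring0 rE.
have rP := poly_over_subring rE.
split=> [[mh /(polyOver_poly_over _ E0) Eh ht minh]|[mh Eh ht divh]]; last first.
  split=> // [|q /(polyOver_poly_over _ E0) Eq q0 qt].
    exact/polyOver_poly_over.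
  by apply: dvdp_leq => //; apply: divh.
split=> // q Eq qt.
have [n [w [r [Ew Er lt_r]]]] := pseudo_division rE Eh (monic_neq0 mh) Eq.
rewrite (monicP mh) expr1n scale1r => Eqw.
have [r0|r0] := eqVneq r 0; first by rewrite Eqw r0 addr0 dvdp_mulr.
move: lt_r; rewrite ltnNge minh //; first exact/polyOver_poly_over.
have := qt; rewrite Eqw /root hornerD hornerM (rootP ht) mul0r add0r => /eqP rt.
by apply/eqP.
Qed.

Lemma exists_minimal_polynomial E t q : is_subfield E ->
  poly_over E q -> q != 0 -> root q t -> exists h, minimal_polynomial E t h.
Proof.
move=> sE Eq q0 qt; have rE := subfield_subring sE; have E0 := subring0 rE.
pose ann n := `[< exists p, [/\ poly_over E p, p != 0, root p t & size p = n] >].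
have ex : exists n, ann n by exists (size q); apply/asboolP; exists q.
case: (ex_minnP ex) => n /asboolP[p [Ep p0 pt sp]] minn.
have lp0 : lead_coef p != 0 by rewrite lead_coef_eq0.
exists ((lead_coef p)^-1 *: p); split.
- by rewrite monicE lead_coefZ mulVf.
- apply/polyOver_poly_over => //; apply: poly_overZ => //.
  exact: subfieldV sE (Ep _).
- by rewrite rootZ // invr_eq0.
- move=> r /(polyOver_poly_over _ E0) Er r0 rt; rewrite size_scale ?invr_eq0 // sp.
  by apply: minn; apply/asboolP; exists r.
Qed.

Lemma separable_over_mono E E' t : is_subfield E -> is_subfield E' -> E `<=` E' ->
  separable_over E t -> separable_over E' t.
Proof.
move=> sE sE' EE' [h /minimal_polynomialP-/(_ sE)[mh Eh ht _] seph].
have E'h := poly_over_sub EE' Eh.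
have [h' minh'] := exists_minimal_polynomial sE' E'h (monic_neq0 mh) ht.
exists h' => //; have /minimal_polynomialP-/(_ sE')[_ _ _ divh'] := minh'.
exact: dvdp_separable (divh' _ E'h ht) seph.
Qed.

(** A separable h is coprime to its cofactor w over gcd(h, r); so w is coprime to r
    and divides r^n, and is constant. *)
Lemma separable_dvd_exp h r n : separable_poly h -> h %| r ^+ n -> h %| r.
Proof.
move=> seph hrn; have g_h := dvdp_gcdl h r; have g_r := dvdp_gcdr h r.
have h0 := separable_poly_neq0 seph.
have [w Ew] : exists w, h = w * gcdp h r.
  by exists (h %/ gcdp h r); rewrite divpK.
have cop_wg : coprimep w (gcdp h r) by apply: separable_coprime seph _; rewrite -Ew.
have cop_wr : coprimep w r.
  apply/coprimepP => d dw dr; apply: (coprimepP _ _ cop_wg d dw).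
  by rewrite dvdp_gcd dr andbT Ew dvdp_mulr.
have w1 : w %= 1.
  have /coprimepP := coprimep_expr n cop_wr; apply; rewrite ?dvdpp //.
  by apply: dvdp_trans hrn; rewrite Ew dvdp_mulr.
by rewrite Ew Gauss_dvdp // g_r andbT (eqp_dvdl _ w1) dvd1p.
Qed.

End Adjunction.

(** * Linear disjointness along a tower *)

(** A vanishing combination of the d_i over E(t) is, up to a common denominator,
    the value at t of a polynomial with coefficients in the span of the d_i
    over E; the coordinates can be reduced modulo h, so that this polynomial is
    zero. The case h = 0 covers transcendental t. *)
Lemma free_over_adjoin (F : fieldType) (E : set F) (t : F) (h : {poly F})
    (I : finType) (B : {set I}) (d : I -> F) :
  is_subfield E -> free_over E B d -> poly_over E h -> root h t ->
  h = 0 \/ h \is monic ->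
  (forall r : {poly F}, (forall n, exists2 c : I -> F, forall i, E (c i) &
      r`_n = \sum_(i in B) c i * d i) -> root r t -> h %| r) ->
  free_over (adjoin E [set t]) B d.
Proof.
move=> sE frd Eh ht h0 divh c Ec c0; have rE := subfield_subring sE.
have [q [p [Eq qt pP]]] := adjoin1_fracs sE Ec.
have red i : exists r, [/\ poly_over E r, r.[t] = (p i).[t]
    & h = 0 \/ (size r < size h)%N].
  have [Ep _] := pP i; case: h0 => [->|mh]; first by exists (p i); split=> //; left.
  have [n [w [r [Ew Er lt_r]]]] := pseudo_division rE Eh (monic_neq0 mh) Ep.
  rewrite (monicP mh) expr1n scale1r => ->; exists r; split=> //; last by right.
  by rewrite hornerD hornerM (rootP ht) mul0r add0r.
have {red}[r rP] := choice red.
pose R := \sum_(i in B) d i *: r i.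
have RE n : R`_n = \sum_(i in B) (r i)`_n * d i.
  by rewrite coef_sum; apply: eq_bigr => i _; rewrite coefZ mulrC.
have R0 : R = 0.
  have : h %| R.
    apply: divh => [n|]; first by exists (fun i => (r i)`_n) => // i; case: (rP i).
    apply/rootP; rewrite horner_sum -[RHS](mul0r q.[t]) -[X in _ = X * _]c0 mulr_suml.
    apply: eq_bigr => i _; have [_ Ert _] := rP i; have [_ Ept] := pP i.
    by rewrite hornerZ Ert -Ept; ring.
  have [->|mh] := h0; first by rewrite dvd0p => /eqP.
  move=> hR; apply/eqP/negPn/negP => Rn0.
  have := dvdp_leq Rn0 hR; rewrite leqNgt; case/negP.
  have h_neq0 := monic_neq0 mh.
  have sh : (0 < size h)%N by rewrite size_poly_gt0.
  apply: leq_ltn_trans (_ : (\max_(i in B) size (r i) < size h)%N).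
    apply: leq_trans (size_sum _ _ _) _; apply/bigmax_leqP => i iB.
    apply: leq_trans (size_scale_leq _ _) _.
    by rewrite (bigmax_sup i).
  apply: (big_ind (fun m => (m < size h)%N)) => // [m n|i _].
    by rewrite gtn_max => -> ->.
  by have [_ _ [h00|//]] := rP i; rewrite h00 eqxx in h_neq0.
move=> i iB; have ri0 : r i = 0.
  apply/polyP => n; rewrite coef0; apply: (frd (fun i => (r i)`_n)) iB.
    by move=> j; case: (rP j).
  by rewrite -RE R0 coef0.
have [_ Ert _] := rP i; have [_ Ept] := pP i.
by apply: (mulIf qt); rewrite mul0r Ept -Ert ri0 horner0.
Qed.

(** A transcendence base followed by a separable algebraic extension, cut into
    simple extensions, so that a property of separable extensions is proved by
    induction on the towers that lie in them. *)
Inductive separable_tower (F : fieldType) (E0 U : set F) : set F -> Prop :=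
| TowerBase : separable_tower E0 U E0
| TowerTranscendental E t : separable_tower E0 U E -> U t ->
    transcendental_over E t -> separable_tower E0 U (adjoin E [set t])
| TowerSeparable E t : separable_tower E0 U E -> U t ->
    separable_over E t -> separable_tower E0 U (adjoin E [set t]).

Lemma separable_tower_field (F : fieldType) (E0 U E : set F) :
  is_subfield E0 -> is_subfield U -> E0 `<=` U -> separable_tower E0 U E ->
  [/\ is_subfield E, E0 `<=` E & E `<=` U].
Proof.
move=> sE0 sU E0U; elim=> [|E' t _ [sE' E0E' E'U] Ut _|E' t _ [sE' E0E' E'U] Ut _].
  by split.
all: split; [exact: adjoin_subfield|exact: subset_trans (@adjoin_base _ _ _)|].
all: by apply: adjoin_min => // _ ->.
Qed.

Section LinearDisjointness.
Variables (k K : fieldType) (f : {rmorphism k -> K}).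
Local Notation Ki := (pinsep_closure f).

(** A common exponent turns combinations of the d_i into combinations over k by a
    single Frobenius power. *)
Lemma pinsep_common_exponent (I : finType) (d : I -> K) : (forall i, Ki (d i)) ->
  exists2 n, [pchar k].-nat n & forall i, range f (d i ^+ n).
Proof.
move=> Kd; have /choice[n nP] : forall i, exists n,
    [pchar k].-nat n /\ range f (d i ^+ n).
  by move=> i; have [n cn [a da]] := Kd i; exists n; split=> //; exists a.
exists (\prod_i n i)%N => [|i].
  by apply: (big_ind (fun m => [pchar k].-nat m)) => // [m m' cm cm'|i _];
    [rewrite pnatM cm|case: (nP i)].
rewrite (bigD1 i) //= exprM; have [_] := nP i.
by apply: (subringX (range_subring f)).
Qed.

Lemma pinsep_span_frobenius E (I : finType) (B : {set I}) (d : I -> K) q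
    (r : {poly K}) :
  is_subfield E -> range f `<=` E -> [pchar k].-nat q ->
  (forall i, range f (d i ^+ q)) ->
  (forall n, exists2 c : I -> K, forall i, E (c i) & r`_n = \sum_(i in B) c i * d i) ->
  poly_over E (r ^+ q).
Proof.
move=> sE fE cq dq rP; have rE := subfield_subring sE.
rewrite -[r]coefK poly_def (frobenius_sum (polyC \o f) _ _ _ cq).
apply: (subring_sum (poly_over_subring rE)) => i _.
rewrite exprZn -exprM; apply: poly_overZ (poly_overXn _ _) => //.
have [c Ec ->] := rP i; rewrite (frobenius_sum f _ _ _ cq).
apply: (subring_sum rE) => j _; rewrite exprMn; apply: (subringM rE).
  exact: subringX.
exact: fE.
Qed.

(** Purely inseparable extensions are linearly disjoint from separable ones: a
    power r^q of the polynomial r in question has coefficients in E, so that the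
    minimal polynomial of t over E divides r^q; being separable, it divides r. *)
Theorem pinsep_linearly_disjoint U E (I : finType) (B : {set I}) (d : I -> K) :
  is_subfield U -> range f `<=` U -> separable_tower (range f) U E ->
  (forall i, Ki (d i)) -> free_over (range f) B d -> free_over E B d.
Proof.
move=> sU fU towE Kd frd; have [q cq dq] := pinsep_common_exponent Kd.
have q_gt0 : (0 < q)%N by case: q cq {dq}.
have root_pow (r : {poly K}) t : root r t -> root (r ^+ q) t.
  by move=> rt; rewrite /root horner_exp (rootP rt) expr0n; case: q q_gt0 {cq dq}.
elim: towE => [//|E' t towE frE Ut tr|E' t towE frE Ut [h minh seph]].
all: have [sE' fE' _] := separable_tower_field (range_subfield f) sU fU towE.
- apply: (free_over_adjoin (h := 0) sE' frE).
  + exact: (poly_over0 (subfield_subring sE')).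
  + exact: root0.
  + by left.
  move=> r rP rt.
  have := tr _ (pinsep_span_frobenius sE' fE' cq dq rP) (root_pow _ _ rt).
  by move=> /eqP; rewrite expf_eq0 q_gt0 /= => /eqP ->; apply: dvdpp.
have /(minimal_polynomialP _ _ sE')[mh Eh ht divh] := minh.
apply: (free_over_adjoin (h := h) sE' frE) => //; first by right.
move=> r rP rt; apply: (separable_dvd_exp (n := q)) => //.
by apply: divh; [apply: pinsep_span_frobenius rP|apply: root_pow].
Qed.

(** Linear disjointness read from the other side: in a relation between the a_i,
    expand the coefficients in a basis over k; the members of this basis are free
    over Ks, so that each of them carries a relation over k between the a_i. *)
Lemma free_over_pinsep U (I : finType) (B : {set I}) (a : I -> K) :
  is_subfield U -> range f `<=` U ->
  (forall s : seq K, [set` s] `<=` U ->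
     exists2 E, separable_tower (range f) U E & [set` s] `<=` E) ->
  (forall i, U (a i)) -> free_over (range f) B a -> free_over Ki B a.
Proof.
move=> sU fU towers Ua fra c Kc c0.
have [D [frD [g gP]]] := exists_basis c (range_subfield f).
have [|E towE aE] := towers [seq a i | i <- enum I].
  by move=> _ /mapP[i _ ->].
have [sE fE _] := separable_tower_field (range_subfield f) sU fU towE.
have rE := subfield_subring sE.
have Ea i : E (a i) by apply: aE; apply: map_f; rewrite mem_enum.
have frE := pinsep_linearly_disjoint sU fU towE Kc frD.
have gE i j : E (g i j) by apply: fE; have [] := gP i.
have ga0 j : j \in D -> \sum_(i in B) g i j * a i = 0.
  apply: (frE (fun j => \sum_(i in B) g i j * a i)).
    by move=> j'; apply: (subring_sum rE) => i _; apply: (subringM rE).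
  rewrite -[RHS]c0; under eq_bigr do rewrite mulr_suml.
  rewrite exchange_big /=; apply: eq_bigr => i _.
  have [_ ->] := gP i; rewrite mulr_suml; apply: eq_bigr => j' _; ring.
move=> i iB; have [_ ->] := gP i; apply: big1 => j jD.
by rewrite (fra (g^~ j)) ?mul0r // => [i'|]; [have [] := gP i'|apply: ga0].
Qed.

End LinearDisjointness.

(** * Towers in a separable extension *)

Section Transcendence.
Variables (k K : fieldType) (f : {rmorphism k -> K}).

Lemma muni_mwiden n (p : mpoly n k) : muni (mwiden p) = p%:P.
Proof.
rewrite {1}(mpolyE p) (raddf_sum (@mwiden n k)) (raddf_sum (@muni n k)).
rewrite [in RHS](mpolyE p) (raddf_sum polyC); apply: eq_bigr => m _.
rewrite /= mwidenZ mwidenX muniZ muniE msuppX big_seq1.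
rewrite mcoeffX eqxx scale1r mnmwiden_ordmax expr0.
have -> : Multinom [tuple mnmwiden m (widen_ord (leqnSn n) i) | i < n] = m.
  by apply/mnmP => i; rewrite mnmE mnmwiden_widen.
by rewrite alg_polyC -mul_polyC -polyCM mul_mpolyC.
Qed.

Lemma mmap_mwiden n (t : 'I_n.+1 -> K) (p : mpoly n k) :
  mmap f t (mwiden p) = mmap f (t \o widen_ord (leqnSn n)) p.
Proof.
rewrite {1}(mpolyE p) (raddf_sum (@mwiden n k)) (raddf_sum (mmap f t)).
rewrite [in RHS](mpolyE p) (raddf_sum (mmap f _)); apply: eq_bigr => m _.
rewrite /= mwidenZ mwidenX !mmapZ !mmapX /mmap1 big_ord_recr /= mnmwiden_ordmax mulr1.
by congr (_ * _); apply: eq_bigr => i _; rewrite mnmwiden_widen.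
Qed.

Lemma muni_Xmax n : muni (mpolyX k (mnm1 ord_max)) = 'X :> {poly mpoly n k}.
Proof.
rewrite muniE msuppX big_seq1 mcoeffX eqxx scale1r mnm1E eqxx expr1.
have -> : Multinom [tuple mnm1 ord_max (widen_ord (leqnSn n) i) | i < n] = mnm0.
  apply/mnmP => i; rewrite mnmE mnm1E mnm0E -val_eqE /=.
  by case: i => i /= /ltn_eqF; rewrite eq_sym => ->.
by rewrite mpolyX0 scale1r.
Qed.

(** A nonzero relation for t over k(s), with cleared denominators, is a nonzero
    polynomial relation over k between the terms of s and t. *)
Lemma algebraically_independent_transcendental T t (s : seq K) :
  algebraically_independent f T -> uniq (t :: s) -> [set` t :: s] `<=` T ->
  transcendental_over (adjoin (range f) [set` s]) t.
Proof.
(* The variable of t is the last one, that of the outer polynomial in muni. *)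
move=> indT uts tsT; pose n := size s; pose tau (i : 'I_n.+1) := nth 0 (rcons s t) i.
pose sigma := tau \o widen_ord (leqnSn n).
have sts : size (rcons s t) = n.+1 by rewrite size_rcons.
have urs : uniq (rcons s t) by rewrite rcons_uniq.
have ind (p : mpoly n.+1 k) : mmap f tau p = 0 -> p = 0.
  apply: (indT _ tau) => [i j /eqP|i].
    by rewrite nth_uniq ?sts ?ltn_ord // => /eqP/val_inj.
  apply: tsT => /=; rewrite -mem_rcons; apply: mem_nth; rewrite sts; apply: ltn_ord.
have inds (p : mpoly n k) : mmap f sigma p = 0 -> p = 0.
  by rewrite -mmap_mwiden => /ind/eqP; rewrite -(mwiden0 n k) => /eqP/inj_mwiden.
pose frac : set K := [set x | exists P Q : mpoly n k,
  mmap f sigma Q != 0 /\ x * mmap f sigma Q = mmap f sigma P].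
have sub_frac : adjoin (range f) [set` s] `<=` frac.
  apply: adjoin_min.
  - apply/subfieldP; split; first split.
    + by exists 1, 1; rewrite rmorph1 oner_neq0 mulr1.
    + move=> x y [P [Q [Q0 Ex]]] [P' [Q' [Q0' Ey]]].
      exists (P * Q' - P' * Q), (Q * Q').
      by rewrite rmorphB !rmorphM /= mulf_neq0 // -Ex -Ey; split=> //; ring.
    + move=> x y [P [Q [Q0 Ex]]] [P' [Q' [Q0' Ey]]].
      exists (P * P'), (Q * Q').
      by rewrite !rmorphM /= mulf_neq0 // -Ex -Ey; split=> //; ring.
    + move=> x [P [Q [Q0 Ex]]]; have [->|x0] := eqVneq x 0.
        by exists 0, 1; rewrite rmorph0 rmorph1 oner_neq0 invr0 mul0r.
      by exists Q, P; rewrite -Ex mulf_neq0 // mulrA mulVf // mul1r.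
  - move=> _ [c _ <-]; exists (mpolyC n c), 1.
    by rewrite rmorph1 oner_neq0 mulr1 mmapC.
  - move=> x /= xs; have lt_i : (index x s < n)%N by rewrite index_mem.
    exists (mpolyX k (mnm1 (Ordinal lt_i))), 1.
    rewrite rmorph1 mmapX mmap1U oner_neq0 mulr1 /sigma /tau /=.
    by rewrite nth_rcons lt_i nth_index.
move=> p Ep pt; apply/polyP => i0; rewrite coef0.
have /choice[P /choice[Q PQ]] := fun i => sub_frac _ (Ep i).
have [lt_i|] := ltnP i0 (size p); last exact: nth_default.
pose d := size p.
pose N (i : 'I_d) := P i * \prod_(j < d | j != i) Q j.
pose D := \prod_(j < d) Q j.
have NE (i : 'I_d) : mmap f sigma (N i) = p`_i * mmap f sigma D.
  have [_ E] := PQ i.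
  by rewrite /N /D rmorphM [in RHS](bigD1 i) //= rmorphM mulrA E.
pose R : mpoly n.+1 k := \sum_(i < d) mwiden (N i) * mpolyX k (mnm1 ord_max) ^+ i.
have tau_max : tau ord_max = t by rewrite /tau /= nth_rcons ltnn eqxx.
have R0 : R = 0.
  apply: ind; rewrite rmorph_sum /=.
  transitivity (\sum_(i < d) p`_i * t ^+ i * mmap f sigma D).
    apply: eq_bigr => i _; rewrite rmorphM rmorphXn /= mmap_mwiden -/sigma NE.
    by rewrite mmapX mmap1U tau_max mulrAC.
  by rewrite -mulr_suml -horner_coef (rootP pt) mul0r.
have N0 (i : 'I_d) : N i = 0.
  have /(congr1 (fun q : {poly mpoly n k} => q`_i)) := congr1 (@muni n k) R0.
  rewrite muni0 coef0 /R (raddf_sum (@muni n k)) coef_sum /=.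
  under eq_bigr => j _ do rewrite (rmorphM (@muni n k)) (rmorphXn (@muni n k)) /=
    muni_mwiden muni_Xmax coefCM coefXn.
  rewrite (bigD1 i) //= eqxx mulr1 big1 ?addr0 // => j /negPf.
  by rewrite -val_eqE eq_sym /= => ->; rewrite mulr0.
have := NE (Ordinal lt_i); rewrite N0 raddf0 => /esym/eqP.
rewrite mulf_eq0 => /orP[/eqP //|].
rewrite /D rmorph_prod /= => /eqP E; exfalso; move: E; apply/eqP/prodf_neq0 => j _.
by have [] := PQ j.
Qed.

(** The elements of s are separable over k(T), hence over k(T') for a finite part
    T' of T: adjoin the elements of T', then those of s. *)
Lemma exists_separable_tower U (s : seq K) :
  is_subfield U -> range f `<=` U -> separable_extension f U -> [set` s] `<=` U ->
  exists2 E, separable_tower (range f) U E & [set` s] `<=` E.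
Proof.
move=> sU fU sepU sUs; have [T [TE indT sepT]] := sepU s sUs.
have sk := range_subfield f.
have TU : T `<=` U by apply: subset_trans TE _; apply: adjoin_min.
have sepTs x : x \in s -> separable_over (adjoin (range f) T) x.
  by move=> xs; apply: sepT; apply: adjoin_gen.
have [T' [uT' T'T sepT']] : exists T' : seq K, [/\ uniq T', [set` T'] `<=` T &
    forall x, x \in s -> separable_over (adjoin (range f) [set` T']) x].
  have [T' T'T sepT'] : exists2 T' : seq K, [set` T'] `<=` T &
      forall x, x \in s -> separable_over (adjoin (range f) [set` T']) x.
    elim: s sepTs {sUs TE sepT} => [|x s IH] sepTs; first by exists [::].
    have [|T1 T1T sep1] := IH.
      by move=> y ys; apply: sepTs; rewrite in_cons ys orbT.
    have [h minh seph] := sepTs x (mem_head _ _).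
    have sET := adjoin_subfield (range f) T.
    have /(minimal_polynomialP _ _ sET)[mh Eh ht divh] := minh.
    have [|T2 T2T T2h] := @adjoin_finite_seq _ (range f) T h.
      by move=> c /(nthP 0)[i _ <-]; apply: Eh.
    have rT2 := subfield_subring (adjoin_subfield (range f) [set` T2]).
    have sep2 : separable_over (adjoin (range f) [set` T2]) x.
      exists h => //; apply/(minimal_polynomialP _ _ (adjoin_subfield _ _)).
      split=> // [i|q Eq qx].
        have [lt_i|le_i] := ltnP i (size h); first by apply: T2h; apply: mem_nth.
        by rewrite nth_default //; apply: (subring0 rT2).
      by apply: divh => //; apply: poly_over_sub Eq; apply: adjoin_mono.
    exists (T1 ++ T2) => [y /=|y]; first by rewrite mem_cat => /orP[/T1T|/T2T].
    rewrite in_cons => /orP[/eqP ->|/sep1].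
      apply: separable_over_mono sep2; try exact: adjoin_subfield.
      by apply: adjoin_mono => // z /= zT; rewrite mem_cat zT orbT.
    apply: separable_over_mono; try exact: adjoin_subfield.
    by apply: adjoin_mono => // z /= zT; rewrite mem_cat zT.
  exists (undup T'); rewrite undup_uniq; split=> // [x /=|x xs].
    by rewrite mem_undup => /T'T.
  have -> : [set` undup T'] = [set` T'].
    by apply/seteqP; split=> y /=; rewrite mem_undup.
  exact: sepT'.
have tow1 : separable_tower (range f) U (adjoin (range f) [set` T']).
  elim: T' uT' T'T {sepT'} => [|t T' IH] uT' T'T.
    have -> : [set` [::]] = set0 :> set K by apply/seteqP; split.
    by rewrite adjoin0 //; apply: TowerBase.
  rewrite adjoin_set_cons; apply: TowerTranscendental.
  - apply: IH; first by case/andP: uT'.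
    by move=> x /= xT; apply: T'T; rewrite /= in_cons xT orbT.
  - by apply/TU/T'T; rewrite /= mem_head.
  - exact: algebraically_independent_transcendental indT uT' T'T.
exists (adjoin (adjoin (range f) [set` T']) [set` s]); last exact: adjoin_gen.
have sT' := adjoin_subfield (range f) [set` T'].
elim: s sUs sepT' {TE sepT sepTs} => [|x s IH] sUs sepT'.
  have -> : [set` [::]] = set0 :> set K by apply/seteqP; split.
  by rewrite adjoin0.
rewrite adjoin_set_cons; apply: TowerSeparable.
- apply: IH => y ys; first by apply: sUs; rewrite /= in_cons ys orbT.
  by apply: sepT'; rewrite in_cons ys orbT.
- by apply: sUs; rewrite /= mem_head.
- apply: separable_over_mono (sepT' x (mem_head _ _)); try exact: adjoin_subfield.
  exact: adjoin_base.
Qed.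

End Transcendence.

(** * Regularity along a tower *)

Section Compositum.
Variables (K : fieldType) (A : comPzRingType) (phi : {rmorphism K -> A}) (M : set A).
Implicit Types E : set K.

(** For subrings M and E this is the subring generated by M and the image of E; as
    a set of sums it carries the coordinates that the proofs use. *)
Definition compositum E : set A := [set r | exists2 s : seq (K * A),
  forall z, z \in s -> E z.1 /\ M z.2 & r = \sum_(z <- s) phi z.1 * z.2].

Hypothesis sM : is_subring M.

Lemma compositum_subring E : is_subfield E -> is_subring (compositum E).
Proof.
move=> sE; have rE := subfield_subring sE; split.
- exists [:: (1, 1)]; last by rewrite big_seq1 rmorph1 mulr1.
  by move=> z; rewrite mem_seq1 => /eqP -> /=; split; [apply: subring1|apply: subring1].
- move=> _ _ [s Es ->] [s' Es' ->]; exists (s ++ [seq (- z.1, z.2) | z <- s']).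
    move=> z; rewrite mem_cat => /orP[/Es //|/mapP[z' /Es'[Ez Mz] ->]] /=.
    by split=> //; apply: (subringN rE).
  rewrite big_cat big_map -sumrN /=; congr (_ + _).
  by apply: eq_bigr => z _; rewrite rmorphN mulNr.
move=> _ _ [s Es ->] [s' Es' ->].
exists [seq (z.1 * z'.1, z.2 * z'.2) | z <- s, z' <- s'].
  move=> _ /allpairsP[[z z'] /= [/Es[Ez Mz] /Es'[Ez' Mz'] ->]] /=.
  by split; [apply: (subringM rE)|apply: (subringM sM)].
rewrite big_allpairs_dep mulr_suml; apply: eq_bigr => z _.
by rewrite mulr_sumr; apply: eq_bigr => z' _; rewrite rmorphM mulrACA.
Qed.

Lemma compositum_mono E E' : E `<=` E' -> compositum E `<=` compositum E'.
Proof. by move=> EE' r [s Es ->]; exists s => // z /Es[/EE' ? ?]. Qed.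

Lemma compositum_mul E e m : E e -> M m -> compositum E (phi e * m).
Proof.
move=> Ee Mm; exists [:: (e, m)]; last by rewrite big_seq1.
by move=> z; rewrite mem_seq1 => /eqP ->.
Qed.

Lemma compositum_phi E e : E e -> compositum E (phi e).
Proof.
by move=> Ee; rewrite -[phi e]mulr1; apply: compositum_mul => //; apply: subring1.
Qed.

End Compositum.

Section TowerRegularity.
Variables (K : fieldType) (A : comNzRingType) (phi : {rmorphism K -> A}).
Variables (E0 U : set K) (M : set A).
Implicit Types (E : set K) (P : set A).
Local Notation compositum := (compositum phi M).

Hypotheses (sE0 : is_subfield E0) (sU : is_subfield U) (E0U : E0 `<=` U).
Hypotheses (sM : is_subring M) (E0M : forall a, E0 a -> M (phi a)).
Hypothesis unitM : forall m, M m -> m != 0 -> exists m', m * m' = 1.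
Hypothesis compositumU : compositum U = setT.
Hypothesis freeU : forall (I : finType) (B : {set I}) (a : I -> K),
  (forall i, U (a i)) -> free_over E0 B a -> free_over M B (phi \o a).

Lemma compositum_base : compositum E0 `<=` M.
Proof.
move=> _ [s Es ->]; rewrite big_seq; apply: (subring_sum sM) => z /Es[Ez Mz].
by apply: (subringM sM) => //; apply: E0M.
Qed.

(** A common length makes the second index independent of the first one, so that
    sums over both can be exchanged. *)
Lemma compositum_family E (I : finType) (c : I -> A) : is_subfield E ->
  (forall i, compositum E (c i)) ->
  exists n (e : I -> 'I_n -> K) (m : I -> 'I_n -> A),
    [/\ forall i j, E (e i j), forall i j, M (m i j)
      & forall i, c i = \sum_j phi (e i j) * m i j].
Proof.
move=> sE Ec; have rE := subfield_subring sE.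
have /choice[s sP] : forall i, exists s : seq (K * A),
    (forall z, z \in s -> E z.1 /\ M z.2) /\ c i = \sum_(z <- s) phi z.1 * z.2.
  by move=> i; have [s Es Er] := Ec i; exists s.
pose n := \max_i size (s i).
have EM i j : E (nth 0 (s i) j).1 /\ M (nth 0 (s i) j).2.
  have [lt_j|le_j] := ltnP j (size (s i)).
    by have [/(_ _ (mem_nth 0 lt_j))] := sP i.
  by rewrite nth_default //; split; [apply: (subring0 rE)|apply: (subring0 sM)].
exists n, (fun i j => (nth 0 (s i) j).1), (fun i j => (nth 0 (s i) j).2).
split=> [i j|i j|i]; [by case: (EM i j)|by case: (EM i j)|].
have [_ ->] := sP i; have le_n : (size (s i) <= n)%N by apply: leq_bigmax.
by apply: big_nth_pad; rewrite ?rmorph0 ?mulr0.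
Qed.

(** Expand the coefficients in a basis over E0: the products of its members with
    the a_i are free over E0, hence over M. *)
Lemma free_over_compositum E (I : finType) (B : {set I}) (a : I -> K) :
  is_subfield E -> E0 `<=` E -> E `<=` U -> (forall i, U (a i)) ->
  free_over E B a -> free_over (compositum E) B (phi \o a).
Proof.
move=> sE E0E EU Ua fra c Ec c0; have rE := subfield_subring sE.
have rU := subfield_subring sU.
have [n [e [m [Ee Mm cE]]]] := compositum_family sE Ec.
have [D [frD [g gP]]] := exists_basis (fun p : I * 'I_n => e p.1 p.2) sE0.
pose mu i q := \sum_j phi (g (i, j) q) * m i j.
have Mmu i q : M (mu i q).
  apply: (subring_sum sM) => j _; apply: (subringM sM) => //; apply: E0M.
  by have [] := gP (i, j).
have cmu i : c i = \sum_(q in D) phi (e q.1 q.2) * mu i q.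
  rewrite cE; under [RHS]eq_bigr do rewrite mulr_sumr.
  rewrite exchange_big /=; apply: eq_bigr => j _.
  have [_ /= {1}->] := gP (i, j); rewrite rmorph_sum mulr_suml.
  by apply: eq_bigr => q _; rewrite rmorphM; ring.
pose b (p : I * (I * 'I_n)) := a p.1 * e p.2.1 p.2.2.
have frb : free_over E0 (finset.setX B D) b.
  by apply: free_over_mul fra frD => // q; apply: Ee.
have Ub p : U (b p) by apply: (subringM rU) => //; apply: EU.
have mu0 := freeU Ub frb (c := fun p => mu p.1 p.2) (fun p => Mmu _ _).
move=> i iB; rewrite cmu big1 // => q qD.
rewrite (mu0 _ (i, q)) ?mulr0 //; last by rewrite finset.in_setX iB.
rewrite -[RHS]c0; under [RHS]eq_bigr do rewrite cmu mulr_suml.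
rewrite pair_big_dep /=; apply: eq_big => [[i' q']|[i' q'] _] /=.
  by rewrite finset.in_setX.
by rewrite /b /= rmorphM; ring.
Qed.

Section Step.
Variables (E : set K) (t : K) (P : set A) (xs : seq A).
Hypotheses (sE : is_subfield E) (E0E : E0 `<=` E) (EU : E `<=` U) (Ut : U t).
Hypothesis pP : is_prime_ideal P.
Let R := compositum E.
Let E' := adjoin E [set t].
Local Notation tau := (phi t).
Hypotheses (xsR : forall x, x \in xs -> R x) (xsP : forall x, x \in xs -> P x).
Hypothesis regxs : regular_at P xs.
Hypothesis genxs : forall y, R y -> P y -> saturation P (ideal_of xs) y.

Let iP : is_ideal P. Proof. by case: pP. Qed.
Let rR : is_subring R. Proof. exact: compositum_subring. Qed.
Let rRX : is_subring (poly_over R). Proof. exact: poly_over_subring. Qed.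
Let isat ys : is_ideal (saturation P (ideal_of ys)).
Proof. by apply: saturation_ideal => //; apply: ideal_of_ideal. Qed.
Let sE' : is_subfield E'. Proof. exact: adjoin_subfield. Qed.
Let E'U : E' `<=` U. Proof. by apply: adjoin_min => // _ ->. Qed.
Let EE' : E `<=` E'. Proof. exact: adjoin_base. Qed.
Let E't : E' t. Proof. exact: adjoin_gen. Qed.
Let rE' : is_subring E'. Proof. exact: subfield_subring. Qed.

Lemma poly_over_compositum h : poly_over E h -> poly_over R (map_poly phi h).
Proof. by move=> Eh i; rewrite coef_map; apply: compositum_phi. Qed.

(** The denominators of E(t) are units of A, so that E(t) behaves like the
    polynomials in t with coefficients in E. *)
Lemma compositum_adjoin_frac y : compositum E' y ->
  exists v w p, [/\ v * w = 1, poly_over R p & y * v = p.[tau]].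
Proof.
move=> Ey; have [n [e [m [Ee Mm yE]]]] :=
  compositum_family (I := unit) sE' (fun=> Ey).
have [q [p [Eq q0 pP']]] := adjoin1_fracs sE (Ee tt).
exists (phi q.[t]), (phi (q.[t])^-1), (\sum_j m tt j *: map_poly phi (p j)).
rewrite -rmorphM divff // rmorph1; split=> //.
  move=> i; rewrite coef_sum; apply: (subring_sum rR) => j _.
  rewrite coefZ coef_map mulrC; apply: compositum_mul => //.
  by have [] := pP' j.
rewrite (yE tt) horner_sum mulr_suml; apply: eq_bigr => j _.
by rewrite hornerZ horner_map -(pP' j).2 rmorphM; ring.
Qed.

Lemma saturation_horner ys (p : {poly A}) :
  (forall i, saturation P (ideal_of ys) p`_i) ->
  saturation P (ideal_of ys) p.[tau].
Proof.
move=> sp; rewrite horner_coef.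
have [s0 sD _] := isat ys.
by apply: (big_ind (saturation P (ideal_of ys))) => // i _; apply: ideal_mulr.
Qed.

Lemma saturation_horner_P p : poly_over R p -> (forall i, P p`_i) ->
  saturation P (ideal_of xs) p.[tau].
Proof. by move=> Rp Pp; apply: saturation_horner => i; apply: genxs. Qed.

Definition contracted p := poly_over R p /\ P p.[tau].

(** The residue ring of the compositum of E at P becomes a polynomial ring in one
    variable over a field upon adjoining t, a principal ideal domain; q is a lift
    of a generator of the prime that corresponds to P. *)
Definition contraction_generator q :=
  [/\ contracted q, ~ P (lead_coef q)
    & forall r, contracted r -> (size r < size q)%N -> forall i, P r`_i].

Lemma exists_contraction_generator h i : contracted h -> ~ P h`_i ->
  exists q, contraction_generator q.
Proof.
pose proper_size n :=
  `[< exists p, [/\ contracted p, exists i, ~ P p`_i & size p = n] >].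
move=> ch Phi; have ex : exists n, proper_size n.
  by exists (size h); apply/asboolP; exists h; split=> //; exists i.
case: (ex_minnP ex) => n /asboolP[q [[Rq Pq] [i0 Pqi] sq]] minn.
have minq r : contracted r -> (size r < size q)%N -> forall i, P r`_i.
  move=> cr lt_r j; apply: contrapT => Prj; move: lt_r; rewrite ltnNge sq.
  by rewrite minn //; apply/asboolP; exists r; split=> //; exists j.
have q0 : q != 0.
  by apply/eqP => q0; apply: Pqi; rewrite q0 coef0; case: iP.
have q_gt0 : (0 < size q)%N by rewrite size_poly_gt0.
exists q; split=> // Plc; apply: Pqi.
pose r := q - lead_coef q *: 'X^((size q).-1).
have rE j : r`_j = if j == (size q).-1 then 0 else q`_j.
  rewrite coefB coefZ coefXn; case: eqP => [->|_]; last by rewrite mulr0 subr0.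
  by rewrite mulr1 lead_coefE subrr.
have Pr : forall j, P r`_j.
  apply: minq; last first.
    rewrite -(prednK q_gt0) ltnS; apply: size_lt_coef0 => j le_j; rewrite rE.
    case: eqP => // /eqP ne; apply: nth_default.
    by rewrite -(prednK q_gt0) ltn_neqAle eq_sym ne.
  split.
    apply: (subringB rRX) => //; apply: (poly_overZ rR); first exact: Rq.
    exact: poly_overXn.
  rewrite hornerD hornerN hornerZ; apply: ideal_sub => //.
  exact: ideal_mulr.
have := Pr i0; rewrite rE; case: eqP => // -> _.
by rewrite -lead_coefE.
Qed.

(** Pseudo-division by q leaves a remainder whose coefficients lie in P, and these
    are generated by xs, locally; the leading coefficient of q is invertible
    there. *)
Lemma contracted_generated q y : contraction_generator q ->
  compositum E' y -> P y -> saturation P (ideal_of (q.[tau] :: xs)) y.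
Proof.
move=> [[Rq Pq] Plc minq] Ey Py; set J := saturation _ _.
have iJ : is_ideal J := isat _.
have [v [w [p [vw Rp Ep]]]] := compositum_adjoin_frac Ey.
have q0 : q != 0.
  by apply/eqP => q0; apply: Plc; rewrite q0 lead_coef0; case: iP.
have [n [s [r [Rs Rr lt_r Eqr]]]] := pseudo_division rR Rq q0 Rp.
have Er : lead_coef q ^+ n * p.[tau] = q.[tau] * s.[tau] + r.[tau].
  by rewrite -hornerZ Eqr hornerD hornerM.
have Pr : forall i, P r`_i.
  apply: minq => //; split=> //.
  have -> : r.[tau] = lead_coef q ^+ n * (y * v) - q.[tau] * s.[tau].
    by rewrite Ep Er; ring.
  apply: ideal_sub => //; last exact: ideal_mulr.
  by rewrite mulrA; apply: ideal_mulr => //; case: iP => _ _; apply.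
have -> : y = p.[tau] * w by rewrite -Ep -mulrA vw mulr1.
apply: ideal_mulr => //; apply: saturation_saturated => //.
exists (lead_coef q ^+ n); first by move=> /(prime_expr pP).
rewrite -/J Er; have [_ JD _] := iJ; apply: JD.
  by apply: ideal_mulr => //; apply: sub_saturation => //; apply: ideal_of_mem;
    rewrite mem_head.
have := saturation_horner_P Rr Pr; apply: saturation_mono.
by apply: ideal_of_sub => [|x x_xs]; [exact: ideal_of_ideal|apply: ideal_of_mem;
  rewrite in_cons x_xs orbT].
Qed.

(** No new generator is needed: h = q w up to a unit and up to terms generated by
    xs. If w vanished at t modulo P, so would the derivative of h, whose value at
    t is a nonzero element of a field. So w(t) is invertible, and q(t), which
    generates P together with xs, is itself generated by xs. *)
Lemma separable_step y : separable_over E t -> compositum E' y -> P y ->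
  saturation P (ideal_of xs) y.
Proof.
move=> [h minh seph] Ey Py; have /(minimal_polynomialP _ _ sE)[mh Eh ht _] := minh.
pose h' := map_poly phi h; have Rh' := poly_over_compositum Eh.
have mh' : h' \is monic by rewrite monic_map.
have h't : h'.[tau] = 0 by rewrite horner_map (rootP ht) rmorph0.
have [||q genq] := @exists_contraction_generator h' (size h').-1.
- by split=> //; rewrite h't; case: iP.
- by rewrite -lead_coefE (monicP mh'); case: pP.
have [[Rq Pq] Plc minq] := genq.
have q0 : q != 0.
  by apply/eqP => q0; apply: Plc; rewrite q0 lead_coef0; case: iP.
have [n [w [r [Rw Rr lt_r Eqr]]]] := pseudo_division rR Rq q0 Rh'.
have Er : q.[tau] * w.[tau] + r.[tau] = 0.
  by rewrite -hornerM -hornerD -Eqr hornerZ h't mulr0.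
have Pr : forall i, P r`_i.
  apply: minq => //; split=> //.
  have -> : r.[tau] = - (q.[tau] * w.[tau]) by apply/eqP; rewrite -addr_eq0 addrC Er.
  by apply: ideal_opp => //; apply: ideal_mulr.
have Pw : ~ P w.[tau].
  move=> Pw; have /(congr1 (fun p => p^`().[tau])) := Eqr.
  rewrite /= derivZ derivD derivM !hornerE /= => Ed.
  have Pr' : P r^`().[tau].
    rewrite horner_coef; have [P0 PD PM] := iP.
    apply: (big_ind P) => // i _; rewrite coef_deriv -mulr_natl mulrAC -mulrA.
    by rewrite mulrC; apply: ideal_mulr => //; rewrite mulrC; apply: ideal_mulr.
  have : P (lead_coef q ^+ n * h'^`().[tau]).
    rewrite Ed; have [_ PD PM] := iP; apply: (PD) Pr'; apply: PD; first exact: PM.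
    exact: ideal_mulr.
  have [_ P1 PM] := pP; case/PM => [/(prime_expr pP) //|].
  rewrite /h' deriv_map horner_map => Phd.
  have hd : h^`().[t] != 0.
    by move: seph; rewrite unlock => /coprimep_root; apply.
  by apply: P1; rewrite -(rmorph1 phi) -(divff hd) rmorphM; apply: ideal_mulr.
have satq : saturation P (ideal_of xs) q.[tau].
  apply: saturation_saturated => //; exists w.[tau] => //.
  have -> : w.[tau] * q.[tau] = - r.[tau].
    by apply/eqP; rewrite -addr_eq0 mulrC Er.
  by apply: ideal_opp => //; apply: saturation_horner_P.
have [s Ps Isy] := contracted_generated genq Ey Py.
apply: saturation_saturated => //; exists s => //.
move: Isy; apply: ideal_of_sub => // x; rewrite in_cons => /orP[/eqP -> //|x_xs].
by apply: sub_saturation => //; apply: ideal_of_mem.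
Qed.

Section Transcendental.
Hypothesis trt : transcendental_over E t.

Lemma compositum_transcendental p : poly_over R p -> p.[tau] = 0 -> p = 0.
Proof.
move=> Rp pt; apply/polyP => i; rewrite coef0.
have [lt_i|] := ltnP i (size p); last exact: nth_default.
pose I := 'I_(size p).
have frt : free_over E [set: I] (fun i : I => t ^+ i).
  move=> c Ec c0 j _; have /(congr1 (fun q : {poly K} => q`_j)) :
      \poly_(i < size p) oapp c 0 (insub i) = 0 :> {poly K}.
    apply: trt => [l|].
      rewrite coef_poly; case: ifP => [lt_l|_]; last first.
        exact: (subring0 (subfield_subring sE)).
      by rewrite insubT /=.
    rewrite /root horner_poly -[X in _ == X]c0; apply/eqP.
    under [RHS]eq_bigl do rewrite inE.
    by apply: eq_bigr => l _; rewrite valK.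
  by rewrite coef_poly coef0 ltn_ord valK.
have Ut' (l : I) : U (t ^+ l) by apply: (subringX (subfield_subring sU)).
have := free_over_compositum sE E0E EU Ut' frt (c := fun l : I => p`_l) (fun l => Rp l).
move=> /(_ _ (Ordinal lt_i)); apply; last by rewrite inE.
rewrite -[RHS]pt horner_coef; apply: eq_big => [l|l _]; first by rewrite inE.
by rewrite /= rmorphXn.
Qed.

(** Dividing the members of a basis over E(t) by a common denominator of the
    coordinates turns these into polynomials in t. *)
Lemma compositum_coordinates (I : finType) (z : I -> A) :
  exists (J : finType) (D : {set J}) (d : J -> K) (r : I -> J -> {poly A}),
    [/\ forall j, U (d j), free_over E' D d, forall i j, poly_over R (r i j)
      & forall i, z i = \sum_(j in D) (r i j).[tau] * phi (d j)].
Proof.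
have rU := subfield_subring sU.
have [|n [e [m [Ue Mm zE]]]] := compositum_family (c := z) sU.
  by move=> i; rewrite compositumU.
have [D [frD [g gP]]] := exists_basis (fun p : I * 'I_n => e p.1 p.2) sE'.
have [q [G [Eq q0 GP]]] := adjoin1_fracs sE
  (a := fun p : (I * 'I_n) * (I * 'I_n) => g p.1 p.2) (fun p => (gP p.1).1 p.2).
have E'q : E' q.[t] by apply: (poly_over_horner rE') E't; apply: poly_over_sub Eq.
exists (I * 'I_n)%type, D, (fun p => e p.1 p.2 / q.[t]),
  (fun i p => \sum_j m i j *: map_poly phi (G ((i, j), p))); split.
- move=> p; apply: (subringM rU) => //; apply: subfieldV => //.
  exact: E'U.
- move=> c Ec c0 p pD; apply: (mulIf (invr_neq0 q0)); rewrite mul0r.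
  apply: (frD (fun p => c p / q.[t])) pD => [p'|].
    by apply: (subringM rE') => //; apply: (subfieldV sE').
  rewrite -[RHS]c0; apply: eq_bigr => p' _; rewrite -mulrA.
  by congr (_ * _); rewrite mulrC.
- move=> i p l; rewrite coef_sum; apply: (subring_sum rR) => j _.
  rewrite coefZ coef_map mulrC; apply: compositum_mul => //.
  by have [] := GP ((i, j), p).
move=> i; rewrite zE; under [RHS]eq_bigr do rewrite horner_sum mulr_suml.
rewrite exchange_big /=; apply: eq_bigr => j _.
have [_ /= {1}->] := gP (i, j); rewrite rmorph_sum mulr_suml; apply: eq_bigr => p _.
rewrite hornerZ horner_map -(GP ((i, j), p)).2 /= -[in LHS](mulfVK q0 (e _ _)).
by rewrite !rmorphM; ring.
Qed.

(** In coordinates, a relation q(t) z = sum_i b_i x_i is an identity between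
    polynomials over the compositum of E, as t is transcendental over it. Its
    right-hand side vanishes modulo P, and q does not, so that the coordinates of
    z have coefficients in P. *)
Lemma transcendental_step q : contraction_generator q ->
  regular_at P (q.[tau] :: xs).
Proof.
move=> [[Rq Pq] Plc minq]; split=> // z /ideal_ofP[b Eb].
pose n := size xs.
have [J [D [d [r [Ud frd Rr rE]]]]] := compositum_coordinates
  (fun o : option 'I_n => if o is Some i then b i else z).
have RE' p : poly_over R p -> compositum E' p.[tau].
  move=> Rp; apply: (poly_over_horner (compositum_subring phi sM sE')).
    by apply: poly_over_sub Rp; apply: compositum_mono.
  exact: compositum_phi.
pose W j := q * r None j - \sum_(i < n) xs`_i *: r (Some i) j.
have RW j : poly_over R (W j).
  apply: (subringB rRX); first exact: (subringM rRX).
  apply: (subring_sum rRX) => i _; apply: (poly_overZ rR) => //.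
  exact/xsR/mem_nth.
have W0 j : j \in D -> W j = 0.
  move=> jD; apply: compositum_transcendental => //.
  have := free_over_compositum sE' (subset_trans E0E EE') E'U Ud frd
    (c := fun j => (W j).[tau]) (fun j => RE' _ (RW j)).
  apply=> //; have := Eb; rewrite (rE None).
  under [X in _ = X]eq_bigr => i _ do rewrite (rE (Some i)).
  move=> /eqP; rewrite -subr_eq0 => /eqP E1; rewrite -[RHS]E1 mulr_sumr.
  under [X in _ = _ - X]eq_bigr do rewrite mulr_suml.
  rewrite exchange_big -sumrB /=; apply: eq_bigr => j' _.
  rewrite hornerD hornerN hornerM horner_sum mulrBl mulrA; congr (_ - _).
  by rewrite mulr_suml; apply: eq_bigr => i _; rewrite hornerZ; ring.
have Pxs (i : 'I_n) : P xs`_i by apply/xsP/mem_nth.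
have Pr j : j \in D -> forall i, P (r None j)`_i.
  move=> jD; have Pqr i : P (q * r None j)`_i.
    have /eqP := W0 j jD; rewrite subr_eq0 => /eqP ->; rewrite coef_sum.
    have [P0 PD PM] := iP.
    by apply: (big_ind P) => // l _; rewrite coefZ; apply: ideal_mulr.
  (* The last coefficient outside P, times the leading coefficient of q, is the
     only term outside P of a coefficient of the product. *)
  apply: contrapT => /existsNP[i Pi].
  pose out l := ~~ `[< P (r None j)`_l >].
  have exo : exists l, out l by exists i; apply/negP => /asboolP.
  have bnd l : out l -> (l <= size (r None j))%N.
    move=> ol; apply: contraNT ol; rewrite -ltnNge => /ltnW lt_l.
    by apply/asboolP; rewrite nth_default //; case: iP.
  case: (ex_maxnP exo bnd) => l /negP ol maxl.
  have sq : (0 < size q)%N.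
    rewrite size_poly_gt0; apply/eqP => q0; apply: Plc.
    by rewrite q0 lead_coef0; case: iP.
  have := Pqr ((size q).-1 + l)%N; rewrite coefM.
  have lt_s : ((size q).-1 < ((size q).-1 + l).+1)%N by rewrite ltnS leq_addr.
  rewrite (bigD1 (Ordinal lt_s)) //= addKn => Psum.
  have [_ _ PM] := pP; have : P (q`_(size q).-1 * (r None j)`_l).
    have [P0 PD PI] := iP.
    apply: ideal_subKr iP _ (_ : P (_ - - _)); last by rewrite opprK; apply: Psum.
    apply: ideal_opp => //; apply: (big_ind P) => // s ne.
    have [lt_s'|] := ltnP s (size q); last by move=> ge; rewrite nth_default // mul0r.
    have lt_l : (l < (size q).-1 + l - s)%N.
      move: ne; rewrite -val_eqE /= => ne; move: lt_s' sq ne.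
      by move: (size q) (nat_of_ord s) => a c; lia.
    apply: PI; apply: contrapT => Pn.
    have /maxl : out ((size q).-1 + l - s)%N by apply/negP => /asboolP.
    by rewrite leqNgt lt_l.
  by rewrite -lead_coefE; case/PM => // /asboolP.
have := rE None => /= ->.
have [s0 sD _] := isat xs.
apply: (big_ind (saturation P (ideal_of xs))) => // j jD.
by apply: ideal_mulr => //; apply: saturation_horner_P => //; apply: Pr.
Qed.
End Transcendental.

End Step.

(** Regularity and local generation are those of A, not of the compositum, so that
    a longer tower only has to add generators. *)
Definition locally_regular P E := exists xs,
  [/\ forall x, x \in xs -> compositum E x /\ P x,
  regular_at P xs & forall y, compositum E y -> P y -> saturation P (ideal_of xs) y].

Lemma tower_regular P E : is_prime_ideal P -> separable_tower E0 U E ->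
  locally_regular P E.
Proof.
move=> pP; have [iP P1 _] := pP; elim=> [|E1 t tow [xs [xsP rxs gen]] Ut tr|
    E1 t tow [xs [xsP rxs gen]] Ut sep].
- exists [::]; split=> // y /compositum_base My Py; exists 1; rewrite //= mul1r.
  apply: contrapT => /eqP y0; have [y' yy'] := unitM My y0.
  by apply: P1; rewrite -yy'; apply: ideal_mulr.
all: have [sE1 E01 E1U] := separable_tower_field sE0 sU E0U tow.
all: have sub1 := compositum_mono (@adjoin_base _ E1 [set t]).
all: have xsR x : x \in xs -> compositum E1 x by case/xsP.
all: have xsP' x : x \in xs -> P x by case/xsP.
- have [[h [i [ch Phi]]]|none] := pselect (exists h i, contracted E1 t P h /\ ~ P h`_i).
    have [q genq] := exists_contraction_generator sE1 pP ch Phi.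
    exists ((q.[phi t]) :: xs); split.
    + move=> x; rewrite in_cons => /orP[/eqP ->|x_xs]; last first.
        by split; [apply: sub1; apply: xsR|apply: xsP'].
      have [[Rq Pq] _ _] := genq; split=> //.
      have sE' := adjoin_subfield E1 [set t].
      apply: (poly_over_horner (compositum_subring phi sM sE')).
        exact: poly_over_sub Rq.
      by apply: (compositum_phi phi sM); apply: adjoin_gen.
    + exact: (transcendental_step sE1 E01 E1U Ut pP xsR xsP' rxs gen tr genq).
    + by move=> y; apply: (contracted_generated sE1 pP gen genq).
  exists xs; split=> // [x x_xs|y Ey Py].
    by split; [apply: sub1; apply: xsR|apply: xsP'].
  have [v [w [p [vw Rp Ep]]]] := compositum_adjoin_frac sE1 Ey.
  have -> : y = p.[phi t] * w by rewrite -Ep -mulrA vw mulr1.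
  have iJ := saturation_ideal pP (ideal_of_ideal xs).
  apply: ideal_mulr => //; apply: (saturation_horner_P t pP gen Rp) => i.
  apply: contrapT => Ppi; apply: none; exists p, i; split=> //.
  by split=> //; rewrite -Ep; apply: ideal_mulr.
exists xs; split=> // [x x_xs|y Ey Py].
  by split; [apply: sub1; apply: xsR|apply: xsP'].
exact: (separable_step sE1 pP gen sep).
Qed.

(** P has finitely many generators, which involve finitely many elements of U; a
    tower that contains these generates P. *)
Theorem towers_regular_sequence P : noetherian A ->
  (forall s : seq K, [set` s] `<=` U ->
     exists2 E, separable_tower E0 U E & [set` s] `<=` E) ->
  is_prime_ideal P ->
  exists xs, [/\ forall x, x \in xs -> P x, regular_at P xs
    & P `<=` saturation P (ideal_of xs)].
Proof.
move=> nA towers pP; have [iP _ _] := pP.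
have [ys Eys] := noetherian_ideal_of nA iP.
have [E towE ysE] : exists2 E, separable_tower E0 U E &
    forall y, y \in ys -> compositum E y.
  have [s sU' ysS] : exists2 s : seq K, [set` s] `<=` U &
      forall E, [set` s] `<=` E -> forall y, y \in ys -> compositum E y.
    elim: ys {Eys} => [|y ys [s sU' ysS]]; first by exists [::].
    have : compositum U y by rewrite compositumU.
    move=> [s' s'U Ey]; exists (s ++ [seq z.1 | z <- s']).
      move=> x /=; rewrite mem_cat => /orP[/sU' //|/mapP[z /s'U[Uz _] ->]]; exact: Uz.
    move=> E sE x; rewrite in_cons => /orP[/eqP ->|x_ys]; last first.
      by apply: ysS x_ys => z /= zs; apply: sE; rewrite /= mem_cat zs.
    exists s' => // z zs'; have [_ Mz] := s'U z zs'; split=> //.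
    by apply: sE; rewrite /= mem_cat (map_f fst) ?orbT.
  by have [E towE sE] := towers s sU'; exists E => //; apply: ysS.
have [xs [xsP rxs gen]] := tower_regular pP towE.
exists xs; split=> // [x /xsP[]//|].
rewrite {1}Eys; apply: ideal_of_sub.
  by apply: saturation_ideal => //; apply: ideal_of_ideal.
move=> y y_ys; apply: gen; first exact: ysE.
by rewrite Eys; apply: ideal_of_mem.
Qed.

End TowerRegularity.

Theorem regular_of_towers (K : fieldType) (A : comPzRingType) (phi : {rmorphism K -> A})
    (E0 U : set K) (M : set A) : (1 : A) <> 0 ->
  is_subfield E0 -> is_subfield U -> E0 `<=` U -> is_subring M ->
  (forall a, E0 a -> M (phi a)) ->
  (forall m, M m -> m <> 0 -> exists m', m * m' = 1) ->
  compositum phi M U = setT ->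
  (forall (I : finType) (B : {set I}) (a : I -> K),
    (forall i, U (a i)) -> free_over E0 B a -> free_over M B (phi \o a)) ->
  noetherian A ->
  (forall s : seq K, [set` s] `<=` U ->
     exists2 E, separable_tower E0 U E & [set` s] `<=` E) ->
  regular_ring A.
Proof.
move=> /eqP A1 sE0 sU E0U sM E0M unitM compU freeU nA towers.
(* Polynomials over A require 1 <> 0 as a part of the structure of A. *)
pose nz := GRing.PzSemiRing_isNonZero.Build A A1.
pose A' : comNzRingType := HB.pack (A : Type) nz (GRing.ComPzRing.class A).
have unitM' (m : A') : M m -> m != 0 -> exists m', m * m' = 1.
  by move=> Mm /eqP m0; apply: unitM.
split=> // p; have [xs [xsP rxs gen]] := @towers_regular_sequence K A' phi E0 U M
  sE0 sU E0U sM E0M unitM' compU freeU (prime_set p) nA towers (prime_setP p).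
exact: (regular_localization nA xsP rxs gen).
Qed.

(** * Coordinates in a tensor product over a field *)

Section Coordinates.
Variables (k K L : fieldType) (f : {rmorphism k -> K}) (g : {rmorphism k -> L}).

Lemma tensor_pairs (I : finType) (x : I -> tensor f g) :
  exists n (a : I -> 'I_n -> K) (l : I -> 'I_n -> L),
    forall i, x i = \sum_j pure f g (a i j) (l i j).
Proof.
pose s i := repr (x i); pose n := \max_i size (s i).
exists n, (fun i j => (nth 0 (s i) j).1), (fun i j => (nth 0 (s i) j).2) => i.
have le_n : (size (s i) <= n)%N by apply: leq_bigmax.
by rewrite [LHS]tensor_sum; apply: big_nth_pad; rewrite ?pure0r.
Qed.

Lemma tensor_coordinates_l (I : finType) (x : I -> tensor f g) :
  exists (J : finType) (D : {set J}) (d : J -> K) (l : I -> J -> L),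
    free_over (range f) D d /\
    forall i, x i = \sum_(j in D) pure f g (d j) (l i j).
Proof.
have [n [a [l xE]]] := tensor_pairs x.
have [D [frD [c cP]]] :=
  exists_basis (fun p : I * 'I_n => a p.1 p.2) (range_subfield f).
have /choice[h hE] : forall p : (I * 'I_n) * (I * 'I_n), exists b, f b = c p.1 p.2.
  by move=> [p q]; have [/(_ q)[b _ Eb] _] := cP p; exists b.
exists (I * 'I_n)%type, D, (fun p => a p.1 p.2),
  (fun i q => \sum_j g (h ((i, j), q)) * l i j); split=> // i.
rewrite xE; under [RHS]eq_bigr do rewrite pure_sumr.
rewrite exchange_big /=; apply: eq_bigr => j _.
have [_ /= {1}->] := cP (i, j); rewrite pure_suml; apply: eq_bigr => q _.
by rewrite -(hE ((i, j), q)) pureZ.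
Qed.

Lemma tensor_coordinates_r (x : tensor f g) :
  exists (J : finType) (D : {set J}) (a : J -> K) (d : J -> L),
    free_over (range g) D d /\ x = \sum_(j in D) pure f g (a j) (d j).
Proof.
have [n [a [l xE]]] := tensor_pairs (fun _ : unit => x).
have [D [frD [c cP]]] := exists_basis (l tt) (range_subfield g).
have /choice[h hE] : forall p : 'I_n * 'I_n, exists b, g b = c p.1 p.2.
  by move=> [p q]; have [/(_ q)[b _ Eb] _] := cP p; exists b.
exists 'I_n, D, (fun q => \sum_j f (h (j, q)) * a tt j), (l tt); split=> //.
rewrite (xE tt); under [RHS]eq_bigr do rewrite pure_suml.
rewrite exchange_big /=; apply: eq_bigr => j _.
have [_ {1}->] := cP j; rewrite pure_sumr; apply: eq_bigr => q _.
by rewrite -(hE (j, q)) pureZ.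
Qed.

Lemma free_over1 (F : fieldType) (E : set F) :
  free_over E [set: unit] (fun=> 1 : F).
Proof.
by move=> c _; rewrite (big_setD1 tt) ?inE //= mulr1 big1 ?addr0 => [c0 []|[]];
  rewrite // !inE.
Qed.

Lemma tensor_neq0 : (1 : tensor f g) <> 0.
Proof.
move=> E; have := tensor_free (g := g) (@free_over1 K (range f)) (l := fun=> 1).
move=> /(_ _ tt); rewrite inE => /(_ _ isT)/eqP; rewrite oner_eq0 => H.
suff : false by []; apply: H.
by rewrite (big_setD1 tt) ?inE //= big1 ?addr0 // => -[]; rewrite !inE.
Qed.

End Coordinates.

(** * Tensor products with a purely inseparable extension *)

Section PurelyInseparable.
Variables (k K L : fieldType) (f : {rmorphism k -> K}) (g : {rmorphism k -> L}).
Local Notation Ki := (pinsep_field f).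
Local Notation B := (tensor (to_pinsep f) g).
Local Notation A := (tensor f g).

Lemma pinsep_fieldP (c : Ki) : exists2 n, [pchar k].-nat n &
  exists a, c ^+ n = to_pinsep f a.
Proof.
have := pinsep_valP c; rewrite inE => -[n cn [a E]]; exists n => //; exists a.
by apply: val_inj; rewrite rmorphXn.
Qed.

Lemma pnat_pchar_gt0 n : [pchar k].-nat n -> (0 < n)%N.
Proof. by case: n. Qed.

(** The Frobenius powers kill the left factor: every element of the tensor
    product has a power in L. *)
Lemma tensor_pinsep_pow (x : B) : exists2 n, [pchar k].-nat n &
  exists l, x ^+ n = tensor_inr (to_pinsep f) g l.
Proof.
pose base := tensor_inl (to_pinsep f) g \o to_pinsep f.
rewrite [x]tensor_sum; elim: (repr x) => [|[c l] s [n cn [l' IH]]] /=.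
  by exists 1%N => //; exists 0; rewrite big_nil rmorph0.
have [m cm [a Ec]] := pinsep_fieldP c.
exists (m * n)%N; first by rewrite pnatM cm.
exists ((g a * l ^+ m) ^+ n + l' ^+ m).
rewrite big_cons (frobeniusD base); last by rewrite pnatM cm.
rewrite [in X in _ + X]mulnC [X in _ + X]exprM IH exprM rmorphD !rmorphXn rmorphM /=.
congr (_ ^+ n + _).
rewrite pure_in_l exprMn -[pure _ _ c 1]/(tensor_inl _ _ c).
rewrite -[pure _ _ 1 l]/(tensor_inr _ _ l) -!rmorphXn Ec /=.
by rewrite tensor_in_base rmorphXn.
Qed.

(** A Frobenius power of a nonzero element is a nonzero element of L. *)
Lemma domain_field : is_domain B -> is_field B.
Proof.
move=> [B1 idB]; split=> // x x0; have [n cn [l xn]] := tensor_pinsep_pow x.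
have n_gt0 := pnat_pchar_gt0 cn.
have l0 : l != 0.
  apply/eqP => l0; have : x ^+ n = 0 by rewrite xn l0 rmorph0.
  elim: n {cn xn n_gt0} => [/B1 //|n IH]; rewrite exprS => /idB/orP[/eqP //|/eqP].
  exact: IH.
exists (x ^+ n.-1 * tensor_inr (to_pinsep f) g l^-1).
by rewrite mulrA -exprS prednK // xn -rmorphM divff // rmorph1.
Qed.

(** Frobenius powers of x and y are elements l and l' of L with l l' = 0. *)
Lemma reduced_domain : (1 : B) <> 0 -> (forall (x : B) n, x ^+ n = 0 -> x = 0) ->
  is_domain B.
Proof.
move=> B1 red; split=> // x y xy; have [n cn [l xn]] := tensor_pinsep_pow x.
have [m cm [l' ym]] := tensor_pinsep_pow y.
have inr_inj c : tensor_inr (to_pinsep f) g c = 0 -> c = 0.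
  move=> c0; apply/eqP/negPn/negP => cn0; apply: B1.
  by rewrite -(rmorph1 (tensor_inr (to_pinsep f) g)) -(divff cn0) rmorphM /= c0 mul0r.
have : tensor_inr (to_pinsep f) g (l ^+ m * l' ^+ n) = 0.
  rewrite rmorphM !rmorphXn /= -xn -ym -!exprM [(m * n)%N]mulnC -exprMn xy.
  by rewrite expr0n muln_eq0 !eqn0Ngt !pnat_pchar_gt0.
move=> /inr_inj/eqP; rewrite mulf_eq0 !expf_eq0 !pnat_pchar_gt0 //=.
by case/orP => /eqP l0; apply/orP; [left|right]; apply/eqP;
  [apply: (red _ n)|apply: (red _ m)]; rewrite ?xn ?ym l0 rmorph0.
Qed.

Lemma exists_theta : exists theta : {rmorphism B -> A},
  forall c l, theta (pure _ _ c l) = pure f g (\val c) l.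
Proof.
have [|h hP] := tensor_lift (alpha := tensor_inl f g \o (\val : Ki -> K))
  (beta := tensor_inr f g) (f := to_pinsep f) (g := g).
  by move=> c; apply: tensor_in_base.
by exists h => c l; rewrite hP /= -pure_in_l.
Qed.

(** K (x) L is free over Ki (x) L, since the products of a free family over Ki by
    a free family of Ki over k are free over k. *)
Lemma free_over_theta (theta : {rmorphism B -> A}) (I : finType) (D : {set I})
    (e : I -> K) (b : I -> B) :
  (forall c l, theta (pure _ _ c l) = pure f g (\val c) l) ->
  free_over (pinsep_closure f) D e ->
  \sum_(i in D) theta (b i) * tensor_inl f g (e i) = 0 ->
  forall i, i \in D -> b i = 0.
Proof.
move=> thetaP fre E.
have [J [D' [d [l [frd bE]]]]] := tensor_coordinates_l b.
have frd' : free_over (range f) D' (fun j => \val (d j)).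
  have -> : range f = (\val : Ki -> K) @` range (to_pinsep f).
    apply/seteqP; split=> [_ [c _ <-]|_ [_ [c _ <-] <-]]; last by exists c.
    by exists (to_pinsep f c) => //; exists c.
  exact/(free_over_morph (\val : {rmorphism Ki -> K})).
have sKi := pinsep_closure_divring f.
have fr : free_over (range f) (finset.setX D D') (fun p => e p.1 * \val (d p.2)).
  apply: free_over_mul fre frd' => [|_ [c _ <-]|j].
  - exact: subfield_subring.
  - by have := base_in_pinsep f c; rewrite inE.
  - by have := pinsep_valP (d j); rewrite inE.
have l0 := tensor_free (g := g) (l := fun p => l p.1 p.2) fr.
move=> i iD; rewrite bE big1 // => j jD'.
rewrite (l0 _ (i, j)) ?pure0r ?finset.in_setX ?iD //.
rewrite -[RHS]E; under [RHS]eq_bigr do rewrite bE rmorph_sum mulr_suml.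
rewrite pair_big_dep /=; apply: eq_big => [[i' j']|[i' j'] _] /=.
  by rewrite finset.in_setX.
by rewrite thetaP /tensor_inl pureM mulr1 mulrC.
Qed.

(** A nilpotent x of B is killed by some s outside a minimal prime of A, because
    the localization there is a field. If x is not zero, the coordinates of s
    over B are killed by x, hence nilpotent, and s is nilpotent. *)
Theorem regular_reduced : noetherian A -> regular_ring A -> (1 : B) <> 0 ->
  is_domain B.
Proof.
move=> nA [_ regA] B1; apply: reduced_domain => // x n xn.
have [P [pP minP]] := exists_minimal_prime nA (@tensor_neq0 _ _ _ f g).
have [iP P1 _] := pP; pose p := PrimeIdeal pP.
have [theta thetaP] := exists_theta.
have nilP (y : B) m : y ^+ m = 0 -> P (theta y).
  move=> ym; apply: (@prime_expr _ _ _ m) => //.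
  by rewrite -rmorphXn ym rmorph0; case: iP.
have [s Ps sx] := @regular_minimal_prime _ p nA minP (regA p) _ (nilP x n xn).
apply: contrapT => x0; apply: Ps.
have [m [a [l sE]]] := tensor_pairs (fun _ : unit => s).
have [D [frD [c cP]]] := exists_basis (a tt) (pinsep_closure_divring f).
have /choice[h hE] : forall q : 'I_m * 'I_m, exists b : Ki, \val b = c q.1 q.2.
  move=> [i j]; have [/(_ j) Kc _] := cP i.
  have Kc' : c i j \in pinsep_pred f by rewrite inE.
  by exists (PinsepField Kc').
pose b j := \sum_i pure (to_pinsep f) g (h (i, j)) (l tt i).
have {}sE : s = \sum_(j in D) theta (b j) * tensor_inl f g (a tt j).
  rewrite (sE tt); under [RHS]eq_bigr do rewrite rmorph_sum mulr_suml.
  rewrite exchange_big /=; apply: eq_bigr => i _.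
  have [_ {1}->] := cP i; rewrite pure_suml; apply: eq_bigr => j _.
  by rewrite thetaP hE /tensor_inl pureM mulr1.
have [P0 PD PM] := iP.
rewrite sE; apply: (big_ind P) => // j jD; apply: ideal_mulr => //.
have bx : b j * x = 0.
  apply: (free_over_theta (b := fun j => b j * x) thetaP frD) jD.
  rewrite -[RHS]sx /= sE mulr_suml; apply: eq_bigr => i _.
  by rewrite rmorphM mulrAC.
have [q cq [c' bq]] := tensor_pinsep_pow (b j).
apply: (nilP _ q); rewrite bq; have [->|c0] := eqVneq c' 0; first by rewrite rmorph0.
case: x0; rewrite -[x]mul1r -(rmorph1 (tensor_inr (to_pinsep f) g)) -(mulVf c0).
rewrite rmorphM /= -bq -(prednK (pnat_pchar_gt0 cq)) exprSr -!mulrA bx.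
by rewrite !mulr0.
Qed.

(** K is the compositum of Ks and Ki as a ring: a Frobenius power of each of its
    elements lies in Ks, so that this ring is a field. *)
Lemma composite_field_compositum Ks : is_subfield Ks -> range f `<=` Ks ->
  adjoin Ks (pinsep_closure f) = setT ->
  forall x, compositum (idfun : {rmorphism K -> K}) (pinsep_closure f) Ks x.
Proof.
move=> sKs fKs KsKi x; have : adjoin Ks (pinsep_closure f) x by rewrite KsKi.
have sKi := pinsep_closure_divring f; have rKi := subfield_subring sKi.
have rC := compositum_subring (idfun : {rmorphism K -> K}) rKi sKs.
move: x; apply: adjoin_min.
- apply/subfieldP; split=> // x Cx; have [->|x0] := eqVneq x 0.
    by rewrite invr0; apply: subring0.
  have [n [e [m [Ee Mm xE]]]] := compositum_family rKi sKs (I := unit) (fun=> Cx).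
  have [q cq qP] := pinsep_common_exponent (Mm tt).
  have Kxq : Ks (x ^+ q).
    rewrite (xE tt) (frobenius_sum f _ _ _ cq).
    apply: (subring_sum (subfield_subring sKs)) => j _; rewrite exprMn.
    apply: (subringM (subfield_subring sKs)); last exact/fKs/qP.
    by apply: (subringX (subfield_subring sKs)); apply: Ee.
  have -> : x^-1 = x ^+ q.-1 * (x ^+ q)^-1.
    rewrite -{2}(prednK (pnat_pchar_gt0 cq)) exprS invfM mulrCA divff ?mulr1 //.
    exact: expf_neq0.
  apply: (subringM rC); first exact: (subringX rC).
  by apply: (compositum_phi (idfun : {rmorphism K -> K}) rKi); apply: subfieldV.
- by move=> x Kx; apply: (compositum_phi (idfun : {rmorphism K -> K}) rKi).
- move=> x Kx; rewrite -[x]mul1r -[1]/((idfun : {rmorphism K -> K}) 1).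
  by apply: compositum_mul => //; apply: subring1; apply: subfield_subring.
Qed.

(** The towers in Ks play the role of finitely generated separable extensions, and
    the image M of B that of a ground field: Ks and Ki being linearly disjoint, A
    is Ks (x) M. *)
Theorem pinsep_field_regular Ks : noetherian A -> is_subfield Ks -> range f `<=` Ks ->
  separable_extension f Ks -> adjoin Ks (pinsep_closure f) = setT ->
  is_field B -> regular_ring A.
Proof.
move=> nA sKs fKs sepKs KsKi [B1 fieldB].
have sk := range_subfield f; have [theta thetaP] := exists_theta.
have towers s := @exists_separable_tower _ _ f Ks s sKs fKs sepKs.
have rM := range_subring theta; have A1 := @tensor_neq0 _ _ _ f g.
have sKi := pinsep_closure_divring f; have rKi := subfield_subring sKi.
apply: (@regular_of_towers K A (tensor_inl f g) (range f) Ks (range theta)) => //.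
- by move=> _ [a _ <-]; exists (pure (to_pinsep f) g (to_pinsep f a) 1).
- move=> _ [b _ <-] b0; have [|c bc] := fieldB b.
    by move=> E; apply: b0; rewrite E rmorph0.
  by exists (theta c); rewrite -rmorphM bc rmorph1.
- apply/seteqP; split=> // x _; rewrite [x]tensor_sum.
  have rC := compositum_subring (tensor_inl f g) rM sKs.
  apply: (subring_sum rC) => z _.
  have [s sP ->] := composite_field_compositum sKs fKs KsKi z.1.
  rewrite pure_suml big_seq; apply: (subring_sum rC) => w /sP[Kw Kiw].
  have Kiw' : w.2 \in pinsep_pred f by rewrite inE.
  have -> : pure f g (idfun w.1 * w.2) z.2 =
      tensor_inl f g w.1 * theta (pure _ _ (PinsepField Kiw') z.2).
    by rewrite thetaP /tensor_inl pureM mul1r.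
  by apply: compositum_mul => //; exists (pure _ _ (PinsepField Kiw') z.2).
- move=> I D a Ka fra c Mc c0 i iD.
  have /choice[b bP] : forall i, exists b, theta b = c i.
    by move=> j; have [b _ Eb] := Mc j; exists b.
  have fra' := free_over_pinsep sKs fKs towers Ka fra.
  rewrite -bP (free_over_theta thetaP fra' (b := b) _ iD) ?rmorph0 //.
  by rewrite -[RHS]c0; apply: eq_bigr => j _; rewrite bP.
Qed.

End PurelyInseparable.

(** * Degrees of finite purely inseparable extensions *)

Section Degrees.
Variables (k F : fieldType) (f : {rmorphism k -> F}).
Implicit Types (E T : set F).

Definition spans E (I : finType) (b : I -> F) E' : Prop :=
  forall x, E' x -> exists2 c : I -> F, forall i, E (c i) & x = \sum_i c i * b i.

Lemma degree_eqP E E' d : degree_eq E E' d <->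
  exists b : 'I_d -> F,
    [/\ forall i, E' (b i), spans E b E' & free_over E [set: 'I_d] b].
Proof.
have sumT (c b : 'I_d -> F) :
    \sum_(i in [set: 'I_d]%SET) c i * b i = \sum_i c i * b i.
  by apply: eq_bigl => i; rewrite inE.
split=> -[b [Eb spb frb]]; exists b; split=> // c Ec c0 i.
  by move=> _; apply: frb => //; rewrite -sumT.
by apply: frb => //; rewrite ?sumT ?inE.
Qed.

Lemma spans_degree E E' (I : finType) (b : I -> F) : is_subfield E ->
  (forall i, E' (b i)) -> spans E b E' -> exists d, degree_eq E E' d.
Proof.
move=> sE E'b spb; have rE := subfield_subring sE.
have [D [frD [g gP]]] := exists_basis b sE.
exists #|D|; apply/degree_eqP; exists (fun i => b (enum_val i)).
split=> [i|x E'x|c Ec c0 i _].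
- exact: E'b.
- have [c Ec ->] := spb x E'x.
  exists (fun i => \sum_j c j * g j (enum_val i)) => [i|].
    by apply: (subring_sum rE) => j _; apply: (subringM rE) => //; have [] := gP j.
  under [RHS]eq_bigr do rewrite mulr_suml.
  rewrite exchange_big /=; apply: eq_bigr => j _; have [_ ->] := gP j.
  rewrite mulr_sumr big_enum_val /=.
  by apply: eq_bigr => i _; rewrite mulrA.
pose c' q := if insub (index q (enum D)) is Some j then c j else 0.
have c'E (j : 'I_#|D|) : c' (enum_val j) = c j.
  rewrite /c' /enum_val index_uniq ?enum_uniq ?valK //.
  by rewrite -cardE.
rewrite -c'E; apply: frD; last exact: enum_valP.
  by move=> q; rewrite /c'; case: insub => // ; apply: (subring0 rE).
rewrite big_enum_val /= -[RHS]c0.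
by apply: eq_big => [j|j _]; rewrite ?inE // c'E.
Qed.

(** Some Frobenius power of t lies in E', hence so does that of any polynomial in t:
    a fraction gets a scalar denominator, and reduction modulo X^n - t^n does the
    rest. *)
Lemma spans_adjoin1 E' t n : is_subfield E' -> range f `<=` E' -> [pchar k].-nat n ->
  E' (t ^+ n) -> spans E' (fun i : 'I_n => t ^+ i) (adjoin E' [set t]).
Proof.
move=> sE' fE' cn E'tn x E'x; have rE' := subfield_subring sE'.
have rP := poly_over_subring rE'.
have n_gt0 : (0 < n)%N by case: n cn {E'tn}.
have [q [p [Eq q0 pP]]] := adjoin1_fracs sE' (a := fun _ : unit => x) (fun=> E'x).
have [Ep xE] := pP tt.
have Eqn : E' (q.[t] ^+ n).
  rewrite horner_coef (frobenius_sum f _ _ _ cn); apply: (subring_sum rE') => i _.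
  rewrite exprMn; apply: (subringM rE'); first exact: (subringX rE').
  by rewrite -exprM mulnC exprM; apply: (subringX rE').
pose P := (q.[t] ^+ n)^-1 *: (p tt * q ^+ n.-1).
have EP : poly_over E' P.
  apply: (poly_overZ rE'); first exact: subfieldV.
  by apply: (subringM rP) => //; apply: (subringX rP).
have xP : x = P.[t].
  rewrite hornerZ hornerM horner_exp -xE -mulrA -exprS prednK //.
  by rewrite mulrCA mulVf ?mulr1 // expf_neq0.
pose h := 'X^n - (t ^+ n)%:P : {poly F}.
have Eh : poly_over E' h.
  by apply: (subringB rP); [apply: poly_overXn|apply: poly_overC].
have mh : h \is monic by apply: monicXnsubC.
have [m [w [r [Ew Er lt_r]]]] := pseudo_division rE' Eh (monic_neq0 mh) EP.
rewrite (monicP mh) expr1n scale1r => EPh.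
exists (fun i : 'I_n => r`_i) => //; rewrite xP EPh hornerD hornerM.
rewrite /h hornerD hornerN hornerXn hornerC subrr mul0r add0r.
by apply: horner_coef_wide; rewrite -ltnS -(size_XnsubC (t ^+ n) n_gt0).
Qed.

Lemma spans_trans E E' E'' (I J : finType) (b : I -> F) (c : J -> F) :
  is_subring E -> spans E b E' -> spans E' c E'' ->
  spans E (fun p : I * J => b p.1 * c p.2) E''.
Proof.
move=> rE spb spc x /spc[d Ed ->]; have /choice[e eP] : forall j, exists e : I -> F,
    (forall i, E (e i)) /\ d j = \sum_i e i * b i.
  by move=> j; have [e Ee ->] := spb _ (Ed j); exists e.
exists (fun p => e p.2 p.1) => [p|]; first by case: (eP p.2).
rewrite -(pair_bigA _ (fun i j => e j i * (b i * c j))) exchange_big /=.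
apply: eq_bigr => j _; have [_ ->] := eP j; rewrite mulr_suml.
by apply: eq_bigr => i _; rewrite mulrA.
Qed.

Lemma pinsep_degree (s : seq F) : [set` s] `<=` pinsep_closure f ->
  exists d, degree_eq (range f) (adjoin (range f) [set` s]) d.
Proof.
move=> sKi; have sk := range_subfield f.
suff [I [b [Eb spb]]] : exists (I : finType) (b : I -> F),
    (forall i, adjoin (range f) [set` s] (b i)) /\
    spans (range f) b (adjoin (range f) [set` s]).
  exact: (spans_degree sk Eb spb).
elim: s sKi => [|t s IH] sKi.
  exists unit, (fun=> 1); split=> [_|x].
    exact: (subring1 (subfield_subring (adjoin_subfield _ _))).
  have -> : [set` [::]] = set0 :> set F by apply/seteqP; split.
  rewrite adjoin0 // => kx; exists (fun=> x) => //.
  by rewrite (big_pred1 tt) ?mulr1 // => -[].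
have [|I [b [Eb spb]]] := IH.
  by move=> x xs; apply: sKi; rewrite /= in_cons xs orbT.
have [n cn [a ta]] : pinsep_closure f t by apply: sKi; rewrite /= mem_head.
have sEs := adjoin_subfield (range f) [set` s].
rewrite adjoin_set_cons; set E' := adjoin _ _ in Eb spb sEs *.
have kE' : range f `<=` E' by apply: adjoin_base.
have spt := @spans_adjoin1 E' t n sEs kE' cn.
exists (I * 'I_n)%type, (fun p : I * 'I_n => b p.1 * t ^+ p.2); split.
  move=> p; have rE'' := subfield_subring (adjoin_subfield E' [set t]).
  apply: (subringM rE''); first exact: adjoin_base.
  by apply: (subringX rE''); apply: adjoin_gen.
apply: spans_trans (subfield_subring sk) spb (spt _).
by rewrite ta; apply: kE'; exists a.
Qed.

End Degrees.

Lemma coef_exp_XsubC (R : comNzRingType) (c : R) n :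
  (('X - c%:P) ^+ n.+1)`_n = - (c *+ n.+1).
Proof.
elim: n => [|n IH]; first by rewrite expr1 coefB coefX coefC /= sub0r.
rewrite exprSr mulrBr coefB coefMX coefMC /= IH.
have -> : (('X - c%:P) ^+ n.+1)`_n.+1 = 1.
  have : ('X - c%:P) ^+ n.+1 \is monic by rewrite monic_exp ?monicXsubC.
  by move=> /monicP; rewrite lead_coefE size_exp_XsubC.
by rewrite mul1r -opprD -mulrSr.
Qed.

(** With n = a b, where a is the part of n at the characteristic exponent, the
    polynomial is (X^a - x^a)^b, and its coefficient next to the leading one is
    - b x^a, where b is invertible. *)
Lemma exp_XsubC_coef (k F : fieldType) (f : {rmorphism k -> F}) (M : set F) x n :
  is_subfield M -> (0 < n)%N -> poly_over M (('X - x%:P) ^+ n) ->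
  exists a, [/\ [pchar k].-nat a, (a <= n)%N & M (x ^+ a)].
Proof.
move=> sM n_gt0 Mn; have rM := subfield_subring sM.
pose a := (n`_[pchar k])%N; pose b := (n`_([pchar k]^'))%N.
have nab : (a * b)%N = n by apply: partnC.
have ca : [pchar k].-nat a by apply: part_pnat.
have cb : [pchar k]^'.-nat b by apply: part_pnat.
have [a_gt0 b_gt0] : (0 < a)%N /\ (0 < b)%N by rewrite !part_gt0.
exists a; split=> //; first by rewrite -nab leq_pmulr.
have b0 : (b%:R : F) != 0.
  by rewrite -(rmorph_nat f) fmorph_eq0 natf_neq0_pchar.
have E : ('X - x%:P) ^+ n = ('X - (x ^+ a)%:P) ^+ b \Po 'X^a.
  rewrite -nab exprM (frobeniusB (polyC \o f)) // rmorphXn rmorphB /=.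
  by rewrite comp_polyX comp_polyC polyC_exp.
have := Mn (b.-1 * a)%N; rewrite E coef_comp_poly_Xn // dvdn_mull // mulnK //.
rewrite -{1}(prednK b_gt0) coef_exp_XsubC prednK // => Mb.
have -> : x ^+ a = - (- (x ^+ a *+ b)) / b%:R.
  by rewrite opprK -mulr_natr mulfK.
apply: (subringM rM); first exact: (subringN rM).
by apply: subfieldV => //; apply: subring_nat.
Qed.

(** * Purely inseparable extensions inside a closure of L *)

Section InClosure.
Variables (k K L F : fieldType).
Variables (f : {rmorphism k -> K}) (g : {rmorphism k -> L}).
Variables (iota : {rmorphism L -> F}) (u : {rmorphism pinsep_field f -> F}).
Hypothesis u_base : forall a, u (to_pinsep f a) = iota (g a).
Local Notation Ki := (pinsep_field f).
Local Notation B := (tensor (to_pinsep f) g).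
Local Notation k' := (range (iota \o g)).
Local Notation L' := (range iota).
Local Notation kS S' := (adjoin (range (iota \o g)) (u @` S')).
Local Notation LS S' := (adjoin (range iota) (u @` S')).
Implicit Types (T : set Ki).

Let sk : is_subfield k'. Proof. exact: range_subfield. Qed.
Let sL : is_subfield L'. Proof. exact: range_subfield. Qed.
Let skS T : is_subfield (kS T). Proof. exact: adjoin_subfield. Qed.
Let sLS T : is_subfield (LS T). Proof. exact: adjoin_subfield. Qed.
Let kL : k' `<=` L'. Proof. by move=> _ [a _ <-]; exists (g a). Qed.

Lemma u_range_base : u @` range (to_pinsep f) = k'.
Proof.
apply/seteqP; split=> [_ [_ [a _ <-] <-]|_ [a _ <-]]; first by exists a.
by exists (to_pinsep f a); rewrite ?u_base //; exists a.
Qed.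

Lemma kS_sub_range T : kS T `<=` range u.
Proof.
apply: adjoin_min; first exact: range_subfield.
  by rewrite -u_range_base => _ [c _ <-]; exists c.
by move=> _ [c _ <-]; exists c.
Qed.

Lemma kS_sub_LS T : kS T `<=` LS T.
Proof. exact: adjoin_mono. Qed.

Lemma u_adjoin T c : adjoin (range (to_pinsep f)) T c -> kS T (u c).
Proof.
move: c; apply: (@adjoin_min _ _ _ [set c | kS T (u c)]).
- have rkS := subfield_subring (skS T).
  apply/subfieldP; split; first split=> /=.
  + by rewrite rmorph1; apply: subring1.
  + by move=> x y kx ky; rewrite rmorphB; apply: (subringB rkS).
  + by move=> x y kx ky; rewrite rmorphM; apply: (subringM rkS).
  + by move=> x kx; rewrite /= fmorphV; apply: (subfieldV (skS T)).
- by move=> c [a _ <-] /=; rewrite u_base; apply: adjoin_base; exists a.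
- by move=> c Tc /=; apply: adjoin_gen; exists c.
Qed.

Lemma u_pinsep c : pinsep_closure (iota \o g) (u c).
Proof.
have [n cn [a Ec]] := pinsep_fieldP c; exists n => //; exists a.
by rewrite -rmorphXn Ec u_base.
Qed.

Lemma exists_mult_map : exists h : {rmorphism B -> F},
  forall c l, h (pure _ _ c l) = u c * iota l.
Proof. exact: tensor_lift. Qed.

Lemma tensor_pinsep_neq0 : (1 : B) <> 0.
Proof.
have [h hP] := exists_mult_map => /(congr1 h)/eqP.
by rewrite rmorph1 rmorph0 oner_eq0.
Qed.

(** The span over L is a ring in which Frobenius powers land in L, hence a field
    that contains L and the generators of L(S'). *)
Lemma spans_LS T (I : finType) (b : I -> F) : (forall i, kS T (b i)) ->
  spans k' b (kS T) -> spans L' b (LS T).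
Proof.
move=> kb spb; have rL := subfield_subring sL; have rkS := subfield_subring (skS T).
pose W := [set x | exists2 c : I -> F, forall i, L' (c i) & x = \sum_i c i * b i].
have kW : kS T `<=` W.
  by move=> x /spb[c kc ->]; exists c => // i; apply: kL.
have WD x y : W x -> W y -> W (x + y).
  move=> [c Lc ->] [d Ld ->]; exists (fun i => c i + d i).
    by move=> i; apply: (subringD rL).
  by rewrite -big_split /=; apply: eq_bigr => i _; rewrite mulrDl.
have WZ a x : L' a -> W x -> W (a * x).
  move=> La [c Lc ->]; exists (fun i => a * c i).
    by move=> i; apply: (subringM rL).
  by rewrite mulr_sumr; apply: eq_bigr => i _; rewrite mulrA.
have W1 : W 1 by apply: kW; apply: (subring1 rkS).
have W0 : W 0 by apply: kW; apply: (subring0 rkS).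
have WM x y : W x -> W y -> W (x * y).
  move=> [c Lc ->] [d Ld ->]; rewrite mulr_suml.
  apply: (big_ind W) => // i _; rewrite mulr_sumr; apply: (big_ind W) => // j _.
  have -> : c i * b i * (d j * b j) = c i * d j * (b i * b j) by ring.
  by apply: WZ; [apply: (subringM rL)|apply: kW; apply: (subringM rkS)].
have LW a : L' a -> W a by move=> La; rewrite -[a]mulr1; apply: WZ.
have rW : is_subring W.
  split=> // x y Wx Wy; apply: WD => //; rewrite -mulN1r; apply: WZ => //.
  by apply: (subringN rL); apply: subring1.
suff LSW : LS T `<=` W by move=> x /LSW.
apply: adjoin_min => //; last first.
  by move=> x [c Tc <-]; apply: kW; apply: adjoin_gen; exists c.
apply/subfieldP; split=> // x Wx; have [->|x0] := eqVneq x 0; first by rewrite invr0.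
have /choice[c cP] : forall i, exists c, u c = b i.
  by move=> i; have [c _ Ec] := kS_sub_range (kb i); exists c.
have [q cq qP] := pinsep_common_exponent (fun i => u_pinsep (c i)).
have Lxq : L' (x ^+ q).
  have [d Ld ->] := Wx; rewrite (frobenius_sum (iota \o g) _ _ _ cq).
  apply: (subring_sum rL) => i _; rewrite exprMn; apply: (subringM rL).
    exact: (subringX rL).
  by rewrite -cP; apply: kL.
have -> : x^-1 = (x ^+ q)^-1 * x ^+ q.-1.
  rewrite -{1}(prednK (pnat_pchar_gt0 cq)) exprS invfM -mulrA mulVf ?mulr1 //.
  exact: expf_neq0.
by apply: WZ; [apply: subfieldV|apply: (subringX rW)].
Qed.

(** The map from the field B to the closure is injective, so that a basis of k(S')
    over k stays free over L. *)
Lemma field_degrees : is_field B -> forall S', finite_set S' ->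
  exists d : nat, degree_eq k' (kS S') d /\ degree_eq L' (LS S') d.
Proof.
move=> [_ fieldB] S' /finite_seqP[s ->]; have [h hP] := exists_mult_map.
have h_inj x : h x = 0 -> x = 0.
  move=> hx; apply: contrapT => /fieldB[y xy].
  by have /eqP := congr1 h xy; rewrite rmorphM hx mul0r rmorph1 eq_sym oner_eq0.
have us : u @` [set` s] = [set` map u s].
  apply/seteqP; split=> [_ [c cs <-]|_ /mapP[c cs ->]]; last by exists c.
  exact: map_f.
have [|d deg] := @pinsep_degree _ _ (iota \o g) (map u s).
  by move=> _ /mapP[c _ ->]; apply: u_pinsep.
rewrite -us in deg; exists d; split=> //; apply/degree_eqP.
have /degree_eqP[b [kb spb frb]] := deg; exists b; split=> [i||].
- by apply: kS_sub_LS; apply: kb.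
- exact: spans_LS.
have /choice[c cP] : forall i, exists c, u c = b i.
  by move=> i; have [c _ Ec] := kS_sub_range (kb i); exists c.
have frc : free_over (range (to_pinsep f)) [set: 'I_d] c.
  apply/(free_over_morph u); rewrite u_range_base.
  by have -> : u \o c = b by apply/funext => i; apply: cP.
move=> e Le e0 i iT; have /choice[l lP] : forall i, exists l, iota l = e i.
  by move=> j; have [l _ El] := Le j; exists l.
rewrite -lP (tensor_free (g := g) frc (l := l) _ iT) ?rmorph0 //.
apply: h_inj; rewrite rmorph_sum -[RHS]e0; apply: eq_bigr => j _.
by rewrite hP cP lP mulrC.
Qed.

(** The change-of-basis matrices satisfy D C = 1 by freeness of the second family,
    hence C D = 1. *)
Lemma spanning_free n (b e : 'I_n -> F) :
  (forall i, exists2 c : 'I_n -> F, forall j, L' (c j) & b i = \sum_j c j * e j) ->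
  (forall i, exists2 c : 'I_n -> F, forall j, L' (c j) & e i = \sum_j c j * b j) ->
  free_over L' [set: 'I_n] e -> free_over L' [set: 'I_n] b.
Proof.
have lift (x y : 'I_n -> F) :
    (forall i, exists2 c : 'I_n -> F, forall j, L' (c j) & x i = \sum_j c j * y j) ->
    exists C : 'M[L]_n, forall i, x i = \sum_j iota (C i j) * y j.
  move=> xy; have /choice[C CP] : forall p : 'I_n, exists c : 'I_n -> L,
      x p = \sum_j iota (c j) * y j.
    move=> i; have [c Lc ->] := xy i.
    have /choice[d dP] : forall j, exists d, iota d = c j.
      by move=> j; have [d _ Ed] := Lc j; exists d.
    by exists d; apply: eq_bigr => j _; rewrite dP.
  exists (\matrix_(i, j) C i j) => i; rewrite CP.
  by apply: eq_bigr => j _; rewrite mxE.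
have sumT (G : 'I_n -> F) : \sum_(i in [set: 'I_n]%SET) G i = \sum_i G i.
  by apply: eq_bigl => i; rewrite inE.
move=> /lift[C bE] /lift[D eE] fre.
have DC : D *m C = 1%:M.
  apply/matrixP => i j; apply: (fmorph_inj iota).
  apply/eqP; rewrite -subr_eq0; apply/eqP.
  apply: (fre (fun j => iota ((D *m C) i j) - iota ((1%:M : 'M_n) i j))) => [l||].
  - by rewrite -rmorphB; exists ((D *m C) i l - (1%:M : 'M_n) i l).
  - rewrite sumT; under eq_bigr do rewrite mulrBl.
    rewrite sumrB.
    have -> : \sum_(l < n) iota ((1%:M : 'M_n) i l) * e l = e i.
      rewrite (bigD1 i) //= mxE eqxx rmorph1 mul1r big1 ?addr0 // => l /negPf li.
      by rewrite mxE eq_sym li rmorph0 mul0r.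
    apply/eqP; rewrite subr_eq0; apply/eqP; rewrite [RHS]eE.
    under [RHS]eq_bigr do rewrite bE mulr_sumr.
    rewrite exchange_big /=; apply: eq_bigr => l _.
    rewrite mxE rmorph_sum mulr_suml; apply: eq_bigr => m _.
    by rewrite rmorphM mulrA.
  - by rewrite inE.
move=> c Lc; rewrite sumT => c0 i _.
have /choice[d dP] : forall i, exists d, iota d = c i.
  by move=> j; have [d _ Ed] := Lc j; exists d.
pose r : 'rV[L]_n := \row_j d j.
have rC : r *m C = 0.
  apply/rowP => j; rewrite [RHS]mxE; apply: (fmorph_inj iota); rewrite rmorph0.
  apply: (fre (fun j => iota ((r *m C) 0 j))) => [l||].
  - by exists ((r *m C) 0 l).
  - rewrite sumT -[RHS]c0; under [RHS]eq_bigr do rewrite bE mulr_sumr.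
    rewrite exchange_big /=; apply: eq_bigr => l _.
    rewrite mxE rmorph_sum mulr_suml; apply: eq_bigr => m _.
    by rewrite mxE rmorphM dP mulrA.
  - by rewrite inE.
have r0 : r = 0 by rewrite -[r]mulmx1 -(mulmx1C DC) mulmxA rC mul0mx.
rewrite -dP; have := congr1 (fun m : 'rV_n => m 0 i) r0; rewrite !mxE => ->.
by rewrite rmorph0.
Qed.

(** An element x of K_i in L(S') lies in k(S'') for a larger S''. A basis of k(S'')
    over k is free over L, as the degrees agree. In such coordinates, expressing x
    by a basis of k(S') is a linear system with coefficients in k; it is solvable
    over L, hence over k. *)
Lemma degrees_intersection (S : set Ki) :
  adjoin (range (to_pinsep f)) S = setT ->
  (forall S', finite_set S' -> S' `<=` S ->
     exists d : nat, degree_eq k' (kS S') d /\ degree_eq L' (LS S') d) ->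
  forall S', finite_set S' -> S' `<=` S -> range u `&` LS S' = kS S'.
Proof.
move=> genS deg S' finS' S'S; apply/seteqP; split=> [x [[y _ <-] LSx]|x kx]; last first.
  by split; [apply: kS_sub_range kx|apply: kS_sub_LS].
have : adjoin (range (to_pinsep f)) S y by rewrite genS.
move=> /adjoin_finite[s sS sy].
pose S'' := S' `|` [set` s].
have [d [/degree_eqP[b' [kb' spb' _]] _]] := deg S' finS' S'S.
have [n [/degree_eqP[b [kb spb _]] /degree_eqP[e [Le spe fre]]]] : exists n : nat,
    degree_eq k' (kS S'') n /\ degree_eq L' (LS S'') n.
  apply: deg; last by move=> c [/S'S|/sS].
  by rewrite finite_setU; split=> //; apply: finite_seq.
have spbL := spans_LS kb spb.
have frb : free_over L' [set: 'I_n] b.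
  apply: (spanning_free (e := e)) => // i; last exact: spbL.
  by apply: spe; apply: kS_sub_LS.
have kSS : kS S' `<=` kS S''.
  by apply: adjoin_mono => // _ [c S'c <-]; exists c => //; left.
have kx : kS S'' (u y).
  by apply: u_adjoin; apply: adjoin_mono sy => // c cs; right.
have lift (z : F) : kS S'' z -> exists c : 'I_n -> k, z = \sum_i iota (g (c i)) * b i.
  move=> /spb[c kc ->]; have /choice[d' dP] : forall i, exists d, iota (g d) = c i.
    by move=> j; have [d' _ Ed] := kc j; exists d'.
  by exists d'; apply: eq_bigr => i _; rewrite dP.
have [c xE] := lift _ kx.
have /choice[M ME] : forall j, exists m : 'I_n -> k, b' j = \sum_i iota (g (m i)) * b i.
  by move=> j; apply: lift; apply: kSS.
have [l Ll xl] := spans_LS kb' spb' LSx.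
have /choice[l' lP] : forall j, exists l', iota l' = l j.
  by move=> j; have [l' _ El] := Ll j; exists l'.
have sol : map_mx g (\row_i c i) = (\row_j l' j) *m map_mx g (\matrix_(j, i) M j i).
  apply/rowP => i; rewrite !mxE; apply: (fmorph_inj iota).
  apply/eqP; rewrite -subr_eq0 -rmorphB; apply/eqP.
  apply: (frb (fun i => iota (g (c i) - \sum_j (\row_j l' j) 0 j *
    (map_mx g (\matrix_(j, i) M j i)) j i))) => [i'||]; last by rewrite inE.
    by eexists.
  under eq_bigl do rewrite inE.
  under eq_bigr do rewrite rmorphB mulrBl.
  rewrite sumrB -xE xl; apply/eqP; rewrite subr_eq0; apply/eqP.
  under eq_bigr do rewrite ME mulr_sumr.
  rewrite exchange_big /=; apply: eq_bigr => i' _.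
  rewrite rmorph_sum mulr_suml; apply: eq_bigr => j _.
  by rewrite !mxE rmorphM lP mulrA.
have : (\row_i c i <= \matrix_(j, i) M j i)%MS.
  by rewrite -(map_submx g) sol submxMl.
move=> /submxP[w wE]; rewrite xE.
have -> : \sum_i iota (g (c i)) * b i = \sum_j iota (g (w 0 j)) * b' j.
  under [RHS]eq_bigr do rewrite ME mulr_sumr.
  rewrite exchange_big /=; apply: eq_bigr => i _.
  have := congr1 (fun m : 'rV_n => m 0 i) wE; rewrite !mxE => ->.
  rewrite !rmorph_sum mulr_suml; apply: eq_bigr => j _.
  by rewrite mxE !rmorphM mulrA.
have rkS := subfield_subring (skS S').
apply: (subring_sum rkS) => j _; apply: (subringM rkS) => //.
by apply: adjoin_base; exists (w 0 j).
Qed.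

(** Adjoin one t of S at a time. The minimal polynomial of t over L(S') is a power
    of X - t, so that its degree is at least some Frobenius exponent a for which
    t^a lies in L(S'), that is, in k(S'). So it has the degree of the minimal
    polynomial of t over k(S'). *)
Lemma intersection_free (S : set Ki) (J : finType) (D : {set J}) (d : J -> L)
    (s : seq Ki) :
  (forall S', finite_set S' -> S' `<=` S -> range u `&` LS S' = kS S') ->
  free_over (range g) D d -> [set` s] `<=` S ->
  free_over (kS [set` s]) D (iota \o d).
Proof.
move=> meet frd; elim: s => [|t s IH] sS.
  have -> : u @` [set` [::]] = set0 by apply/seteqP; split=> // x [c].
  rewrite adjoin0 //; have -> : k' = iota @` range g.
    apply/seteqP; split=> [_ [a _ <-]|_ [_ [a _ <-] <-]]; last by exists a.
    by exists (g a) => //; exists a.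
  exact/free_over_morph.
have sS' : [set` s] `<=` S by move=> c cs; apply: sS; rewrite /= in_cons cs orbT.
have meet_s := meet _ (finite_seq s) sS'.
have -> : kS [set` t :: s] = adjoin (kS [set` s]) [set u t].
  rewrite adjoin_adjoin; congr adjoin; apply/seteqP; split.
    move=> _ [c /= cts <-]; move: cts.
    rewrite in_cons => /orP[/eqP ->|cs]; first by right.
    by left; exists c.
  by move=> _ [[c cs <-]|->]; [exists c|exists t] => //=;
    rewrite in_cons ?cs ?orbT ?eqxx.
set E := kS [set` s]; set M := LS [set` s]; set x := u t.
have EM : E `<=` M by apply: kS_sub_LS.
have sE : is_subfield E := skS _; have sM : is_subfield M := sLS _.
have rE := subfield_subring sE; have rM := subfield_subring sM.
have LM : L' `<=` M by apply: adjoin_base.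
pose hit n := ([pchar k].-nat n) && `[< E (x ^+ n) >].
have ex : exists n, hit n.
  have [n cn [a Ea]] := u_pinsep t; exists n; rewrite /hit cn; apply/asboolP.
  by rewrite Ea; apply: adjoin_base; exists a.
case: (ex_minnP ex) => q /andP[cq /asboolP Exq] minq.
have q_gt0 := pnat_pchar_gt0 cq.
pose h := 'X^q - (x ^+ q)%:P : {poly F}.
have Eh : poly_over E h.
  by apply: (subringB (poly_over_subring rE)); [apply: poly_overXn|apply: poly_overC].
have hE : h = ('X - x%:P) ^+ q.
  by rewrite (frobeniusB (polyC \o (iota \o g))) // -polyC_exp.
have mh : h \is monic by apply: monicXnsubC.
have ht : root h x by rewrite /root hornerD hornerN hornerXn hornerC subrr.
apply: (free_over_adjoin (h := h) sE (IH sS')) => //; first by right.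
move=> r rE' rt; have Mr : poly_over M r.
  move=> n; have [c Ec ->] := rE' n; apply: (subring_sum rM) => j _.
  by apply: (subringM rM); [apply: EM|apply: LM; exists (d j)].
have [m minm] := exists_minimal_polynomial sM (poly_over_sub EM Eh) (monic_neq0 mh) ht.
have /(minimal_polynomialP _ _ sM)[mm Mm mx divm] := minm.
have := divm h (poly_over_sub EM Eh) ht; rewrite hE => /dvdp_exp_XsubCP[n [le_nq mE]].
have {}mE : m = ('X - x%:P) ^+ n.
  by apply/eqP; rewrite -eqp_monic // monic_exp ?monicXsubC.
have n_gt0 : (0 < n)%N.
  by rewrite lt0n; apply/eqP => n0; move: mx; rewrite mE n0 /root hornerC oner_eq0.
have [a [ca le_an Mxa]] : exists a, [/\ [pchar k].-nat a, (a <= n)%N & M (x ^+ a)].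
  by apply: (exp_XsubC_coef (iota \o g)) => //; rewrite -mE.
have Exa : E (x ^+ a).
  rewrite /E -meet_s; split=> //; exists (t ^+ a) => //.
  by rewrite rmorphXn.
have le_qa : (q <= a)%N by apply: minq; rewrite /hit ca; apply/asboolP.
have -> : q = n by apply/eqP; rewrite eqn_leq le_nq (leq_trans le_qa).
by rewrite -mE; apply: divm.
Qed.

(** K_i and L being linearly disjoint, the map from B to the closure is injective,
    and B is a domain. *)
Lemma intersection_field (S : set Ki) :
  adjoin (range (to_pinsep f)) S = setT ->
  (forall S', finite_set S' -> S' `<=` S -> range u `&` LS S' = kS S') ->
  is_field B.
Proof.
move=> genS meet; have [h hP] := exists_mult_map.
have h_inj x : h x = 0 -> x = 0.
  have [J [D [a [d [frd ->]]]]] := tensor_coordinates_r x => hx.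
  have [|s sS sa] := @adjoin_finite_seq _ (range (to_pinsep f)) S
    [seq a j | j <- enum J].
    by move=> c _; rewrite genS.
  have fr := intersection_free meet frd sS.
  apply: big1 => j jD; have ua0 : u (a j) = 0.
    apply: (fr (fun j => u (a j))) jD => [i|].
      by apply: u_adjoin; apply: sa; apply: map_f; rewrite mem_enum.
    by rewrite -[RHS]hx rmorph_sum; apply: eq_bigr => i _; rewrite hP.
  by rewrite (fmorph_inj u (etrans ua0 (esym (rmorph0 u)))) pure0l.
apply: domain_field; split; first exact: tensor_pinsep_neq0.
move=> x y xy; have /eqP := congr1 h xy; rewrite rmorphM rmorph0 mulf_eq0.
by case/orP => /eqP/h_inj ->; rewrite eqxx ?orbT.
Qed.

End InClosure.

(** * The equivalence *)

Theorem theorem2p4 (k K L : fieldType)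
  (f : {rmorphism k -> K}) (g : {rmorphism k -> L})
  (noethKL : noetherian (tensor f g))
  (Ks : set K) (maxKs : maximal_separable f Ks)
  (KsKi : adjoin Ks (pinsep_closure f) = setT)
  (S : set (pinsep_field f)) (genS : adjoin (range (to_pinsep f)) S = setT)
  (Lbar : closedFieldType) (iota : {rmorphism L -> Lbar})
  (algLbar : forall z : Lbar, algebraicOver iota z)
  (u : {rmorphism pinsep_field f -> Lbar})
  (u_base : forall a : k, u (to_pinsep f a) = iota (g a)) :
  let kS (S' : set (pinsep_field f)) : set Lbar := adjoin (range (iota \o g)) (u @` S') in
  let LS (S' : set (pinsep_field f)) : set Lbar := adjoin (range iota) (u @` S') in
  [<-> regular_ring (tensor f g);
       is_domain (tensor (to_pinsep f) g);
       is_field (tensor (to_pinsep f) g);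
       forall S' : set (pinsep_field f), finite_set S' -> S' `<=` S ->
         exists d : nat, degree_eq (range (iota \o g)) (kS S') d /\
                         degree_eq (range iota) (LS S') d;
       forall S' : set (pinsep_field f), finite_set S' -> S' `<=` S ->
         range u `&` LS S' = kS S'].
Proof.
have [[sKs fKs] sepKs _] := maxKs => kS LS; tfae.
- by move=> regA; apply: regular_reduced noethKL regA (tensor_pinsep_neq0 u_base).
- exact: domain_field.
- by move=> fieldB S' finS' _; apply: (field_degrees u_base fieldB).
- exact: (degrees_intersection u_base genS).
move=> meet; apply: (pinsep_field_regular noethKL sKs fKs sepKs KsKi).
exact: (intersection_field u_base genS meet).
Qed.
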